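(* Suppose that $\alpha>1$ and $\kappa\in(1/2,1]$ satisfy $\alpha>\frac{\kappa}{3\kappa+4}+5\kappa+\frac72$. Then for any $t>0$, $K\in(0,\infty)$ and $E<\frac{\kappa}{2(3\kappa+4)(\kappa+2)}$, $$\mathbb E\left[\sup_{|x|\le K}\bigl|p(t,0,x)-p_n(t,0,\lfloor nx\rfloor/n)\bigr|\right]\lesssim n^{-E}.$$ In particular, if $\alpha>\frac{121}{14}$, then $$\mathbb E\left[\sup_{|x|\le K}\bigl|p(t,0,x)-p_n(t,0,\lfloor nx\rfloor/n)\bigr|\right]\lesssim n^{-E}$$ for any $K\in(0,\infty)$ and $E<\frac1{42}$.
   Context: One-dimensional Bouchaud trap model. $(\tau_x)_{x\in\mathbb Z}$ are i.i.d. random variables on a probability space with probability $\mathbb P$ and expectation $\mathbb E$, with $\mathbb P(\tau_0\ge u)=u^{-\alpha}$ for $u>1$. For a realization of $(\tau_x)$, put $\mu_n=\frac1n\sum_{x\in\mathbb Z}\tau_x\delta_{x/n}$ on $n^{-1}\mathbb Z$ and $\mu=\mathbb E[\tau_0]\,dx$ on $\mathbb R$. $X^n$ is the Markov process associated with $n^{-1}\mathbb Z$ equipped with the Euclidean metric (as resistance metric) and $\mu_n$, i.e. the continuous-time chain with generator $\Delta_nf(x/n)=\frac{n^2}{\tau_x}\sum_{y:|y-x|=1}(f(y/n)-f(x/n))$. $X$ is the process associated with $\mathbb R$ with the Euclidean metric and $\mu$, i.e. the diffusion with generator $\frac1{\mathbb E[\tau_0]}\frac{d^2}{dx^2}$.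 $p(t,x,y)$ and $p_n(t,x,y)$ are the transition densities (heat kernels) of $X$ and $X^n$ with respect to $\mu$ and $\mu_n$ respectively. $\lesssim$ means inequality for all $n\ge1$ up to a deterministic constant in $(0,\infty)$ independent of $n$ (it may depend on $\alpha,\kappa,t,K,E$). *)

(* Defs.v *)
From HB Require Import structures.
From mathcomp Require Import all_boot all_order all_algebra.
From mathcomp Require Import all_classical all_reals all_analysis.
From mathcomp Require Import measurable_realfun.
Set Implicit Arguments.
Unset Strict Implicit.
Unset Printing Implicit Defensive.
Import Order.TTheory GRing.Theory Num.Theory.
Import numFieldNormedType.Exports.
Local Open Scope classical_set_scope.
Local Open Scope ring_scope.

(** ** Feller processes on a closed set [S] of the real line

    A process with state space [S] is given by its transition function
    [Q t x A], the probability of being in [A] at time [t] when started at [x].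
    The values [Q t x] with [t < 0] or [x] outside [S] play no role. *)

Section feller_process.
Variable R : realType.
Implicit Types (S : set R) (f g : R -> R).
Implicit Types Q : R -> R -> probability (measurableTypeR R) R.

(* The space C_0(S), for [S] closed; functions matter only through their
   restriction to [S]. *)
Definition C0 S f : Prop :=
  {within S, continuous f} /\
  (forall e : R, 0 < e -> exists M : R, forall x, S x -> M < `|x| -> `|f x| < e).

Definition semigroup S Q (t : R) f (x : R) : R :=
  Rintegral (Q t x) S f.

Definition is_transition_function S Q : Prop :=
  [/\ (forall t x : R, 0 <= t -> S x -> Q t x S = 1%E),
      (forall (x : R) (A : set (measurableTypeR R)), S x -> measurable A ->
         Q 0 x A = \d_x A),
      (forall (t : R) (A : set (measurableTypeR R)), 0 <= t -> measurable A ->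
         measurable_fun (S : set (measurableTypeR R)) (fun x => Q t x A))
    & (forall (s t x : R) (A : set (measurableTypeR R)), 0 <= s -> 0 <= t ->
         S x -> measurable A ->
         Q (s + t) x A = (\int[Q s x]_(y in S) Q t y A)%E)].

(* [u t] tends to [g] uniformly on [S] as [t] decreases to 0. *)
Definition unif_cvg0 S (u : R -> R -> R) g : Prop :=
  forall e : R, 0 < e -> \forall t \near 0^'+, forall x, S x -> `|u t x - g x| < e.

Definition is_feller S Q : Prop :=
  [/\ is_transition_function S Q,
      (forall (t : R) f, 0 <= t -> C0 S f -> C0 S (semigroup S Q t f))
    & (forall f, C0 S f -> unif_cvg0 S (fun t => semigroup S Q t f) f)].

(* [L f g] reads "[f] is in the domain of [L], and [L f = g]".  The condition
   says that, as an unbounded operator on C_0(S), [L] is exactly the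
   infinitesimal generator of the semigroup, domain included. *)
Definition has_generator S Q (L : (R -> R) -> (R -> R) -> Prop) : Prop :=
  forall f g, C0 S f -> C0 S g ->
    (L f g <->
     unif_cvg0 S (fun t x => t^-1 * (semigroup S Q t f x - f x)) g).

(* Joint continuity selects the version of the density for which the pointwise
   values [p t x y] make sense. *)
Definition is_transition_density S (m : {measure set (measurableTypeR R) -> \bar R})
    Q (p : R -> R -> R -> R) : Prop :=
  [/\ (forall t x y : R, 0 < t -> S x -> S y -> 0 <= p t x y),
      {within [set z : R * R * R | [/\ 0 < z.1.1, S z.1.2 & S z.2]],
        continuous (fun z : R * R * R => p z.1.1 z.1.2 z.2)}
    & (forall (t x : R) (A : set (measurableTypeR R)), 0 < t -> S x ->
         measurable A -> A `<=` S ->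
         Q t x A = (\int[m]_(y in A) (p t x y)%:E)%E)].

Definition is_heat_kernel S L m p : Prop :=
  exists Q, [/\ is_feller S Q, has_generator S Q L
              & is_transition_density S m Q p].

End feller_process.

(** ** Weighted counting measures on the rescaled lattice *)

Section lattice_measure.
Context {R : realType} (n : nat) (w : int -> R).

(* The measure (1/n) sum_x w_x delta_{x/n}.  The absolute value only serves to
   have a measure for every [w]; below, [w] is positive almost surely. *)
Definition lattice_measure (A : set (measurableTypeR R)) : \bar R :=
  (\esum_(x in [set x : int | A (x%:~R / n%:R)%R]) (`|w x| / n%:R)%:E)%E.

Let lattice_measure0 : lattice_measure set0 = 0%E.
Proof. by rewrite /lattice_measure esum_set0. Qed.

Let weight_ge0 x : (0 <= (`|w x| / n%:R)%:E)%E.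
Proof. by rewrite lee_fin divr_ge0. Qed.

Let lattice_measure_ge0 A : (0 <= lattice_measure A)%E.
Proof. exact: esum_ge0. Qed.

Let lattice_measure_sigma_additive : semi_sigma_additive lattice_measure.
Proof.
move=> F mF tF mUF.
have -> : lattice_measure (\bigcup_i F i) =
    (\sum_(0 <= i <oo) lattice_measure (F i))%E.
  rewrite /lattice_measure -nneseries_sum_bigcup//.
  apply/trivIsetP => i j _ _ ij; apply/seteqP; split=> // x [Fi Fj].
  by move/trivIsetP : tF => /(_ i j I I ij) /seteqP[+ _]; apply; split; eassumption.
by apply: is_cvg_nneseries => k _ _; exact: lattice_measure_ge0.
Qed.

HB.instance Definition _ := isMeasure.Build _ _ _ lattice_measure
  lattice_measure0 lattice_measure_ge0 lattice_measure_sigma_additive.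

End lattice_measure.

(** ** The Bouchaud trap model *)

Section bouchaud.
Context d (T : measurableType d) (R : realType) (Pr : probability T R).

Definition mutually_independent (tau : int -> {RV Pr >-> R}) : Prop :=
  forall (J : seq int) (B : int -> set (measurableTypeR R)),
    uniq J -> (forall x, measurable (B x)) ->
    Pr (\bigcap_(x in [set` J]) (tau x @^-1` B x)) =
    (\prod_(x <- J) Pr (tau x @^-1` B x))%E.

Definition identically_distributed (tau : int -> {RV Pr >-> R}) : Prop :=
  forall x (B : set (measurableTypeR R)), measurable B ->
    Pr (tau x @^-1` B) = Pr (tau 0%R @^-1` B).

Definition is_trap_environment (alpha : R) (tau : int -> {RV Pr >-> R}) : Prop :=
  [/\ mutually_independent tau, identically_distributed tau
    & (forall u, 1 < u ->
         Pr [set w | (u <= tau 0 w)%R] = (u `^ (- alpha))%:E)].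

Definition mean_trap (tau : int -> {RV Pr >-> R}) : R := fine ('E_Pr[tau 0%R])%E.

End bouchaud.

Section bouchaud_processes.
Variable R : realType.

Definition lattice (n : nat) : set R :=
  [set x | exists k : int, x = k%:~R / n%:R].

Definition btm_generator (n : nat) (w : int -> R) (f g : R -> R) : Prop :=
  forall x : int,
    g (x%:~R / n%:R) = n%:R ^+ 2 / w x *
      ((f ((x + 1)%:~R / n%:R) - f (x%:~R / n%:R)) +
       (f ((x - 1)%:~R / n%:R) - f (x%:~R / n%:R))).

Definition is_btm_heat_kernel (n : nat) (w : int -> R) (p : R -> R -> R -> R) :=
  is_heat_kernel (lattice n) (btm_generator n w) (lattice_measure n w) p.

Definition diffusion_generator (c : R) (f g : R -> R) : Prop :=
  [/\ (forall x : R, derivable f x 1), (forall x : R, derivable (derive1 f) x 1)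
    & (forall x : R, g x = c^-1 * derive1 (derive1 f) x)].

(* The reference measure is [c dx]; the absolute value has no effect, as [c]
   is the (positive) mean of a trap. *)
Definition is_limit_heat_kernel (c : R) (p : R -> R -> R -> R) :=
  is_heat_kernel setT (diffusion_generator c)
    (mscale `|c|%:nng (@lebesgue_measure R)) p.

Definition sup_error (t K : R) (n : nat) (p pn : R -> R -> R -> R) : \bar R :=
  ereal_sup [set (`|p t 0 x - pn t 0 ((Num.floor (n%:R * x))%:~R / n%:R)|)%:E
            | x in [set x : R | `|x| <= K]].

End bouchaud_processes.

(* Main.v *)
Require Import Defs.
From HB Require Import structures.
From mathcomp Require Import all_boot all_order all_algebra.
From mathcomp Require Import all_classical all_reals all_analysis.
From mathcomp Require Import measurable_realfun.
From mathcomp Require Import zify ring lra.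
Set Implicit Arguments.
Unset Strict Implicit.
Unset Printing Implicit Defensive.
Import Order.TTheory GRing.Theory Num.Theory.
Import numFieldNormedType.Exports.
Local Open Scope classical_set_scope.
Local Open Scope ring_scope.

(** The limit kernel [p t 0 x] is a Gaussian, so the task is to compare the
    heat kernel of the chain with a Gaussian, quantitatively in the
    environment. Put [q s y] for the value at time [s] of the heat kernel of
    the chain, started at 0, at the lattice point [y / n].

    The chain moves in one dimension and its speed measure dominates the uniform
    one, because all traps are at least 1. Nash's argument therefore applies with
    absolute constants: the Dirichlet form decays in time, [mass2_decay] bounds
    the [L^2] norm of [q], and consequently [q] is bounded and Hoelder continuous
    of order 1/2 at every positive time, uniformly in [n] and in the environment
    ([dirichlet_decay], [q_decay], [holder_le]).

    The environment enters only through the difference between the mean [c] of a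
    trap and the actual traps. The Gaussian of parameter [c] nearly solves the
    equation of the chain: when it is transported by the chain for a time [t],
    the defect is a discretisation error plus a sum of [(c - tau y)] against [q]
    times a smooth function ([generator_defect]). As [c - tau y] is the discrete
    derivative of the partial sums [M] of the centred traps, a summation by parts
    ([noise_bound]) bounds the sum by the energy of [q] and the weighted square
    norm of [M]. Integrating the defect in time ([chain_smoothing]) compares a
    Gaussian with the average of [q t] against a narrow Gaussian around [x], and
    the Hoelder bound ([smoothing_at_point]) removes the average. This gives
    [pointwise_error], for every environment with traps at least 1: with
    [kap = n^(-1/42)], the error is at most a constant times
    [kap + kap^(-37) * W], where [W] is the weighted square norm of [M / n].

    Finally, [alpha > 2] follows from either assumption on [alpha] and means that
    traps have a finite second moment. Independence makes them uncorrelated, the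
    partial sums grow diffusively, and the mean of [W] is of order
    [1 / n = kap^42] ([fluctuation_energy_mean]). The mean error is thus at most of order
    [n^(-1/42)], and every exponent [E] of the theorem is at most 1/42, as
    [kappa / (2 (3 kappa + 4) (kappa + 2))] increases up to [kappa = 1]. *)

(** * Integrating against a composition of kernels *)

Section chapman_kolmogorov.
Context {R : realType}.
Variables (D : set (measurableTypeR R)) (mu nu : probability (measurableTypeR R) R)
  (k : R -> probability (measurableTypeR R) R).
Hypothesis mD : measurable D.
Hypothesis mk : forall U : set (measurableTypeR R), measurable U ->
  measurable_fun D (fun y => k y U).
Hypothesis muD : mu D = 1%E.
Hypothesis nuE : forall U : set (measurableTypeR R), measurable U ->
  nu U = (\int[mu]_(y in D) k y U)%E.

(** Composition of kernels asks for a kernel from the whole line. Outside [D],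
    which [mu] does not charge, any probability will do. *)
Definition extended_kernel (z : unit * measurableTypeR R) :
    {measure set (measurableTypeR R) -> \bar R} :=
  if z.2 \in D then k z.2 else mu.

Let extended_kernel_measurable (U : set (measurableTypeR R)) : measurable U ->
  measurable_fun setT (extended_kernel ^~ U).
Proof.
move=> mU.
have -> : extended_kernel ^~ U =
    (fun y : measurableTypeR R => if y \in D then k y U else mu U) \o snd.
  by apply/funext => z; rewrite /extended_kernel /=; case: ifP.
apply: measurableT_comp => //.
have DE : (fun y => y \in D) @^-1` [set true] = D.
  by rewrite predeqE => y /=; split=> [/set_mem|/mem_set].
apply: measurable_fun_if => //.
- by apply: (measurable_fun_bool true); rewrite setTI DE.
- by rewrite setTI DE; exact: mk.
Qed.

HB.instance Definition _ := isKernel.Build _ _ _ _ R extended_kernel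
  extended_kernel_measurable.

Let extended_kernel_prob z : extended_kernel z setT = 1%E.
Proof. by rewrite /extended_kernel; case: ifP => _; exact: probability_setT. Qed.

HB.instance Definition _ := Kernel_isProbability.Build _ _ _ _ R extended_kernel
  extended_kernel_prob.

Definition constant_kernel (_ : unit) : {measure set (measurableTypeR R) -> \bar R} :=
  mu.

Let constant_kernel_measurable (U : set (measurableTypeR R)) : measurable U ->
  measurable_fun setT (constant_kernel ^~ U).
Proof. by move=> mU; exact: measurable_cst. Qed.

HB.instance Definition _ := isKernel.Build _ _ _ _ R constant_kernel
  constant_kernel_measurable.

Let constant_kernel_prob z : constant_kernel z setT = 1%E.
Proof. exact: probability_setT. Qed.

HB.instance Definition _ := Kernel_isProbability.Build _ _ _ _ R constant_kernel
  constant_kernel_prob.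

Lemma integral_full_set (m : probability (measurableTypeR R) R) (f : R -> \bar R) :
  m D = 1%E -> (forall z, 0 <= f z)%E -> measurable_fun (setT : set (measurableTypeR R)) f ->
  (\int[m]_z f z = \int[m]_(z in D) f z)%E.
Proof.
move=> mD1 f0 mf.
have mDC : m (~` D) = 0%E.
  by rewrite probability_setC// mD1 subee.
have mDC' : measurable (~` D) by exact: measurableC.
rewrite -(setvU D) ge0_integral_setU//=; last 2 first.
  by rewrite setvU.
  by apply/disj_setPS; rewrite setICl.
by rewrite null_set_integral ?add0e//; exact: measurable_funTS.
Qed.

(** The hypothesis on [nu] is this identity for indicators: it says that [nu] is
    the composition of [mu] with the kernel, and integration against a
    composition of kernels is iterated integration. *)
Lemma integral_chapman_kolmogorov (f : R -> \bar R) :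
  (forall z, 0 <= f z)%E -> measurable_fun (setT : set (measurableTypeR R)) f ->
  (\int[nu]_z f z = \int[mu]_(y in D) \int[k y]_z f z)%E.
Proof.
move=> f0 mf.
have mext (U : set (measurableTypeR R)) : measurable U ->
    measurable_fun (setT : set (measurableTypeR R)) (fun y => extended_kernel (tt, y) U).
  by move=> mU; exact: (measurable_fun_pair2 tt (extended_kernel_measurable mU)).
have := @integral_kcomp _ _ _ _ _ _ _ constant_kernel extended_kernel tt f f0 mf.
have -> : (\int[kcomp constant_kernel extended_kernel tt]_z f z = \int[nu]_z f z)%E.
  apply: eq_measure_integral => A mA _.
  rewrite /= /kcomp /constant_kernel.
  rewrite integral_full_set//; last exact: mext.
  rewrite nuE//; apply: eq_integral => y yD.
  by rewrite /extended_kernel /= yD.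
move=> ->.
rewrite integral_full_set//.
- by apply: eq_integral => y yD; rewrite /extended_kernel /= yD.
- by move=> z; exact: integral_ge0.
- exact: (measurable_fun_integral_kernel mext f0 mf).
Qed.

End chapman_kolmogorov.

(** * Calculus of Feller semigroups *)

Section derivative_tools.
Context {R : realType}.

(** The derivative of a semigroup comes out of estimates as a first-order
    expansion with a multiplicative error; this is the bridge to [is_derive]. *)
Lemma is_derive_expansion (f : R -> R) (s l : R) :
  (forall e, 0 < e -> exists2 d, 0 < d &
     forall k, `|k| < d -> `|f (s + k) - f s - k * l| <= e * `|k|) ->
  is_derive s 1 f l.
Proof.
move=> H.
have : (fun h => h^-1 *: ((f \o shift s) (h *: 1) - f s)) @ 0^' --> l.
  apply/cvgrPdist_le => e e0.
  have [d d0 Hd] := H e e0.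
  near=> h.
  have h0 : h != 0 by near: h; exact: nbhs_dnbhs_neq.
  have hd : `|h| < d.
    near: h; apply: nbhs_dnbhs; apply/nbhs_ballP; exists d => //= y.
    by rewrite /ball /= sub0r normrN.
  have := Hd h hd.
  rewrite /= /shift /= (_ : h *: 1 = h); last by rewrite -[_ *: _]/(_ * _) mulr1.
  rewrite -[_ *: _]/(_ * _) (addrC s).
  have -> : f (h + s) - f s - h * l = - h * (l - h^-1 * (f (h + s) - f s)).
    by field.
  by rewrite normrM normrN mulrC ler_pM2r ?normr_gt0.
move=> cv; apply: DeriveDef; first by apply/cvg_ex; exists l.
exact/cvg_lim.
Unshelve. all: by end_near. Qed.

Lemma unif_cvg0P (S : set R) (u : R -> R -> R) g : unif_cvg0 S u g ->
  forall e, 0 < e -> exists2 d, 0 < d &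
    forall k x, 0 < k -> k < d -> S x -> `|u k x - g x| <= e.
Proof.
move=> H e e0; have := H e e0.
rewrite /at_right /within /= => /nbhs_ballP[d /= d0 Hd]; exists d => // k x k0 kd Sx.
by apply/ltW/Hd => //=; rewrite /ball /= sub0r normrN gtr0_norm.
Qed.

End derivative_tools.

Section feller_calculus.
Context {R : realType}.
Variables (S : set R) (Q : R -> R -> probability (measurableTypeR R) R).
Hypothesis mS : measurable (S : set (measurableTypeR R)).
Hypothesis QF : is_feller S Q.

Local Notation P := (semigroup S Q).
Implicit Types (f g : R -> R) (s t x y a e B : R).

(** On a closed set every [C0] function is bounded, but carrying the bound along
    gives integrability at no cost, and all test functions below are explicit. *)
Definition bounded_C0 (f : R -> R) :=
  C0 S f /\ exists B, forall x, S x -> `|f x| <= B.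

Lemma bounded_C0_measurable f : bounded_C0 f ->
  measurable_fun (S : set (measurableTypeR R)) f.
Proof. by move=> [[cf _] _]; exact: subspace_continuous_measurable_fun. Qed.

Let QT t x : 0 <= t -> S x -> Q t x S = 1%E.
Proof. by case: QF => -[+ _ _ _] _ _; exact. Qed.

Lemma bounded_integrable t x f B :
  measurable_fun (S : set (measurableTypeR R)) f ->
  (forall x, S x -> `|f x| <= B) -> (Q t x).-integrable S (EFin \o f).
Proof.
move=> mf fB; apply: (@le_integrable _ _ _ (Q t x) S mS _ (cst B%:E)) => //.
- exact/measurable_EFinP.
- by move=> y Sy /=; rewrite lee_fin (le_trans (fB _ Sy))// ler_norm.
- apply/integrableP; split=> //=.
  rewrite integral_cst//= (@le_lt_trans _ _ (`|B|%:E * 1)%E)//; last by rewrite mule1 ltry.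
  by rewrite lee_wpmul2l// ?lee_fin// probability_le1.
Qed.

Lemma C0_integrable t x f : bounded_C0 f -> (Q t x).-integrable S (EFin \o f).
Proof.
move=> bf; have [_ [B fB]] := bf.
by apply: (@bounded_integrable t x f B) => //; exact: bounded_C0_measurable.
Qed.

Let Rintegral_full_cst t x B : 0 <= t -> S x -> \int[Q t x]_(y in S) B = B.
Proof.
move=> t0 Sx; rewrite Rintegral_cst//; have := congr1 fine (QT t0 Sx).
by move=> /= ->; rewrite mulr1.
Qed.

(** The semigroup is a contraction because each [Q t x] is a probability
    on [S]. *)
Lemma semigroup_le t x f B : 0 <= t -> S x ->
  measurable_fun (S : set (measurableTypeR R)) f ->
  (forall y, S y -> `|f y| <= B) -> `|P t f x| <= B.
Proof.
move=> t0 Sx mf fB.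
have intf := @bounded_integrable t x f B mf fB.
apply: (le_trans (le_normr_Rintegral mS intf)).
have -> : B = \int[Q t x]_(y in S) B by rewrite Rintegral_full_cst.
apply: le_Rintegral => //.
- exact: integrable_norm.
- apply: (@bounded_integrable _ _ _ `|B|) => //.
Qed.

Lemma semigroupD t x f g : bounded_C0 f -> bounded_C0 g ->
  P t (fun y => f y + g y) x = P t f x + P t g x.
Proof. by move=> bf bg; rewrite /semigroup RintegralD//; exact: C0_integrable. Qed.

Lemma semigroupB t x f g : bounded_C0 f -> bounded_C0 g ->
  P t (fun y => f y - g y) x = P t f x - P t g x.
Proof. by move=> bf bg; rewrite /semigroup RintegralB//; exact: C0_integrable. Qed.

Lemma semigroupZ t x a f : bounded_C0 f ->
  P t (fun y => a * f y) x = a * P t f x.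
Proof. by move=> bf; rewrite /semigroup RintegralZl//; exact: C0_integrable. Qed.

Lemma semigroup0 x f : S x -> bounded_C0 f -> P 0 f x = f x.
Proof.
move=> Sx bf; case: QF => -[_ Q0 _ _] _ _.
rewrite /semigroup /Rintegral.
have -> : (\int[Q 0 x]_(y in S) (f y)%:E = \int[@dirac _ (measurableTypeR R) x R]_(y in S) (f y)%:E)%E.
  by apply: eq_measure_integral => A mA _; exact: Q0.
rewrite integral_dirac//; last first.
  by apply/measurable_EFinP; exact: bounded_C0_measurable.
by rewrite diracE mem_set// mul1e.
Qed.

Lemma bounded_C0B f g : bounded_C0 f -> bounded_C0 g ->
  bounded_C0 (fun y => f y - g y).
Proof.
move=> [[cf f0] [A fA]] [[cg g0] [B gB]]; split; [split|].
- by move=> x; apply: cvgB; [exact: cf|exact: cg].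
- move=> e e0; have e2 : 0 < e / 2 by rewrite divr_gt0.
  have [M HM] := f0 _ e2; have [N HN] := g0 _ e2.
  exists (Num.max M N) => x Sx; rewrite gt_max => /andP[Mx Nx].
  rewrite (le_lt_trans (ler_normB _ _))// [ltRHS](splitr e).
  by rewrite ltrD ?HM ?HN.
- exists (A + B) => x Sx; rewrite (le_trans (ler_normB _ _))//.
  by rewrite lerD ?fA ?gB.
Qed.

Lemma bounded_C0Z a f : bounded_C0 f -> bounded_C0 (fun y => a * f y).
Proof.
move=> [[cf f0] [A fA]]; split; [split|].
- by move=> x; apply: cvgM; [exact: cvg_cst|exact: cf].
- move=> e e0; have e2 : 0 < e / (`|a| + 1) by rewrite divr_gt0// ltr_wpDl.
  have [M HM] := f0 _ e2; exists M => x Sx Mx.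
  rewrite normrM (@le_lt_trans _ _ ((`|a| + 1) * `|f x|))//.
    by rewrite ler_wpM2r// lerDl.
  by rewrite mulrC -ltr_pdivlMr ?HM// ltr_wpDl.
- by exists (`|a| * A) => x Sx; rewrite normrM ler_wpM2l ?fA.
Qed.

Lemma bounded_C0_semigroup t f : 0 <= t -> bounded_C0 f -> bounded_C0 (P t f).
Proof.
move=> t0 bf; have [cf [B fB]] := bf; split.
  by case: QF => _ + _; apply.
exists B => x Sx; apply: semigroup_le => //; exact: bounded_C0_measurable.
Qed.

Lemma semigroup_dist t x f g e : 0 <= t -> S x -> bounded_C0 f -> bounded_C0 g ->
  (forall y, S y -> `|f y - g y| <= e) -> `|P t f x - P t g x| <= e.
Proof.
move=> t0 Sx bf bg fg; rewrite -semigroupB//; apply: semigroup_le => //.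
by apply: bounded_C0_measurable; exact: bounded_C0B.
Qed.

Lemma semigroup_comp s t x f : 0 <= s -> 0 <= t -> S x -> bounded_C0 f ->
  P (s + t) f x = P s (P t f) x.
Proof.
move=> s0 t0 Sx bf; have [_ [B fB]] := bf.
have B0 : 0 <= B by exact: le_trans (fB _ Sx).
have mf := bounded_C0_measurable bf.
pose g := (fun y => (f y + B)%:E) \_ S.
have g0 y : (0 <= g y)%E.
  rewrite /g patchE; case: ifPn => // /set_mem Sy; rewrite lee_fin.
  by have := fB _ Sy; rewrite ler_norml => /andP[+ _]; lra.
have mg : measurable_fun (setT : set (measurableTypeR R)) g.
  apply/(measurable_restrictT (D := S : set (measurableTypeR R))) => //.
  by apply/measurable_EFinP; apply: measurable_funD.
have intE u y h : bounded_C0 h -> 0 <= u -> S y ->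
    (\int[Q u y]_(z in S) (h z + B)%:E = (P u h y + B)%:E)%E.
  move=> bh u0 Sy.
  have ic : (Q u y).-integrable S (EFin \o cst B).
    by apply: (@bounded_integrable _ _ _ `|B|).
  have ih := C0_integrable u y bh.
  rewrite -[LHS]fineK; last first.
    by apply: integrable_fin_num => //; exact: (integrableD mS ih ic).
  rewrite -/(Rintegral _ _ _) RintegralD// Rintegral_full_cst//.
case: QF => -[_ _ mQ CK] _ _.
have := @integral_chapman_kolmogorov R S (Q s x) (Q (s + t) x) (Q t) mS
  (fun U mU => mQ t U t0 mU) (QT s0 Sx) (fun U mU => CK s t x U s0 t0 Sx mU) g g0 mg.
rewrite /g -integral_mkcond intE//; last exact: addr_ge0.
under eq_integral => y /set_mem Sy do rewrite -integral_mkcond intE//.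
rewrite intE//; last exact: bounded_C0_semigroup.
by move=> [] /addIr.
Qed.

Lemma strong_continuity f e : bounded_C0 f -> 0 < e -> exists2 d, 0 < d &
  forall k x, 0 <= k -> k < d -> S x -> `|P k f x - f x| <= e.
Proof.
move=> bf e0; case: QF => _ _ /(_ f bf.1)/unif_cvg0P/(_ e e0)[d d0 Hd].
exists d => // k x; rewrite le_eqVlt => /predU1P[<-|k0] kd Sx.
  by rewrite semigroup0// subrr normr0 ltW.
exact: Hd.
Qed.

(** Strong continuity at time 0 is transported to time [s] by contraction; for an
    earlier time, the roles of the two times are exchanged. *)
Lemma semigroup_continuous s x f e : 0 <= s -> S x -> bounded_C0 f -> 0 < e ->
  exists2 d, 0 < d & forall k, `|k| < d -> 0 <= s + k ->
    `|P (s + k) f x - P s f x| <= e.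
Proof.
move=> s0 Sx bf e0; have [d d0 Hd] := strong_continuity bf e0.
exists d => // k kd sk; have [k0|k0] := leP 0 k.
  rewrite semigroup_comp//; apply: semigroup_dist => //.
    exact: bounded_C0_semigroup.
  by move=> y Sy; apply: Hd => //; rewrite -(ger0_norm k0).
have k0' : 0 <= - k by rewrite oppr_ge0 ltW.
have := semigroup_comp sk k0' Sx bf; rewrite addrK => ->.
rewrite distrC; apply: semigroup_dist => //; first exact: bounded_C0_semigroup.
by move=> y Sy; apply: Hd => //; rewrite -(ltr0_norm k0).
Qed.

Variable L : (R -> R) -> (R -> R) -> Prop.
Hypothesis QL : has_generator S Q L.

(** The generator is a limit from the right, uniform in space; uniformity is what
    allows the expansion to be transported by the contraction [P s]. *)
Lemma generator_expansion f g e : bounded_C0 f -> bounded_C0 g -> L f g -> 0 < e ->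
  exists2 d, 0 < d & forall k x, 0 < k -> k < d -> S x ->
    `|P k f x - f x - k * g x| <= e * k.
Proof.
move=> bf bg Lfg e0; have [H _] := QL bf.1 bg.1.
have [d d0 Hd] := unif_cvg0P (H Lfg) e0.
exists d => // k x k0 kd Sx; have := Hd k x k0 kd Sx.
have -> : P k f x - f x - k * g x = k * (k^-1 * (P k f x - f x) - g x).
  by field; rewrite gt_eqF.
by rewrite normrM gtr0_norm// (mulrC e) ler_pM2l.
Qed.

Variables (U V dU : R -> R -> R) (t0 x0 : R).
Hypothesis Sx0 : S x0.
Hypothesis bU : forall t, 0 < t -> bounded_C0 (U t).
Hypothesis bV : forall t, 0 < t -> bounded_C0 (V t).
Hypothesis bdU : forall t, 0 < t -> bounded_C0 (dU t).
Hypothesis LUV : forall t, 0 < t -> L (U t) (V t).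
Hypothesis expU : forall t e, 0 < t -> 0 < e -> exists2 d, 0 < d &
  forall k y, `|k| < d -> S y -> `|U (t + k) y - U t y - k * dU t y| <= e * `|k|.

Let D s := P s (U (t0 - s)) x0.

(** Both the semigroup and the test function move: in the increment of
    [P s (U (t0 - s))] the first contributes [V], the generator applied to [U],
    and the second contributes [- dU]. *)
Lemma semigroup_derive s : 0 < s -> s < t0 ->
  is_derive s 1 (fun r => semigroup S Q r (U (t0 - r)) x0)
    (P s (fun y => V (t0 - s) y - dU (t0 - s) y) x0).
Proof.
move=> s0 st; apply: is_derive_expansion => e e0.
pose t := t0 - s; have tp : 0 < t by rewrite subr_gt0.
rewrite semigroupB; [|exact: bV|exact: bdU].
have e4 : 0 < e / 4 by rewrite divr_gt0.
have [d1 d1p H1] := generator_expansion (bU tp) (bV tp) (LUV tp) e4.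
have [d2 d2p H2] := expU tp e4.
have [d3 d3p H3] := semigroup_continuous (ltW s0) Sx0 (bV tp) e4.
have [d4 d4p H4] := semigroup_continuous (ltW s0) Sx0 (bdU tp) e4.
exists (Num.min (Num.min d1 d2) (Num.min (Num.min d3 d4) (Num.min t s))).
  by rewrite !lt_min d1p d2p d3p d4p tp s0.
move=> k; rewrite !lt_min => /andP[/andP[k1 k2] /andP[/andP[k3 k4] /andP[kt ks]]].
have sk : 0 <= s + k by move: ks; rewrite ltr_norml; lra.
have tk : 0 < t - k by move: kt; rewrite ltr_norml; lra.
have tk' : 0 < t + k by move: kt; rewrite ltr_norml; lra.
have -> : t0 - (s + k) = t - k by rewrite /t; ring.
rewrite -/t.
(* the variation of the test function *)
have E2 a : 0 <= a -> `|P a (U (t - k)) x0 - P a (U t) x0 + k * P a (dU t) x0|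
    <= e / 4 * `|k|.
  move=> a0; rewrite -semigroupB; [|exact: bU..].
  rewrite -[k]opprK mulNr -semigroupZ; last exact: bdU.
  rewrite opprK -semigroupB; [|by apply: bounded_C0B; exact: bU|by apply: bounded_C0Z; exact: bdU].
  apply: semigroup_le => //.
    apply: bounded_C0_measurable; apply: bounded_C0B.
      by apply: bounded_C0B; exact: bU.
    by apply: bounded_C0Z; exact: bdU.
  by move=> y Sy; rewrite -(normrN k); apply: H2; rewrite ?normrN.
(* the variation of the semigroup *)
have E1 a h : 0 <= a -> 0 < h -> h < d1 ->
    `|P (a + h) (U t) x0 - P a (U t) x0 - h * P a (V t) x0| <= e / 4 * h.
  move=> a0 h0 hd; rewrite semigroup_comp//; [|exact: ltW|exact: bU].
  have bPU : bounded_C0 (P h (U t)) by apply: bounded_C0_semigroup; [exact: ltW|exact: bU].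
  rewrite -semigroupB; [|exact: bPU|exact: bU].
  rewrite -semigroupZ; last exact: bV.
  rewrite -semigroupB; [|by apply: bounded_C0B => //; exact: bU|by apply: bounded_C0Z; exact: bV].
  apply: semigroup_le => //.
    apply: bounded_C0_measurable; apply: bounded_C0B.
      by apply: bounded_C0B => //; exact: bU.
    by apply: bounded_C0Z; exact: bV.
  by move=> y Sy; exact: H1.
have E3 : `|k * (P (s + k) (V t) x0 - P s (V t) x0)| <= e / 4 * `|k|.
  by rewrite normrM mulrC ler_wpM2r// H3.
have E4 : `|k * (P (s + k) (dU t) x0 - P s (dU t) x0)| <= e / 4 * `|k|.
  by rewrite normrM mulrC ler_wpM2r// H4.
have := E2 _ sk; move: E3 E4.
have [k0|k0|->] := ltgtP k 0; last first.
- by move=> *; rewrite addr0 mul0r !subr0 subrr normr0 mulr0.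
- have := E1 s k (ltW s0) k0; rewrite -{1}(gtr0_norm k0) => /(_ k1).
  rewrite (gtr0_norm k0) !ler_norml.
  move=> /andP[a1 a2] /andP[b1 b2] /andP[c1 c2] /andP[d1' d2'].
  by clear - a1 a2 b1 b2 c1 c2 d1' d2'; apply/andP; split; lra.
- have nk0 : 0 < - k by rewrite oppr_gt0.
  have := E1 (s + k) (- k) sk nk0; rewrite -{1}(ltr0_norm k0) => /(_ k1).
  rewrite addrK (ltr0_norm k0) !ler_norml.
  move=> /andP[a1 a2] /andP[b1 b2] /andP[c1 c2] /andP[d1' d2'].
  by clear - a1 a2 b1 b2 c1 c2 d1' d2'; apply/andP; split; lra.
Qed.

Lemma semigroup_right_continuous e : 0 < t0 -> 0 < e -> exists2 d, 0 < d &
  forall s, 0 <= s -> s < d -> `|P s (U (t0 - s)) x0 - U t0 x0| <= e.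
Proof.
move=> t00 e0; have e2 : 0 < e / 2 by rewrite divr_gt0.
have [d1 d1p H1] := strong_continuity (bU t00) e2.
have [B HB] := (bdU t00).2.
have B0 : 0 <= B by exact: le_trans (HB _ Sx0).
have [d2 d2p H2] := expU t00 (@ltr01 R).
exists (Num.min (Num.min d1 d2) (Num.min t0 (e / 2 / (1 + B)))).
  by rewrite !lt_min d1p d2p t00 divr_gt0// ltr_pwDl.
move=> s s0; rewrite !lt_min => /andP[/andP[sd1 sd2] /andP[st se]].
have ts : 0 < t0 - s by rewrite subr_gt0.
have E1 := H1 s x0 s0 sd1 Sx0.
have E2 : `|P s (U (t0 - s)) x0 - P s (U t0) x0| <= e / 2.
  apply: semigroup_dist => //; [exact: bU|exact: bU|move=> y Sy].
  have := H2 (- s) y; rewrite normrN (ger0_norm s0) => /(_ sd2 Sy) H3.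
  have H4 := HB _ Sy; move: se; rewrite ltr_pdivlMr ?ltr_pwDl// => se.
  have H5 : `|s * dU t0 y| <= s * B by rewrite normrM (ger0_norm s0) ler_wpM2l.
  move: H3 H5; rewrite !ler_norml => /andP[? ?] /andP[? ?].
  by apply/andP; split; lra.
move: E1 E2; rewrite !ler_norml => /andP[? ?] /andP[? ?].
by apply/andP; split; lra.
Qed.

End feller_calculus.

(** * Derivatives and the Gaussian heat kernel *)

Section derivative_rules.
Context {R : realType}.
Implicit Types (f g : R -> R) (x a b : R).

Lemma derD f g x a b : is_derive x 1 f a -> is_derive x 1 g b ->
  is_derive x 1 (fun t => f t + g t) (a + b).
Proof. by move=> df dg; exact: is_deriveD. Qed.

Lemma derB f g x a b : is_derive x 1 f a -> is_derive x 1 g b ->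
  is_derive x 1 (fun t => f t - g t) (a - b).
Proof. by move=> df dg; exact: is_deriveB. Qed.

Lemma derM f g x a b : is_derive x 1 f a -> is_derive x 1 g b ->
  is_derive x 1 (fun t => f t * g t) (a * g x + f x * b).
Proof.
move=> df dg; have := @is_deriveM _ _ f g x 1 a b df dg.
by move=> /is_derive_eq; apply; rewrite -[_ *: _]/(_ * _) -[X in _ + X]/(_ * _) addrC (mulrC a).
Qed.

Lemma derc x a : is_derive x 1 (fun=> a) 0.
Proof. exact: is_derive_cst. Qed.

Lemma deri x : is_derive x 1 (fun t => t) 1.
Proof. exact: is_derive_id. Qed.

Lemma derZ f x a k : is_derive x 1 f a -> is_derive x 1 (fun t => k * f t) (k * a).
Proof.
move=> df; have := derM (derc x k) df; move=> /is_derive_eq; apply; by rewrite mul0r add0r.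
Qed.

Lemma derN f x a : is_derive x 1 f a -> is_derive x 1 (fun t => - f t) (- a).
Proof. by move=> df; exact: is_deriveN. Qed.

Lemma derV x : x != 0 -> is_derive x 1 (fun t => t^-1) (- x ^- 2).
Proof.
move=> x0; have := @is_deriveV R id x 1 1 x0 (deri x).
by move=> /is_derive_eq; apply; rewrite -[_ *: _]/(_ * _) mulr1.
Qed.

Lemma dercomp f g x a b : is_derive x 1 f a -> is_derive (f x) 1 g b ->
  is_derive x 1 (fun t => g (f t)) (b * a).
Proof. by move=> df dg; have := @is_derive1_comp _ g f x b a dg df. Qed.

Lemma der_expR f x a : is_derive x 1 f a ->
  is_derive x 1 (fun t => expR (f t)) (expR (f x) * a).
Proof. by move=> df; apply: dercomp df _; exact: is_derive_expR. Qed.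

Lemma der_sqr f x a : is_derive x 1 f a -> is_derive x 1 (fun t => f t ^+ 2) (2 * f x * a).
Proof. move=> df; have := derM df df; move=> /is_derive_eq; apply; ring. Qed.

Lemma der_continuous f df x : is_derive x 1 f df -> {for x, continuous f}.
Proof. by move=> [d _]; apply/differentiable_continuous/derivable1_diffP. Qed.

Lemma mean_value_le f df a b B : a <= b ->
  (forall x, a < x -> x < b -> is_derive x 1 f (df x)) ->
  (forall x, a < x -> x < b -> `|df x| <= B) ->
  {within `[a, b], continuous f} ->
  `|f b - f a| <= B * (b - a).
Proof.
rewrite le_eqVlt => /orP[/eqP->|ab] fd fB fc; first by rewrite !subrr normr0 mulr0.
have [x|x xab ->] := @MVT _ f df a b ab _ fc.
  by rewrite in_itv /= => /andP[? ?]; exact: fd.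
move: xab; rewrite in_itv /= => /andP[? ?].
by rewrite normrM (gtr0_norm (_ : 0 < b - a)) ?subr_gt0// ler_pM2r ?subr_gt0// fB.
Qed.

Lemma mean_value_upper f df a b : a <= b ->
  (forall x, a <= x -> x <= b -> is_derive x 1 f (df x)) ->
  forall e, (forall x, a <= x -> x <= b -> df x <= e) -> f b - f a <= e * (b - a).
Proof.
rewrite le_eqVlt => /orP[/eqP->|ab] fd e fe; first by rewrite !subrr mulr0.
have [x||x xab ->] := @MVT _ f df a b ab.
- by rewrite in_itv /= => /andP[? ?]; apply: fd; exact: ltW.
- apply: derivable_within_continuous => x; rewrite in_itv /= => /andP[ax xb].
  by have [] := fd x ax xb.
move: xab; rewrite in_itv /= => /andP[? ?].
by rewrite ler_pM2r ?subr_gt0//; apply: fe; exact: ltW.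
Qed.

Lemma mean_value_sym f df s r B :
  (forall x, `|x - s| <= r -> is_derive x 1 f (df x)) ->
  (forall x, `|x - s| <= r -> `|df x| <= B) ->
  forall k, `|k| <= r -> `|f (s + k) - f s| <= B * `|k|.
Proof.
move=> fd fB k kr.
have cont a b : s - r <= a -> b <= s + r -> {within `[a, b], continuous f}.
  move=> sa sb; apply: derivable_within_continuous => x; rewrite in_itv /= => /andP[ax xb].
  have dx : is_derive x 1 f (df x).
    by apply: fd; rewrite ler_norml; apply/andP; split; lra.
  by case: dx.
move: (kr); rewrite ler_norml => /andP[kr1 kr2].
have [k0|k0] := leP 0 k.
  have := @mean_value_le f df s (s + k) B.
  rewrite (_ : s + k - s = k); last by ring.
  rewrite (ger0_norm k0); apply.
  - by rewrite lerDl.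
  - by move=> x sx xk; apply: fd; rewrite ler_norml; apply/andP; split; lra.
  - by move=> x sx xk; apply: fB; rewrite ler_norml; apply/andP; split; lra.
  - by apply: cont; lra.
have := @mean_value_le f df (s + k) s B.
rewrite (_ : s - (s + k) = - k); last by ring.
rewrite (ltr0_norm k0) distrC; apply.
- by rewrite gerDl ltW.
- by move=> x sx xk; apply: fd; rewrite ler_norml; apply/andP; split; lra.
- by move=> x sx xk; apply: fB; rewrite ler_norml; apply/andP; split; lra.
- by apply: cont; lra.
Qed.

Lemma taylor_order1 f f1 f2 s r B :
  (forall x, `|x - s| <= r -> is_derive x 1 f (f1 x)) ->
  (forall x, `|x - s| <= r -> is_derive x 1 f1 (f2 x)) ->
  (forall x, `|x - s| <= r -> `|f2 x| <= B) ->
  forall k, `|k| <= r -> `|f (s + k) - f s - k * f1 s| <= B * `|k| * `|k|.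
Proof.
move=> d1 d2 fB k kr.
have := @mean_value_sym (fun x => f x - x * f1 s) (fun x => f1 x - f1 s) s `|k| (B * `|k|).
have -> : f (s + k) - f s - k * f1 s = f (s + k) - (s + k) * f1 s - (f s - s * f1 s) by ring.
apply => //.
- move=> x xk; have := derB (d1 x (le_trans xk kr)) (derM (deri x) (derc x (f1 s))).
  by move=> /is_derive_eq; apply; ring.
- move=> x xk; have := mean_value_sym d2 fB (le_trans xk kr); rewrite subrKC => /le_trans; apply.
  rewrite ler_wpM2l//; apply: le_trans (fB s _); first exact: normr_ge0.
  by rewrite subrr normr0 (le_trans _ kr).
Qed.

(** Differentiating in [h] reduces the claim to first-order expansions of [f1] at
    [z], in both directions. *)
Lemma second_difference f f1 f2 f3 z B :
  (forall x, is_derive x 1 f (f1 x)) -> (forall x, is_derive x 1 f1 (f2 x)) ->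
  (forall x, is_derive x 1 f2 (f3 x)) -> (forall x, `|f3 x| <= B) ->
  forall h, `|f (z + h) + f (z - h) - 2 * f z - h ^+ 2 * f2 z| <= 2 * B * `|h| ^+ 3.
Proof.
move=> d1 d2 d3 fB h.
pose u h := f (z + h) + f (z - h) - 2 * f z - h ^+ 2 * f2 z.
pose u1 h := f1 (z + h) - f1 (z - h) - 2 * h * f2 z.
have u0 : u 0 = 0 by rewrite /u addr0 subr0; ring.
have -> : 2 * B * `|h| ^+ 3 = 2 * B * `|h| ^+ 2 * `|h| by ring.
have := @mean_value_sym u u1 0 `|h| (2 * B * `|h| ^+ 2).
move=> /(_ _ _ h (lexx _)); rewrite u0 subr0 add0r; apply=> x xh.
- have dp := dercomp (derD (derc x z) (deri x)) (d1 (z + x)).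
  have dm := dercomp (derB (derc x z) (deri x)) (d1 (z - x)).
  have := derB (derB (derD dp dm) (derc x (2 * f z)))
    (derM (der_sqr (deri x)) (derc x (f2 z))).
  by move=> /is_derive_eq; apply; rewrite /u1; ring.
- rewrite subr0 in xh.
  have t1 := @taylor_order1 f1 f2 f3 z `|x| B (fun y _ => d2 y) (fun y _ => d3 y)
    (fun y _ => fB y) x (lexx _).
  have t2 := @taylor_order1 f1 f2 f3 z `|x| B (fun y _ => d2 y) (fun y _ => d3 y)
    (fun y _ => fB y) (- x).
  rewrite normrN in t2; move/(_ (lexx _)) : t2 => t2.
  have B0 : 0 <= B by exact: le_trans (fB 0).
  have xx : B * `|x| * `|x| <= B * `|h| ^+ 2.
    by rewrite -mulrA -expr2 ler_wpM2l// ler_sqr ?nnegrE.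
  move: t1 t2; rewrite /u1 !ler_norml => /andP[? ?] /andP[? ?].
  by apply/andP; split; lra.
Qed.

End derivative_rules.

Section gaussian.
Context {R : realType}.
Variable c : R.
Implicit Types t z x y : R.
Hypothesis c0 : 0 < c.

(** The factor [t^(-1/2)] of the Gaussian is kept inside the exponential, so that
    all derivatives are the Gaussian times a rational function. *)
Definition gexp t z : R := - (ln t / 2) - c * z ^+ 2 / 4 * t^-1.

(** The heat kernel of [c^-1 * d^2/dx^2] with respect to [c dx]; it solves
    [c * gauss_t = gauss_zz]. *)
Definition gauss t z : R := (Num.sqrt (4 * pi * c))^-1 * expR (gexp t z).
Definition gauss_z t z : R := gauss t z * (- (c * z / 2) * t^-1).
Definition gauss_t t z : R :=
  gauss t z * (- (t^-1 / 2) + c * z ^+ 2 / 4 * t ^- 2).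
Definition gauss_tz t z : R :=
  gauss t z * (- (c * z / 2) * t^-1 * (- (t^-1 / 2) + c * z ^+ 2 / 4 * t ^- 2)
               + c * z / 2 * t ^- 2).
Definition gauss_tt t z : R :=
  gauss t z * ((- (t^-1 / 2) + c * z ^+ 2 / 4 * t ^- 2) ^+ 2
               + (t ^- 2 / 2 - c * z ^+ 2 / 2 * t ^- 3)).

Lemma gauss_ge0 t z : 0 <= gauss t z.
Proof. by rewrite mulr_ge0 ?expR_ge0// invr_ge0 sqrtr_ge0. Qed.

Lemma derive_gexp_z t z : is_derive z 1 (gexp t) (- (c * z / 2) * t^-1).
Proof.
have := derB (derc z (- (ln t / 2)))
  (derM (derM (derZ c (der_sqr (deri z))) (derc z (4^-1))) (derc z t^-1)).
by move/is_derive_eq; apply; move: t^-1 (ln t) => i l; field.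
Qed.

Lemma derive_gauss_z t z : is_derive z 1 (gauss t) (gauss_z t z).
Proof.
have := derZ (Num.sqrt (4 * pi * c))^-1 (der_expR (derive_gexp_z t z)).
by move/is_derive_eq; apply; rewrite /gauss_z /gauss mulrA.
Qed.

Lemma derive_gexp_t t z : 0 < t ->
  is_derive t 1 (gexp^~ z) (- (t^-1 / 2) + c * z ^+ 2 / 4 * t ^- 2).
Proof.
move=> t0; have tn : t != 0 by rewrite gt_eqF.
have dln : is_derive t 1 (@ln R) t^-1 by exact: is_derive1_ln.
have := derB (derN (derM dln (derc t 2^-1))) (derZ (c * z ^+ 2 / 4) (derV tn)).
by move/is_derive_eq; apply; field.
Qed.

Lemma derive_gauss_t t z : 0 < t -> is_derive t 1 (gauss^~ z) (gauss_t t z).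
Proof.
move=> t0.
have := derZ (Num.sqrt (4 * pi * c))^-1 (der_expR (derive_gexp_t z t0)).
by move/is_derive_eq; apply; rewrite /gauss_t /gauss mulrA.
Qed.

Lemma derive_gauss_zz t z : t != 0 ->
  is_derive z 1 (gauss_z t) (c * gauss_t t z).
Proof.
move=> t0.
have := derM (derive_gauss_z t z) (derM (derN (derM (derZ c (deri z)) (derc z 2^-1))) (derc z t^-1)).
by move/is_derive_eq; apply; rewrite /gauss_z /gauss_t; field.
Qed.

Lemma derive_gauss_tz t z : t != 0 -> is_derive z 1 (gauss_t t) (gauss_tz t z).
Proof.
move=> t0.
have := derM (derive_gauss_z t z) (derD (derc z (- (t^-1 / 2)))
   (derM (derM (derZ c (der_sqr (deri z))) (derc z (4^-1))) (derc z (t ^- 2)))).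
by move/is_derive_eq; apply; rewrite /gauss_z /gauss_tz; field.
Qed.

Lemma derive_gauss_tt t z : 0 < t -> is_derive t 1 (gauss_t^~ z) (gauss_tt t z).
Proof.
move=> t0; have tn : t != 0 by rewrite gt_eqF.
have tn2 : t ^+ 2 != 0 by rewrite expf_neq0.
have dV2 := dercomp (der_sqr (deri t)) (derV tn2).
have := derM (derive_gauss_t z t0) (derD (derN (derM (derV tn) (derc t 2^-1)))
   (derZ (c * z ^+ 2 / 4) dV2)).
by move/is_derive_eq; apply; rewrite /gauss_t /gauss_tt; field.
Qed.

Lemma gauss_normal_pdf t x y : 0 < t ->
  c * gauss t (x - y) = normal_pdf x (Num.sqrt (2 * t / c)) y.
Proof.
move=> t0; have tn : t != 0 by rewrite gt_eqF.
have cn : c != 0 by rewrite gt_eqF.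
have sn : 0 < 2 * t / c by rewrite divr_gt0// mulr_gt0.
have pn : 0 < pi :> R by exact: pi_gt0.
have p0 : (pi : R) != 0 by rewrite gt_eqF.
rewrite normal_pdfE; last by rewrite gt_eqF// sqrtr_gt0.
rewrite /normal_peak /normal_fun sqr_sqrtr ?(ltW sn)//.
rewrite /gauss /gexp expRD !mulrA.
congr (_ * _); last by congr expR; field; rewrite tn cn.
have pos : 0 < c * (Num.sqrt (4 * pi * c))^-1 * expR (- (ln t / 2)).
  by rewrite !mulr_gt0 ?expR_gt0 ?invr_gt0 ?sqrtr_gt0 ?mulr_gt0.
apply/eqP; rewrite -(@eqrXn2 _ 2) ?(ltW pos) ?invr_ge0 ?sqrtr_ge0//; apply/eqP.
rewrite /normal_peak !exprMn !exprVn !sqr_sqrtr; last first.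
  by rewrite !mulr_ge0 ?ltW.
  by rewrite pmulrn_lge0// mulr_ge0 ?ltW.
rewrite -expRM_natl (_ : 2 * _ = - ln t); last by rewrite mulrN mulrC divfK.
rewrite expRN lnK ?posrE//; move: (@pi R) p0 => w w0; field.
by rewrite tn cn w0.
Qed.

(** Since [v * exp (- v) <= 1], a polynomial factor costs only a doubling of the
    variance. *)
Lemma gauss_moment t z : 0 < t ->
  z ^+ 2 * gauss t z <= 16 * t / c * gauss (2 * t) z.
Proof.
move=> t0; have tn : t != 0 by rewrite gt_eqF.
have cn : c != 0 by rewrite gt_eqF.
rewrite /gauss mulrCA [leRHS]mulrCA ler_wpM2l ?invr_ge0 ?sqrtr_ge0//.
set v := c * z ^+ 2 / 8 * t^-1.
have -> : gexp t z = gexp (2 * t) z + ln 2 / 2 - v.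
  by rewrite /gexp lnM ?posrE// /v; field.
have -> : z ^+ 2 = v * (8 * t / c) by rewrite /v; field; rewrite tn cn.
have -> : 16 * t / c = 2 * (8 * t / c) by field.
move: (gexp (2 * t) z) => g; rewrite !expRD.
have e1 : expR (ln 2 / 2) <= 2 :> R.
  rewrite -[leRHS]lnK ?posrE// ler_expR ler_pdivrMr// ler_peMr ?ler1n//.
  by rewrite ln_ge0// ler1n.
have e2 : v * expR (- v) <= 1.
  rewrite expRN ler_pdivrMr ?expR_gt0// mul1r.
  by apply: le_trans (expR_ge1Dx v); rewrite lerDr.
have k0 : 0 <= 8 * t / c * expR g.
  by rewrite mulr_ge0 ?expR_ge0// divr_ge0 ?mulr_ge0// ltW.
have -> : v * (8 * t / c) * (expR g * expR (ln 2 / 2) * expR (- v)) =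
    8 * t / c * expR g * (expR (ln 2 / 2) * (v * expR (- v))) by ring.
have -> : 2 * (8 * t / c) * expR g =
    8 * t / c * expR g * 2 by ring.
rewrite ler_wpM2l// (le_trans (ler_wpM2l (expR_ge0 _) e2))// mulr1.
exact: e1.
Qed.

Section gaussian_bounds.
Variable T : R.
Hypothesis T0 : 0 < T.

(** A constant such that [(1 + z^2)^4 * gauss t z <= gauss_cst / e] for
    [0 < e <= t <= T] and [e <= 1]. *)
Definition gauss_cst := (Num.sqrt (4 * pi * c))^-1 * (1 + 16 * T / c) ^+ 4.

Lemma gauss_cst_ge0 : 0 <= gauss_cst.
Proof.
rewrite mulr_ge0 ?invr_ge0 ?sqrtr_ge0 ?exprn_ge0//.
by rewrite addr_ge0 ?divr_ge0 ?mulr_ge0// ltW.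
Qed.

(** The exponential dominates the fourth power of [1 + c z^2 / (16 T)], by four
    uses of [1 + v <= exp v]. *)
Lemma gauss_decay e t z : 0 < e -> e <= 1 -> e <= t -> t <= T ->
  gauss t z <= gauss_cst / e * (1 + z ^+ 2) ^- 4.
Proof.
move=> e0 e1 et tT; have t0 : 0 < t by exact: lt_le_trans et.
have cn : c != 0 by rewrite gt_eqF.
have Tn : T != 0 by rewrite gt_eqF.
have z2 : 0 < 1 + z ^+ 2 by rewrite ltr_wpDr ?sqr_ge0.
rewrite /gauss /gauss_cst.
have -> (k m w : R) : k * m / e * w = k * (e^-1 * (m * w)) by ring.
rewrite ler_wpM2l ?invr_ge0 ?sqrtr_ge0// /gexp expRD.
have h1 : expR (- (ln t / 2)) <= e^-1.
  rewrite -[leRHS]lnK ?posrE ?invr_gt0// ler_expR lnV ?posrE// lerN2.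
  have [t1|t1] := leP 1 t.
    apply: (@le_trans _ _ 0); first exact: ln_le0.
    by rewrite divr_ge0// ln_ge0.
  apply: (@le_trans _ _ (ln t)); first by rewrite ler_ln ?posrE.
  have : ln t <= 0 by apply: ln_le0; exact: ltW.
  by lra.
apply: ler_pM; rewrite ?expR_ge0//.
rewrite expRN -[leLHS]mul1r ler_pdivrMr ?expR_gt0//.
set a := c / (4 * T).
have a0 : 0 < a by rewrite divr_gt0// mulr_gt0.
have z2' : 0 <= z ^+ 2 by exact: sqr_ge0.
have cz : 0 <= c * z ^+ 2 / 4 by rewrite divr_ge0// mulr_ge0// ltW.
have az : 0 <= a * z ^+ 2 / 4 by rewrite divr_ge0// mulr_ge0// ltW.
have Tc : 0 <= 16 * T / c by rewrite divr_ge0 ?mulr_ge0// ltW.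
have h2 : 1 + a * z ^+ 2 / 4 <= expR (a * z ^+ 2 / 4) by exact: expR_ge1Dx.
have h3 : expR (a * z ^+ 2 / 4) ^+ 4 <= expR (c * z ^+ 2 / 4 / t).
  rewrite -expRM_natl ler_expR.
  have -> : 4 * (a * z ^+ 2 / 4) = c * z ^+ 2 / 4 * T^-1.
    by rewrite /a; field.
  by rewrite ler_wpM2l// lef_pV2 ?posrE.
rewrite mulrAC ler_pdivlMr ?exprn_gt0// mul1r.
apply: (@le_trans _ _ ((1 + 16 * T / c) ^+ 4 * (1 + a * z ^+ 2 / 4) ^+ 4)).
  rewrite -exprMn; apply: lerXn2r; rewrite ?nnegrE ?(ltW z2)//.
    by rewrite mulr_ge0// addr_ge0.
  have -> : (1 + 16 * T / c) * (1 + a * z ^+ 2 / 4) =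
      1 + z ^+ 2 + (a * z ^+ 2 / 4 + 16 * T / c) by rewrite /a; field; rewrite cn Tn.
  by rewrite lerDl addr_ge0.
rewrite ler_wpM2l ?exprn_ge0 ?addr_ge0//.
rewrite (le_trans _ h3)//; apply: lerXn2r => //; rewrite nnegrE ?expR_ge0//.
by rewrite addr_ge0.
Qed.

End gaussian_bounds.

End gaussian.

(** * Gaussian estimates *)

Section gaussian_estimates.
Context {R : realType}.
Variable c : R.
Hypothesis c0 : 0 < c.
Implicit Types t x y z e : R.

(** The weight has to be summable against [|z|], as the squared fluctuations of
    the environment grow linearly, and to be beaten by the Gaussian and its
    derivatives. *)
Definition weight z : R := (1 + z ^+ 2) ^- 2.

Lemma weight_den_ge1 z : 1 <= 1 + z ^+ 2.
Proof. by rewrite lerDl sqr_ge0. Qed.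

Lemma weight_den_gt0 z : 0 < 1 + z ^+ 2.
Proof. exact: lt_le_trans ltr01 (weight_den_ge1 z). Qed.

Lemma weight_gt0 z : 0 < weight z.
Proof. by rewrite invr_gt0 exprn_gt0// weight_den_gt0. Qed.

Lemma weight_le1 z : weight z <= 1.
Proof. by rewrite invf_le1 ?exprn_gt0 ?weight_den_gt0// exprn_ege1// weight_den_ge1. Qed.

(** Moving the centre of the weight within [-K, K] costs a constant, which makes
    the later bounds uniform over that interval. *)
Lemma weight_shift K x y : `|x| <= K ->
  weight (x - y) <= 4 * (1 + K ^+ 2) ^+ 2 * weight y.
Proof.
move=> xK; have K0 : 0 <= K by exact: le_trans xK.
have x2 : x ^+ 2 <= K ^+ 2 by rewrite -(real_normK (num_real x)) ler_sqr ?nnegrE.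
rewrite /weight ler_pdivlMr ?exprn_gt0 ?weight_den_gt0//.
rewrite mulrC ler_pdivrMr ?exprn_gt0 ?weight_den_gt0//.
have -> : 4 * (1 + K ^+ 2) ^+ 2 * (1 + (x - y) ^+ 2) ^+ 2 =
  (2 * (1 + K ^+ 2) * (1 + (x - y) ^+ 2)) ^+ 2 by ring.
rewrite ler_sqr ?nnegrE ?(ltW (weight_den_gt0 _))//; last first.
  by rewrite !mulr_ge0// ltW// weight_den_gt0.
have h1 : y ^+ 2 <= 2 * x ^+ 2 + 2 * (x - y) ^+ 2.
  have := sqr_ge0 (x + (x - y)); lra.
have h2 : 0 <= K ^+ 2 * (x - y) ^+ 2 by rewrite mulr_ge0 ?sqr_ge0.
lra.
Qed.

Section bounds.
Variables T e : R.
Hypotheses (T0 : 0 < T) (e0 : 0 < e) (e1 : e <= 1).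

Definition gauss_bound := gauss_cst c T * (1 + c) ^+ 2 * 2.

Lemma gauss_bound_ge0 : 0 <= gauss_bound.
Proof. by rewrite mulr_ge0// mulr_ge0 ?gauss_cst_ge0 ?sqr_ge0. Qed.

(** Every derivative of the Gaussian is the Gaussian times a factor that grows at
    most like [(1 + z^2)^2]; four powers of decay absorb it and leave the
    weight. *)
Lemma gaussM_le t z p k : e <= t -> t <= T ->
  `|p| <= 2 * (1 + c) ^+ 2 * (1 + z ^+ 2) ^+ 2 / e ^+ k ->
  `|gauss c t z * p| <= gauss_bound / e ^+ k.+1 * weight z.
Proof.
move=> et tT pB; have t0 : 0 < t by exact: lt_le_trans et.
rewrite normrM (ger0_norm (gauss_ge0 c t z)).
have e0' : e != 0 by rewrite gt_eqF.
have w0 : 1 + z ^+ 2 != 0 by rewrite gt_eqF// weight_den_gt0.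
have -> : gauss_bound / e ^+ k.+1 * weight z =
  gauss_cst c T / e * (1 + z ^+ 2) ^- 4 *
  (2 * (1 + c) ^+ 2 * (1 + z ^+ 2) ^+ 2 / e ^+ k).
  rewrite /gauss_bound /weight (exprS e k); field.
  by rewrite w0 e0' expf_neq0.
by apply: ler_pM => //; [exact: gauss_ge0|exact: gauss_decay].
Qed.

Let inv_le t : e <= t -> t^-1 <= e^-1.
Proof. by move=> et; rewrite lef_pV2 ?posrE//; exact: lt_le_trans et. Qed.

Let abs_le z : `|z| <= 1 + z ^+ 2.
Proof.
by rewrite ler_norml; apply/andP; split;
  [have := sqr_ge0 (z + 1)|have := sqr_ge0 (z - 1)]; have := sqr_ge0 z; lra.
Qed.

Let ei1 : 1 <= e^-1. Proof. by rewrite invf_ge1. Qed.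

Let factor_z t z : e <= t -> `|- (c * z / 2) * t^-1| <= c / 2 * (1 + z ^+ 2) * e^-1.
Proof.
move=> et; have t0 : 0 < t by exact: lt_le_trans et.
rewrite normrM normrN [`|t^-1|]gtr0_norm ?invr_gt0//.
apply: ler_pM => //; rewrite ?invr_ge0 ?(ltW t0) ?inv_le//.
rewrite mulrAC normrM [`|c / 2|]ger0_norm ?divr_ge0 ?(ltW c0)//.
by rewrite ler_wpM2l// divr_ge0// ltW.
Qed.

Let factor_t t z : e <= t ->
  `|- (t^-1 / 2) + c * z ^+ 2 / 4 * t ^- 2| <= (1 + c) * (1 + z ^+ 2) * e^-1 ^+ 2.
Proof.
move=> et; have t0 : 0 < t by exact: lt_le_trans et.
have ti0 : 0 < t^-1 by rewrite invr_gt0.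
have h1 : t^-1 <= e^-1 ^+ 2.
  by rewrite (le_trans (inv_le et))// expr2 ler_peMl// (le_trans ler01).
have h2 : t ^- 2 <= e^-1 ^+ 2.
  rewrite -exprVn ler_sqr ?nnegrE ?(ltW ti0)//; [exact: inv_le|].
  exact: le_trans ler01 ei1.
have z2 : 0 <= z ^+ 2 by exact: sqr_ge0.
have h3 : c * z ^+ 2 * t ^- 2 <= c * z ^+ 2 * e^-1 ^+ 2.
  by rewrite ler_wpM2l// mulr_ge0// ltW.
have h4 : 0 <= c * z ^+ 2 * t ^- 2.
  by rewrite mulr_ge0 ?(mulr_ge0 (ltW c0))// invr_ge0 exprn_ge0// ltW.
have h5 : 0 <= z ^+ 2 * e^-1 ^+ 2 by rewrite mulr_ge0 ?sqr_ge0.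
have h6 : 0 <= c * e^-1 ^+ 2 by rewrite mulr_ge0 ?sqr_ge0// ltW.
by rewrite ler_norml; apply/andP; split; lra.
Qed.

Lemma gauss_le t z : e <= t -> t <= T ->
  `|gauss c t z| <= gauss_bound / e ^+ 4 * weight z.
Proof.
move=> et tT; rewrite -[gauss c t z]mulr1; apply: gaussM_le => //.
rewrite normr1 -exprVn.
have a1 : 1 <= (1 + c) ^+ 2 by rewrite exprn_ege1// lerDl ltW.
have a2 : 1 <= (1 + z ^+ 2) ^+ 2 by rewrite exprn_ege1// weight_den_ge1.
have a3 : 1 <= e^-1 ^+ 3 by rewrite exprn_ege1.
by rewrite mulr_ege1// mulr_ege1// mulr_ege1// ler1n.
Qed.

(* [c^i w^j e^-k] increases with each of the exponents up to [2, 2, 3] *)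
Let combine A i j k : 0 <= A -> A <= 2 -> (i <= 2)%N -> (j <= 2)%N -> (k <= 3)%N ->
  forall z, A * (1 + c) ^+ i * (1 + z ^+ 2) ^+ j * e^-1 ^+ k <=
   2 * (1 + c) ^+ 2 * (1 + z ^+ 2) ^+ 2 / e ^+ 3.
Proof.
move=> A0 A2 i2 j2 k3 z; rewrite -exprVn.
have cc : 1 <= 1 + c by rewrite lerDl ltW.
have ww := weight_den_ge1 z.
have cc0 : 0 <= 1 + c by exact: le_trans ler01 cc.
have ww0 : 0 <= 1 + z ^+ 2 by exact: le_trans ler01 ww.
have ei0 : 0 <= e^-1 by exact: le_trans ler01 ei1.
apply: ler_pM; rewrite ?mulr_ge0 ?exprn_ge0//; last exact: ler_weXn2l.
apply: ler_pM; rewrite ?mulr_ge0 ?exprn_ge0//; last exact: ler_weXn2l.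
by apply: ler_pM; rewrite ?exprn_ge0//; exact: ler_weXn2l.
Qed.

Lemma gauss_t_le t z : e <= t -> t <= T ->
  `|gauss_t c t z| <= gauss_bound / e ^+ 4 * weight z.
Proof.
move=> et tT; apply: gaussM_le => //; apply: (le_trans (factor_t z et)).
have := @combine 1 1 1 2 ler01 _ isT isT isT z.
by rewrite mul1r !expr1; apply; rewrite ler1n.
Qed.

Lemma gauss_z_le t z : e <= t -> t <= T ->
  `|gauss_z c t z| <= gauss_bound / e ^+ 4 * weight z.
Proof.
move=> et tT; apply: gaussM_le => //; apply: (le_trans (factor_z z et)).
have := @combine 1 1 1 1 ler01 _ isT isT isT z.
rewrite mul1r !expr1 => H; apply: le_trans (H _); last by rewrite ler1n.
rewrite !ler_wpM2r ?invr_ge0 ?(ltW e0) ?(ltW (weight_den_gt0 _))//.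
by have := ltW c0; lra.
Qed.

Lemma gauss_tz_le t z : e <= t -> t <= T ->
  `|gauss_tz c t z| <= gauss_bound / e ^+ 4 * weight z.
Proof.
move=> et tT; apply: gaussM_le => //; apply: (le_trans (ler_normD _ _)).
have t0 : 0 < t by exact: lt_le_trans et.
have ei0 : 0 <= e^-1 by exact: le_trans ler01 ei1.
have w0 := ltW (weight_den_gt0 z).
have F1 : `|- (c * z / 2) * t^-1 * (- (t^-1 / 2) + c * z ^+ 2 / 4 * t ^- 2)| <=
    c / 2 * (1 + z ^+ 2) * e^-1 * ((1 + c) * (1 + z ^+ 2) * e^-1 ^+ 2).
  by rewrite normrM; apply: ler_pM => //; [exact: factor_z|exact: factor_t].
have F2 : `|c * z / 2 * t ^- 2| <= c / 2 * (1 + z ^+ 2) * e^-1 * e^-1.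
  have -> : c * z / 2 * t ^- 2 = - (- (c * z / 2) * t^-1 * t^-1).
    by rewrite -exprVn (expr2 t^-1) !mulNr opprK mulrA.
  rewrite normrN normrM; apply: ler_pM => //; first exact: factor_z.
  by rewrite gtr0_norm ?invr_gt0// inv_le.
apply: (le_trans (lerD F1 F2)).
have := @combine (1/2) 2 2 3 _ _ isT isT isT z.
have := @combine (1/2) 2 1 2 _ _ isT isT isT z.
have h0 : 0 <= 1 / 2 :> R by rewrite divr_ge0.
have h1 : 1 / 2 <= 2 :> R by lra.
move=> /(_ h0 h1) C1 /(_ h0 h1) C2.
have C3 := @combine 1 2 2 3 ler01 _ isT isT isT z.
have c1 : 0 <= 1 + c by rewrite addr_ge0// ltW.
set W := 1 + z ^+ 2 in C1 C2 w0 *; set E := e^-1 in C1 C2 ei0 *.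
have G1 : c / 2 * W * E * ((1 + c) * W * E ^+ 2) <= 1 / 2 * (1 + c) ^+ 2 * W ^+ 2 * E ^+ 3.
  have -> : 1 / 2 * (1 + c) ^+ 2 * W ^+ 2 * E ^+ 3 =
    (1 + c) / 2 * W * E * ((1 + c) * W * E ^+ 2) by field.
  apply: ler_pM => //; first by rewrite mulr_ge0// mulr_ge0// divr_ge0// ltW.
    by rewrite mulr_ge0 ?exprn_ge0// mulr_ge0.
  by rewrite !ler_wpM2r// lerDr.
have G2 : c / 2 * W * E * E <= 1 / 2 * (1 + c) ^+ 2 * W ^+ 2 * E ^+ 3.
  have -> : 1 / 2 * (1 + c) ^+ 2 * W ^+ 2 * E ^+ 3 =
    (1 + c) / 2 * W * E * E * ((1 + c) * W * E) by field.
  rewrite -[leLHS]mulr1; apply: ler_pM; rewrite ?mulr_ge0 ?divr_ge0 ?(ltW c0)//.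
    by rewrite !ler_wpM2r// lerDr.
  by rewrite !mulr_ege1 ?weight_den_ge1// lerDl ltW.
apply: (le_trans (lerD G1 G2)).
have -> : 2 * (1 + c) ^+ 2 * W ^+ 2 / e ^+ 3 = 2 * ((1 + c) ^+ 2 * W ^+ 2 * E ^+ 3).
  by rewrite /E exprVn; ring.
have : 0 <= (1 + c) ^+ 2 * W ^+ 2 * E ^+ 3.
  by rewrite !mulr_ge0 ?exprn_ge0// addr_ge0// ltW.
by lra.
Qed.

Lemma gauss_tt_bounded : exists M, forall t z, e <= t -> t <= T ->
  `|gauss_tt c t z| <= M.
Proof.
exists (gauss_bound / e ^+ 5) => t z et tT.
have t0 : 0 < t by exact: lt_le_trans et.
have ei0 : 0 <= e^-1 by exact: le_trans ler01 ei1.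
have B0 : 0 <= gauss_bound / e ^+ 5.
  by rewrite divr_ge0 ?gauss_bound_ge0// exprn_ge0// ltW.
rewrite -[leRHS]mulr1; apply: le_trans (ler_wpM2l B0 (weight_le1 z)).
apply: gaussM_le => //; apply: (le_trans (ler_normD _ _)).
rewrite normrX.
set W := 1 + z ^+ 2; set E := e^-1 in ei0 *.
have W1 : 1 <= W by exact: weight_den_ge1.
have F1 := factor_t z et; rewrite -/W -/E in F1.
have F1' : `|- (t^-1 / 2) + c * z ^+ 2 / 4 * t ^- 2| ^+ 2 <= ((1 + c) * W * E ^+ 2) ^+ 2.
  by rewrite ler_sqr ?nnegrE//; exact: le_trans F1.
have tE : t^-1 <= E by exact: inv_le.
have ti0 : 0 <= t^-1 by rewrite invr_ge0 ltW.
have E2 : t ^- 2 <= E ^+ 4.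
  rewrite -exprVn (@le_trans _ _ (E ^+ 2))//; first by rewrite ler_sqr ?nnegrE.
  exact: ler_weXn2l.
have E3 : t ^- 3 <= E ^+ 4.
  rewrite -exprVn (@le_trans _ _ (E ^+ 3))//; last exact: ler_weXn2l.
  by apply: lerXn2r.
have E20 : 0 <= t ^- 2 by rewrite -exprVn exprn_ge0.
have E30 : 0 <= t ^- 3 by rewrite -exprVn exprn_ge0.
have z2 : 0 <= z ^+ 2 by exact: sqr_ge0.
have F2 : `|t ^- 2 / 2 - c * z ^+ 2 / 2 * t ^- 3| <= (1 + c) * W * E ^+ 4.
  have h3 : c * z ^+ 2 * t ^- 3 <= c * z ^+ 2 * E ^+ 4.
    by rewrite ler_wpM2l// mulr_ge0// ltW.
  have h4 : 0 <= c * z ^+ 2 * t ^- 3 by rewrite mulr_ge0// mulr_ge0// ltW.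
  have h5 : 0 <= z ^+ 2 * E ^+ 4 by rewrite mulr_ge0// exprn_ge0.
  have h6 : 0 <= c * E ^+ 4 by rewrite mulr_ge0 ?exprn_ge0// ltW.
  by rewrite /W ler_norml; apply/andP; split; lra.
apply: (le_trans (lerD F1' F2)).
have h7 : (1 + c) * W * E ^+ 4 <= (1 + c) ^+ 2 * W ^+ 2 * E ^+ 4.
  rewrite ler_wpM2r ?exprn_ge0//.
  have -> : (1 + c) ^+ 2 * W ^+ 2 = ((1 + c) * W) * ((1 + c) * W) by ring.
  rewrite ler_peMr ?mulr_ege1 ?lerDl ?(ltW c0)//.
  by rewrite mulr_ge0 ?addr_ge0 ?(ltW c0)// (le_trans ler01).
have -> : 2 * (1 + c) ^+ 2 * W ^+ 2 / e ^+ 4 = 2 * ((1 + c) ^+ 2 * W ^+ 2 * E ^+ 4).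
  by rewrite /E exprVn; ring.
by lra.
Qed.

End bounds.

(** The second time derivative is bounded uniformly in space, as long as the time
    stays away from 0; hence the expansion is uniform in [y], as the semigroup
    calculus demands. *)
Lemma gauss_time_expansion x t e : 0 < t -> 0 < e -> exists2 d, 0 < d &
  forall k y, `|k| < d ->
   `|gauss c (t + k) (x - y) - gauss c t (x - y) - k * gauss_t c t (x - y)| <= e * `|k|.
Proof.
move=> t0 e0; have m0 : 0 < Num.min 1 (t / 2) by rewrite lt_min ltr01 divr_gt0.
have m1 : Num.min 1 (t / 2) <= 1 by rewrite ge_min lexx.
have T0 : 0 < 2 * t by rewrite mulr_gt0.
have [M HM] := gauss_tt_bounded T0 m0 m1.
have M0 : 0 <= M.
  apply: le_trans (HM t 0 _ _); first exact: normr_ge0.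
    by rewrite ge_min; apply/orP; right; lra.
  by lra.
exists (Num.min (t / 2) (e / (1 + M))).
  by rewrite lt_min !divr_gt0// ltr_pwDl.
move=> k y; rewrite lt_min => /andP[kt ke].
have H := @taylor_order1 _ (gauss c ^~ (x - y)) (gauss_t c ^~ (x - y))
  (gauss_tt c ^~ (x - y)) t (t / 2) M.
apply: le_trans (H _ _ _ k (ltW kt)) _.
- move=> s; rewrite ler_norml => /andP[s1 s2]; apply: derive_gauss_t => //; lra.
- move=> s; rewrite ler_norml => /andP[s1 s2]; apply: derive_gauss_tt => //; lra.
- move=> s; rewrite ler_norml => /andP[s1 s2]; apply: HM; last by lra.
  by rewrite ge_min; apply/orP; right; lra.
rewrite ler_wpM2r//; move: ke; rewrite ltr_pdivlMr ?ltr_pwDl//.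
by have := normr_ge0 k; lra.
Qed.

Lemma weighted_bounded_C0 (S : set R) (h : R -> R) A x : continuous h ->
  (forall y, `|h y| <= A * weight (x - y)) -> bounded_C0 S h.
Proof.
move=> hc hA.
have A0 : 0 <= A.
  have := le_trans (normr_ge0 _) (hA 0).
  by rewrite pmulr_lge0// weight_gt0.
split; last first.
  exists A => y _; apply: (le_trans (hA y)).
  by rewrite ler_piMr// weight_le1.
split; first exact: continuous_subspaceT.
move=> e e0; exists (`|x| + (A + 1) / e) => y _ yM.
apply: (le_lt_trans (hA y)).
have xy : (A + 1) / e < `|x - y|.
  by have := ler_normB x (x - y); rewrite subKr; lra.
have A1 : 0 < A + 1 by rewrite ltr_wpDl.
have xy0 : 0 < `|x - y| by apply: le_lt_trans xy; rewrite divr_ge0// ltW.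
have h1 : weight (x - y) <= `|x - y|^-1.
  rewrite /weight lef_pV2 ?posrE ?exprn_gt0 ?weight_den_gt0//.
  have h2 : `|x - y| <= 1 + (x - y) ^+ 2.
    have := sqr_ge0 (`|x - y| - 1); rewrite -(real_normK (num_real (x - y))).
    by have := sqr_ge0 `|x - y|; lra.
  apply: (le_trans h2); rewrite expr2 ler_peMr ?weight_den_ge1//.
  exact/ltW/weight_den_gt0.
apply: (@le_lt_trans _ _ (A / `|x - y|)); first by rewrite ler_wpM2l.
rewrite ltr_pdivrMr//; move: xy; rewrite ltr_pdivrMr// mulrC.
by apply: lt_trans; rewrite ltrDl.
Qed.

Lemma continuous_reflection (h h' : R -> R) x : (forall z, is_derive z 1 h (h' z)) ->
  continuous (fun y => h (x - y)).
Proof.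
move=> hd y; have := dercomp (derB (derc y x) (deri y)) (hd (x - y)).
by move/der_continuous.
Qed.

Let gauss_family_C0 (S : set R) t x : 0 < t ->
  bounded_C0 S (fun y => gauss c t (x - y)) /\
  bounded_C0 S (fun y => gauss_t c t (x - y)).
Proof.
move=> t0; have m0 : 0 < Num.min 1 t by rewrite lt_min ltr01.
have m1 : Num.min 1 t <= 1 by rewrite ge_min lexx.
have m2 : Num.min 1 t <= t by rewrite ge_min lexx orbT.
have tn : t != 0 by rewrite gt_eqF.
split; apply: weighted_bounded_C0.
- by apply: continuous_reflection => z; exact: derive_gauss_z.
- by move=> y; apply: (gauss_le t0 m0 m1 _ m2 (lexx t)).
- by apply: continuous_reflection => z; exact: derive_gauss_tz.
- by move=> y; apply: (gauss_t_le t0 m0 m1 _ m2 (lexx t)).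
Qed.

Lemma gauss_bounded_C0 (S : set R) t x : 0 < t ->
  bounded_C0 S (fun y => gauss c t (x - y)).
Proof. by move=> t0; have [] := gauss_family_C0 S x t0. Qed.

Lemma gauss_t_bounded_C0 (S : set R) t x : 0 < t ->
  bounded_C0 S (fun y => gauss_t c t (x - y)).
Proof. by move=> t0; have [] := gauss_family_C0 S x t0. Qed.

End gaussian_estimates.

(** * The Gaussian and the generator of the diffusion *)

Section continuity_tools.
Context {R : realType}.

(** Dynamics started at time 0 are differentiable only afterwards; right
    continuity at the left end is then enough for the mean value theorem. *)
Lemma derivable_continuous_itv (f df : R -> R) (a b : R) : a < b ->
  (forall x, a < x -> x <= b -> is_derive x 1 f (df x)) ->
  (forall e, 0 < e -> exists2 d, 0 < d & forall s, a <= s -> s < a + d -> `|f s - f a| <= e) ->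
  {within `[a, b], continuous f}.
Proof.
move=> ab fd fa; apply/continuous_within_itvP => //; split.
- move=> x; rewrite in_itv /= => /andP[ax xb].
  by apply: (@der_continuous _ _ (df x)); apply: fd => //; exact: ltW.
- apply/cvgrPdist_le => e e0; have [d d0 Hd] := fa e e0.
  near=> s; rewrite distrC; apply: Hd.
    by apply: ltW; near: s; exact: nbhs_right_gt.
  by near: s; apply: nbhs_right_lt; rewrite ltrDl.
- apply: cvg_at_left_filter; apply: (@der_continuous _ _ (df b)); exact: fd.
Unshelve. all: by end_near. Qed.

(** Comparison of measures on the subsets of [S] only, as a density is compared
    with a constant only near a point. *)
Lemma le_integral_local d (T : measurableType d) (m1 m2 : {measure set T -> \bar R})
    (S : set T) (f : T -> \bar R) : measurable S ->
  (forall A, measurable A -> A `<=` S -> (m1 A <= m2 A)%E) ->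
  (forall x, 0 <= f x)%E -> measurable_fun setT f ->
  (\int[m1]_(x in S) f x <= \int[m2]_(x in S) f x)%E.
Proof.
move=> mS m12 f0 mf.
have restr (m : {measure set T -> \bar R}) :
    (\int[m]_(x in S) f x = \int[mrestr m mS]_(x in S) f x)%E.
  apply: eq_measure_integral => A mA AS.
  by transitivity (m (A `&` S)) => //; rewrite setIidl.
rewrite (restr m1) (restr m2); apply: ge0_le_measure_integral => // A mA.
by apply: m12; [exact: measurableI|exact: subIsetr].
Qed.

End continuity_tools.

Section limit_kernel.
Context {R : realType}.
Variable c : R.
Hypothesis c0 : 0 < c.
Local Notation leb := (@lebesgue_measure R).
Implicit Types t x y z r e : R.

Lemma diffusion_generator_gauss t x : 0 < t ->
  diffusion_generator c (fun y => gauss c t (x - y)) (fun y => gauss_t c t (x - y)).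
Proof.
move=> t0; have tn : t != 0 by rewrite gt_eqF.
have d1 (y : R) : is_derive y 1 (fun y => gauss c t (x - y)) (- gauss_z c t (x - y)).
  have := dercomp (derB (derc y x) (deri y)) (derive_gauss_z c t (x - y)).
  by move/is_derive_eq; apply; ring.
have d2 (y : R) : is_derive y 1 (fun y => - gauss_z c t (x - y)) (c * gauss_t c t (x - y)).
  have := derN (dercomp (derB (derc y x) (deri y)) (derive_gauss_zz c (x - y) tn)).
  by move/is_derive_eq; apply; ring.
have e1 : derive1 (fun y => gauss c t (x - y)) = fun y => - gauss_z c t (x - y).
  by apply/funext => y; rewrite derive1E; have [_ ->] := d1 y.
split=> [y|y|y].
- by have [] := d1 y.
- by rewrite e1; have [] := d2 y.
- rewrite e1 derive1E; have [_ ->] := d2 y.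
  by rewrite mulKf// gt_eqF.
Qed.

(** Up to parametrisation this is a normal density. *)
Lemma integral_gauss t x : 0 < t -> (\int[leb]_y (c * gauss c t (x - y))%:E = 1)%E.
Proof.
move=> t0; under eq_integral do rewrite gauss_normal_pdf//.
exact: integral_normal_pdf.
Qed.

Lemma measurable_gauss t x : measurable_fun setT (fun y => gauss c t (x - y)).
Proof.
apply: continuous_measurable_fun.
exact: (continuous_reflection (derive_gauss_z c t)).
Qed.

Lemma integral_gauss_far t x r : 0 < t -> 0 < r ->
  (\int[leb]_(y in [set y | (r <= `|x - y|)%R]) (c * gauss c t (x - y))%:E <=
   (16 * t / c / r ^+ 2)%:E)%E.
Proof.
move=> t0 r0; have t20 : 0 < 2 * t by rewrite mulr_gt0.
have mfar : measurable [set y | r <= `|x - y|].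
  rewrite -[X in measurable X]setTI; apply: measurable_fun_le => //.
  by apply: measurableT_comp => //; exact: measurable_funB.
have k0 : 0 <= 16 * t / c / r ^+ 2.
  by rewrite !divr_ge0 ?mulr_ge0 ?exprn_ge0// ltW.
apply: (@le_trans _ _ (\int[leb]_y ((16 * t / c / r ^+ 2)%:E * (c * gauss c (2 * t) (x - y))%:E))%E).
  rewrite integral_mkcond; apply: ge0_le_integral => //.
  - move=> y _; apply: erestrict_ge0 => z _.
    by rewrite lee_fin mulr_ge0 ?gauss_ge0// ltW.
  - apply/(measurable_restrictT _ mfar); apply: measurable_funTS.
    by apply/measurable_EFinP; apply: measurable_funM => //; exact: measurable_gauss.
  - apply: measurable_funeM; apply/measurable_EFinP.
    by apply: measurable_funM => //; exact: measurable_gauss.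
  - move=> y _; rewrite patchE -EFinM; case: ifPn => [|_]; last first.
      by rewrite lee_fin mulr_ge0// mulr_ge0 ?gauss_ge0// ltW.
    rewrite inE /= => ry; rewrite lee_fin [leRHS]mulrCA ler_wpM2l ?(ltW c0)//.
    have h := gauss_moment c0 (x - y) t0.
    rewrite mulrAC ler_pdivlMr ?exprn_gt0// (le_trans _ h)// mulrC.
    rewrite ler_wpM2r ?gauss_ge0// -(real_normK (num_real (x - y))).
    by rewrite ler_sqr ?nnegrE// ltW.
rewrite ge0_integralZl//; last 2 first.
- apply/measurable_EFinP.
  by apply: measurable_funM => //; exact: measurable_gauss.
- by move=> y _; rewrite lee_fin mulr_ge0 ?gauss_ge0// ltW.
by rewrite integral_gauss// mule1.
Qed.

(** The fourth moment is [O(t^2)] times a Gaussian of variance comparable to [t],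
    which is itself [O(1/t)]. *)
Lemma gauss_far_le : exists M, forall t r z, 0 < t -> t <= 1 / 4 -> 0 < r ->
  r <= `|z| -> gauss c t z <= M * t / r ^+ 4.
Proof.
exists (128 / c ^+ 2 * gauss_cst c 1) => t r z t0 t4 r0 rz.
have t20 : 0 < 2 * t by rewrite mulr_gt0.
have t40 : 0 < 4 * t by rewrite mulr_gt0.
have z0 : 0 < `|z| by exact: lt_le_trans rz.
have h1 := gauss_moment c0 z t0.
have h2 := gauss_moment c0 z t20.
have t41 : 4 * t <= 1 by lra.
have h3 := gauss_decay c0 ltr01 z t40 t41 (lexx _) t41.
have h4 : gauss c (4 * t) z <= gauss_cst c 1 / (4 * t).
  apply: (le_trans h3); rewrite ler_piMr ?divr_ge0 ?gauss_cst_ge0 ?(ltW t40)//.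
  by rewrite invf_le1 ?exprn_gt0 ?weight_den_gt0// exprn_ege1// weight_den_ge1.
rewrite ler_pdivlMr ?exprn_gt0//.
have rz4 : r ^+ 4 <= z ^+ 4.
  have -> : z ^+ 4 = `|z| ^+ 4 by rewrite (exprM _ 2 2) -(real_normK (num_real z)) -exprM.
  by apply: lerXn2r; rewrite ?nnegrE// ltW.
apply: (@le_trans _ _ (gauss c t z * z ^+ 4)); first by rewrite ler_wpM2l ?gauss_ge0.
have -> : gauss c t z * z ^+ 4 = z ^+ 2 * (z ^+ 2 * gauss c t z) by ring.
apply: (@le_trans _ _ (z ^+ 2 * (16 * t / c * gauss c (2 * t) z))).
  by rewrite ler_wpM2l ?sqr_ge0.
have -> : z ^+ 2 * (16 * t / c * gauss c (2 * t) z) =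
    16 * t / c * (z ^+ 2 * gauss c (2 * t) z) by ring.
have k0 : 0 <= 16 * t / c by rewrite divr_ge0 ?mulr_ge0// ltW.
have k1 : 0 <= 16 * (2 * t) / c by rewrite divr_ge0 ?mulr_ge0// ltW.
apply: (le_trans (ler_wpM2l k0 h2)).
have -> : 2 * (2 * t) = 4 * t by ring.
apply: (le_trans (ler_wpM2l k0 (ler_wpM2l k1 h4))).
rewrite le_eqVlt; apply/orP; left; apply/eqP; field.
by rewrite !gt_eqF.
Qed.

End limit_kernel.

(** * Identification of the limit heat kernel *)

Section limit_kernel_identification.
Context {R : realType}.
Variables (c : R) (Q : R -> R -> probability (measurableTypeR R) R).
Hypothesis c0 : 0 < c.
Local Notation leb := (@lebesgue_measure R).
Implicit Types t x y z r e : R.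

(** Along [s], the semigroup at time [s] applied to the Gaussian at time
    [t + e - s] has derivative zero, as the Gaussian solves the heat equation of
    the generator. Comparing the two ends shows that the semigroup acts on
    Gaussians by adding times. *)
Lemma limit_semigroup_gauss t e x : 0 < t -> 0 < e ->
  is_feller setT Q -> has_generator setT Q (diffusion_generator c) ->
  semigroup setT Q t (fun y => gauss c e (x - y)) 0 = gauss c (t + e) x.
Proof.
move=> t0 e0 QF QL.
have mT : measurable (setT : set (measurableTypeR R)) by exact: measurableT.
pose U s y := gauss c s (x - y); pose V s y := gauss_t c s (x - y).
have bU s : 0 < s -> bounded_C0 setT (U s) by move=> s0; exact: gauss_bounded_C0.
have bV s : 0 < s -> bounded_C0 setT (V s) by move=> s0; exact: gauss_t_bounded_C0.
have LUV s : 0 < s -> diffusion_generator c (U s) (V s).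
  by move=> s0; exact: diffusion_generator_gauss.
have expU s h : 0 < s -> 0 < h -> exists2 d, 0 < d & forall k y, `|k| < d -> setT y ->
    `|U (s + k) y - U s y - k * V s y| <= h * `|k|.
  move=> s0 h0; have [d d0 Hd] := gauss_time_expansion c0 x s0 h0.
  by exists d => // k y kd _; exact: Hd.
have te0 : 0 < t + e by rewrite addr_gt0.
have dD s : 0 < s -> s < t + e -> is_derive s 1
    (fun r => semigroup setT Q r (U (t + e - r)) 0) 0.
  move=> s0 st.
  have := semigroup_derive mT QF QL (I : setT (0 : R)) bU bV bV LUV expU s0 st.
  move/is_derive_eq; apply; apply/eqP; rewrite -normr_le0.
  apply: (semigroup_le mT QF (ltW s0)) => //.
    by under eq_fun do rewrite subrr; exact: measurable_cst.
  by move=> y _; rewrite subrr normr0.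
pose D r := semigroup setT Q r (U (t + e - r)) 0.
have D0 : D 0 = U (t + e) 0 by rewrite /D subr0 (semigroup0 mT QF)//; exact: bU.
have : `|D t - D 0| <= 0 * (t - 0).
  apply: (@mean_value_le _ D (fun=> 0) 0 t 0 (ltW t0)).
  - by move=> s s0 st; apply: dD => //; rewrite (lt_trans st)// ltrDl.
  - by move=> s _ _; rewrite normr0.
  - apply: (derivable_continuous_itv (df := fun=> 0)) => //.
      by move=> s s0 st; apply: dD => //; rewrite (le_lt_trans st)// ltrDl.
    move=> h h0; rewrite D0.
    have [d d0 Hd] := semigroup_right_continuous mT QF (I : setT (0 : R)) bU bV expU te0 h0.
    by exists d => // s s0; rewrite add0r => sd; exact: Hd.
rewrite mul0r normr_le0 subr_eq0 D0 => /eqP; rewrite /D /U subr0 => <-.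
by rewrite addrAC subrr add0r.
Qed.

Variable p : R -> R -> R -> R.
Hypothesis QF : is_feller setT Q.
Hypothesis QL : has_generator setT Q (diffusion_generator c).
Hypothesis Qp : is_transition_density setT (mscale `|c|%:nng leb) Q p.

Let p_continuous t : 0 < t -> continuous (p t 0).
Proof.
move=> t0; case: Qp => _ pc _.
have oD : open [set z : R * R * R | [/\ 0 < z.1.1, setT z.1.2 & setT z.2]].
  have -> : [set z : R * R * R | [/\ 0 < z.1.1, setT z.1.2 & setT z.2]] =
      (fun z : R * R * R => z.1.1) @^-1` [set u | 0 < u].
    by apply/seteqP; split => z /= => [[]|].
  apply: (@open_comp _ _ (fun z : R * R * R => z.1.1)) => /=; last exact: open_gt.
  move=> z _; apply: (@continuous_comp _ _ _ (fun z : R * R * R => z.1) (fun z : R * R => z.1)).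
    exact: cvg_fst.
  exact: cvg_fst.
move=> y; move: pc; rewrite continuous_open_subspace// => pc.
apply: (@continuous_comp _ _ _ (fun y => (t, 0, y)) (fun z : R * R * R => p z.1.1 z.1.2 z.2)).
  have h1 : (fun _ : R => (t, 0 : R)) @ y --> (t, 0 : R) by exact: cvg_cst.
  have h2 : (fun z : R => z) @ y --> y by exact: cvg_id.
  exact: cvg_pair h1 h2.
by apply: pc; rewrite inE.
Qed.

(** Integrating [p t 0] against Gaussians of small variance [h] centred at [x]
    gives the Gaussian at time [t + h]; as [h] tends to 0 the left side tends to
    [p t 0 x], by continuity of the density, and the right side to the Gaussian
    at time [t]. *)
Lemma limit_kernel_gauss t x : 0 < t -> p t 0 x = gauss c t x.
Proof.
move=> t0; case: (Qp) => p0 _ pE.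
have cp : continuous (p t 0) by exact: p_continuous.
have mp : measurable_fun setT (p t 0) by exact: continuous_measurable_fun.
pose a := p t 0 x.
have a0 : 0 <= a by exact: p0.
have rhoE (A : set (measurableTypeR R)) : measurable A ->
    Q t 0 A = (c%:E * \int[leb]_(y in A) (p t 0 y)%:E)%E.
  move=> mA; rewrite (pE t 0 A)// ge0_integral_mscale//=.
  - by rewrite gtr0_norm.
  - by apply/measurable_EFinP; exact: measurable_funTS.
  - by move=> y _; rewrite lee_fin p0.
suff H e : 0 < e -> `|a - gauss c t x| <= 3 * e.
  apply/eqP; rewrite -subr_eq0 -normr_le0; apply/ler_addgt0Pl => e e0.
  rewrite addr0; have e3 : 0 < e / 3 by rewrite divr_gt0.
  by have := H _ e3; rewrite mulrCA divff// mulr1.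
move=> e0.
have /cvgrPdist_le/(_ e e0)/nbhs_ballP[r /= r0 Hr] := cp x.
pose I := ball x r.
have mI : measurable (I : set (measurableTypeR R)).
  by apply: open_measurable; exact: ball_open.
have pI y : I y -> a - e <= p t 0 y /\ p t 0 y <= a + e.
  by move=> /Hr; rewrite -/a ler_norml => /andP[? ?]; split; lra.
have [M HM] := gauss_far_le c0.
have M0 : 0 <= M.
  have := HM (1/4) 1 1; rewrite expr1n divr1 => H.
  have h : 0 <= M * (1 / 4).
    by apply: le_trans (H _ _ _ _); rewrite ?gauss_ge0 ?normr1//; lra.
  by lra.
have /cvgrPdist_le/(_ e e0)/nbhs_ballP[d /= d0 Hd] :=
  der_continuous (derive_gauss_t c x t0).
(* [h] is small enough for the time increment, for the Gaussian outside the
   ball, and for its mass there *)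
pose h := Num.min (Num.min (1 / 4) (d / 2))
  (Num.min (e / (1 + M) * r ^+ 4) (e / (1 + a) * (c * r ^+ 2 / 16))).
have h0 : 0 < h.
  rewrite !lt_min !divr_gt0//= !mulr_gt0 ?invr_gt0 ?exprn_gt0 ?ltr_pwDl//.
have h4 : h <= 1 / 4 by rewrite !ge_min lexx.
have hd : h <= d / 2 by rewrite !ge_min lexx !orbT.
have hM : h <= e / (1 + M) * r ^+ 4 by rewrite !ge_min lexx !orbT.
have ha : h <= e / (1 + a) * (c * r ^+ 2 / 16) by rewrite !ge_min lexx !orbT.
have E1 : `|gauss c t x - gauss c (t + h) x| <= e.
  by apply: Hd; rewrite /ball /= opprD addrA subrr add0r normrN gtr0_norm//; lra.
pose g y := (gauss c h (x - y))%:E.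
have g0 y : (0 <= g y)%E by rewrite lee_fin gauss_ge0.
have mg : measurable_fun (setT : set (measurableTypeR R)) g.
  by apply/measurable_EFinP; exact: measurable_gauss.
have P1 : (\int[Q t 0]_y g y = (gauss c (t + h) x)%:E)%E.
  rewrite -(limit_semigroup_gauss x t0 h0 QF QL) /semigroup /Rintegral fineK//.
  apply: integrable_fin_num => //.
  exact: (@C0_integrable R setT Q measurableT t 0 _ (gauss_bounded_C0 c0 setT x h0)).
have mIC : measurable (~` I : set (measurableTypeR R)) by exact: measurableC.
have disjI : [disjoint I & ~` I] by apply/disj_setPS; rewrite setICr.
have P2 : (\int[Q t 0]_y g y = \int[Q t 0]_(y in I) g y + \int[Q t 0]_(y in ~` I) g y)%E.
  by rewrite -ge0_integral_setU ?setUv.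
have gI : (\int[leb]_(y in I) (c%:E * g y) + \int[leb]_(y in ~` I) (c%:E * g y) = 1)%E.
  rewrite -ge0_integral_setU ?setUv//.
  - by rewrite -(integral_gauss c0 x h0).
  - exact: measurable_funeM.
  - by move=> y _; rewrite mule_ge0// lee_fin ltW.
have gfar : (\int[leb]_(y in ~` I) (c%:E * g y) <= (16 * h / c / r ^+ 2)%:E)%E.
  rewrite (_ : ~` I = [set y | r <= `|x - y|]).
    exact: integral_gauss_far.
  by apply/seteqP; split => y; rewrite /I /ball /= leNgt => /negP.
have near_le : (\int[leb]_(y in I) (c%:E * g y) <= 1)%E.
  rewrite -gI leeDl//; apply: integral_ge0 => y _.
  by rewrite mule_ge0// lee_fin ltW.
have near_ge0 : (0 <= \int[leb]_(y in I) (c%:E * g y))%E.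
  by apply: integral_ge0 => y _; rewrite mule_ge0// lee_fin ltW.
have far_ge0 : (0 <= \int[leb]_(y in ~` I) (c%:E * g y))%E.
  by apply: integral_ge0 => y _; rewrite mule_ge0// lee_fin ltW.
have near_fin : (\int[leb]_(y in I) (c%:E * g y))%E \is a fin_num.
  by rewrite ge0_fin_numE// (le_lt_trans near_le)// ltry.
have far_fin : (\int[leb]_(y in ~` I) (c%:E * g y))%E \is a fin_num.
  by rewrite ge0_fin_numE// (le_lt_trans gfar)// ltry.
have scaleE b (b0 : 0 <= b) :
    (\int[mscale (NngNum (mulr_ge0 (ltW c0) b0)) leb]_(y in I) g y =
     b%:E * \int[leb]_(y in I) (c%:E * g y))%E.
  rewrite ge0_integral_mscale//=; last exact: measurable_funTS.
  rewrite ge0_integralZl_EFin//; [|exact: measurable_funTS|exact: ltW].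
  by rewrite EFinM muleA (muleC c%:E).
have ae0 : 0 <= a + e by rewrite addr_ge0// ltW.
have upper : (\int[Q t 0]_(y in I) g y <= (a + e)%:E)%E.
  apply: (@le_trans _ _ (\int[mscale (NngNum (mulr_ge0 (ltW c0) ae0)) leb]_(y in I) g y)%E).
    apply: le_integral_local => // A mA AI.
    apply: (@le_trans _ _ (c%:E * \int[leb]_(y in A) (p t 0 y)%:E)%E).
      by rewrite -(rhoE A mA).
    rewrite [leRHS](_ : _ = c%:E * ((a + e)%:E * leb A))%E; last first.
      by rewrite muleA -EFinM.
    rewrite lee_wpmul2l ?lee_fin ?(ltW c0)// -integral_cst//.
    apply: ge0_le_integral => //.
    + by move=> y _; rewrite lee_fin p0.
    + by apply/measurable_EFinP; exact: measurable_funTS.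
    + by move=> y /AI /pI[_ ?]; rewrite lee_fin.
  by rewrite scaleE -[leRHS]mule1 lee_wpmul2l ?lee_fin.
have far : (\int[Q t 0]_(y in ~` I) g y <= (M * h / r ^+ 4)%:E)%E.
  apply: (@le_trans _ _ (\int[Q t 0]_(y in ~` I) (M * h / r ^+ 4)%:E)%E).
    apply: ge0_le_integral => //; first exact: measurable_funTS.
    move=> y /negP; rewrite -leNgt => ry; rewrite lee_fin.
    exact: HM.
  rewrite integral_cst// -[leRHS]mule1 lee_wpmul2l ?probability_le1//.
  by rewrite lee_fin divr_ge0 ?mulr_ge0 ?exprn_ge0// ltW.
have lower : a - e <= gauss c (t + h) x + a * (16 * h / c / r ^+ 2).
  have q0 : 0 <= a * (16 * h / c / r ^+ 2).
    by rewrite mulr_ge0// !divr_ge0 ?mulr_ge0 ?exprn_ge0// ltW.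
  have [ae|ae] := leP a e.
    by have := gauss_ge0 c (t + h) x; clear - ae q0; lra.
  have b0 : 0 <= a - e by rewrite subr_ge0 ltW.
  have : ((a - e)%:E * \int[leb]_(y in I) (c%:E * g y) <= (gauss c (t + h) x)%:E)%E.
    rewrite -P1 P2 -(scaleE _ b0).
    apply: (@le_trans _ _ (\int[Q t 0]_(y in I) g y)%E); last first.
      by rewrite leeDl//; exact: integral_ge0.
    apply: le_integral_local => // A mA AI.
    apply: (@le_trans _ _ (c%:E * \int[leb]_(y in A) (p t 0 y)%:E)%E); last first.
      by rewrite -(rhoE A mA).
    rewrite [leLHS](_ : _ = c%:E * ((a - e)%:E * leb A))%E; last first.
      by rewrite muleA -EFinM.
    rewrite lee_wpmul2l ?lee_fin ?(ltW c0)// -integral_cst//.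
    apply: ge0_le_integral => //.
    + by apply/measurable_EFinP; exact: measurable_funTS.
    + by move=> y /AI /pI[? _]; rewrite lee_fin.
  move: gI gfar; rewrite -(fineK near_fin) -(fineK far_fin).
  set j := fine _; set f := fine _; rewrite -EFinD -EFinM !lee_fin => -[jf] fq h5.
  have f0 : 0 <= f by rewrite fine_ge0.
  have : (a - e) * f <= a * f by rewrite ler_wpM2r// gerBl ltW.
  have : a * f <= a * (16 * h / c / r ^+ 2) by rewrite ler_wpM2l.
  have jE : j = 1 - f by rewrite -jf addrK.
  by move: h5; rewrite jE; clear; lra.
have far_e : M * h / r ^+ 4 <= e.
  rewrite ler_pdivrMr ?exprn_gt0//.
  have M1 : 0 < 1 + M by rewrite ltr_pwDl.
  have : (1 + M) * h <= e * r ^+ 4.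
    by rewrite mulrC -ler_pdivlMr// mulrAC.
  by clear - h0; lra.
have q_e : a * (16 * h / c / r ^+ 2) <= e.
  have a1 : 0 < 1 + a by rewrite ltr_pwDl.
  have cr : 0 < c * r ^+ 2 / 16 by rewrite divr_gt0// mulr_gt0// exprn_gt0.
  have -> : 16 * h / c / r ^+ 2 = h / (c * r ^+ 2 / 16).
    by field; rewrite !gt_eqF// exprn_gt0.
  have h5 : h / (c * r ^+ 2 / 16) <= e / (1 + a) by rewrite ler_pdivrMr.
  apply: (le_trans (ler_wpM2l a0 h5)).
  by rewrite mulrCA -[leRHS]mulr1 ler_wpM2l ?(ltW e0)// ler_pdivrMr// mul1r lerDr.
have up : gauss c (t + h) x <= a + e + e.
  rewrite -lee_fin -P1 P2 EFinD; apply: leeD => //.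
  by apply: (le_trans far); rewrite lee_fin.
move: E1; rewrite !ler_norml => /andP[g1 g2].
by clear - g1 g2 up lower q_e; apply/andP; split; lra.
Qed.

End limit_kernel_identification.

(** * Sums over windows of the integers *)

Section two_sided_sums.
Context {R : realType}.
Implicit Types (F G : int -> R) (N : nat) (y : int).

(** The sum over the integers of [-N, N-1]. *)
Definition zsum N F : R := \sum_(k < N) (F (Posz k) + F (Negz k)).

Lemma zsum0 F : zsum 0 F = 0. Proof. by rewrite /zsum big_ord0. Qed.

Lemma zsumS N F : zsum N.+1 F = zsum N F + (F (Posz N) + F (Negz N)).
Proof. by rewrite /zsum big_ord_recr. Qed.

Lemma eq_zsum N F G : F =1 G -> zsum N F = zsum N G.
Proof. by move=> FG; apply: eq_bigr => k _; rewrite !FG. Qed.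

Lemma zsumD N F G : zsum N (fun y => F y + G y) = zsum N F + zsum N G.
Proof. by rewrite /zsum -big_split; apply: eq_bigr => k _ /=; ring. Qed.

Lemma zsumZ N a F : zsum N (fun y => a * F y) = a * zsum N F.
Proof. by rewrite /zsum mulr_sumr; apply: eq_bigr => k _; ring. Qed.

Lemma zsumN N F : zsum N (fun y => - F y) = - zsum N F.
Proof. by rewrite /zsum -sumrN; apply: eq_bigr => k _; ring. Qed.

Lemma zsumB N F G : zsum N (fun y => F y - G y) = zsum N F - zsum N G.
Proof. by rewrite zsumD zsumN. Qed.

Lemma le_zsum N F G :
  (forall y, (- (N%:Z) <= y)%R -> (y < N%:Z)%R -> F y <= G y) -> zsum N F <= zsum N G.
Proof.
move=> FG; apply: ler_sum => k _; have := ltn_ord k => kN.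
by apply: lerD; apply: FG; lia.
Qed.

Lemma zsum_ge0 N F : (forall y, 0 <= F y) -> 0 <= zsum N F.
Proof. by move=> F0; apply: sumr_ge0 => k _; rewrite addr_ge0. Qed.

Lemma ler_norm_zsum N F : `|zsum N F| <= zsum N (fun y => `|F y|).
Proof.
apply: (le_trans (ler_norm_sum _ _ _)); apply: ler_sum => k _; exact: ler_normD.
Qed.

Lemma zsum_mono N N' F : (forall y, 0 <= F y) -> (N <= N')%N -> zsum N F <= zsum N' F.
Proof.
move=> F0 /subnK <-; elim: (N' - N)%N => // k IH.
by rewrite addSn zsumS (le_trans IH)// lerDl addr_ge0.
Qed.

Lemma zsum_ge_term N F y : (forall y, 0 <= F y) -> (`|y| < N)%N -> F y <= zsum N F.
Proof.
move=> F0 yN; apply: (@le_trans _ _ (zsum `|y|.+1 F)); last exact: zsum_mono.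
rewrite zsumS; case: y yN => k /= kN.
  by rewrite addrA (addrAC _ (F k)) lerDr addr_ge0// zsum_ge0.
have : 0 <= F (Negz k) by []. 
rewrite zsumS => H; rewrite -!addrA.
have := zsum_ge0 k F0; have := F0 (Posz k); have := F0 (Posz k.+1); have := F0 (Negz k.+1); lra.
Qed.

Lemma telescope_zsum N F : zsum N (fun y => F (y + 1) - F y) = F N%:Z - F (- N%:Z).
Proof.
elim: N => [|N IH]; first by rewrite zsum0 oppr0 subrr.
rewrite zsumS IH.
have -> : N%:Z + 1 = N.+1%:Z by lia.
have -> : Negz N + 1 = - N%:Z by lia.
have -> : Negz N = - N.+1%:Z by lia.
ring.
Qed.

Lemma abel_zsum N F G :
  zsum N (fun y => F y * (G (y + 1) - G y)) =
  F N%:Z * G N%:Z - F (- N%:Z) * G (- N%:Z)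
  - zsum N (fun y => G (y + 1) * (F (y + 1) - F y)).
Proof.
apply/eqP; rewrite -[X in _ == X - _]/((fun y => F y * G y) N%:Z - (fun y => F y * G y) (- N%:Z)).
rewrite -telescope_zsum eq_sym subr_eq -zsumD; apply/eqP.
by apply: eq_zsum => y; ring.
Qed.

Lemma zsum_shift N F : (forall y, 0 <= F y) ->
  zsum N (fun y => F (y + 1)) <= zsum N.+1 F.
Proof.
move=> F0; have := telescope_zsum N F; rewrite zsumB zsumS => /eqP.
rewrite subr_eq => /eqP ->; have := F0 (- N%:Z); have := F0 (Negz N); lra.
Qed.

Lemma zsum_shiftN N F : (forall y, 0 <= F y) ->
  zsum N (fun y => F (y - 1)) <= zsum N.+1 F.
Proof.
move=> F0; have := telescope_zsum N (fun y => F (y - 1)).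
rewrite (@eq_zsum _ _ (fun y => F y - F (y - 1))); last by move=> y; rewrite addrK.
rewrite zsumB zsumS.
have -> : - N%:Z - 1 = Negz N by lia.
by have := F0 (N%:Z - 1); have := F0 (Posz N); lra.
Qed.

Lemma derive_zsum N (f : R -> int -> R) (f' : int -> R) (s : R) :
  (forall y, is_derive s 1 (f ^~ y) (f' y)) ->
  is_derive s 1 (fun s => zsum N (f s)) (zsum N f').
Proof.
move=> fd; elim: N => [|N IH].
  rewrite zsum0 (_ : (fun s => _) = fun=> 0); first exact: derc.
  by apply/funext => r; rewrite zsum0.
rewrite zsumS (_ : (fun s => _) =
    fun s => zsum N (f s) + (f s (Posz N) + f s (Negz N))); last first.
  by apply/funext => r; rewrite zsumS.
by apply: derD => //; apply: derD.
Qed.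

(** Otherwise the sums would grow linearly. *)
Lemma small_term F B e (N0 : nat) : (forall y, 0 <= F y) -> (forall N, zsum N F <= B) ->
  0 < e -> exists2 N, (N0 <= N)%N & F N%:Z <= e.
Proof.
move=> F0 FB e0; apply: contrapT => H.
have {}H k : (N0 <= k)%N -> e < F k%:Z.
  by move=> Nk; rewrite ltNge; apply/negP => ke; apply: H; exists k.
have grow m : m%:R * e <= zsum (N0 + m) F.
  elim: m => [|m IH]; first by rewrite mul0r zsum_ge0.
  rewrite addnS zsumS -[m.+1]addn1 natrD mulrDl mul1r lerD//.
  by rewrite (le_trans (ltW (H _ (leq_addr m N0))))// lerDl.
have B0 : 0 <= B by apply: le_trans (FB 0%N); rewrite zsum0.
have := archi_boundP (divr_ge0 B0 (ltW e0)); set m := Num.bound _.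
rewrite ltr_pdivrMr// => /(le_lt_trans (le_trans (grow m) (FB _))).
by rewrite ltxx.
Qed.

End two_sided_sums.

(** * Energy inequalities for the chain *)

Section energy.
Context {R : realType}.
Variables (n : R) (tau : int -> R) (q : R -> int -> R).
Implicit Types (s t a b : R) (x y z : int) (N J M : nat).
Hypothesis n1 : 1 <= n.
Hypothesis tau1 : forall y, 1 <= tau y.
Hypothesis q0 : forall s y, 0 < s -> 0 <= q s y.
Hypothesis q_mass : forall s N, 0 < s -> zsum N (fun y => tau y * q s y) <= n.

Definition grad s y : R := q s (y + 1) - q s y.
(** The right-hand side of the forward equation for the density; it is the
    discrete Laplacian divided by the trap. *)
Definition flow s y : R := n ^+ 2 / tau y * (grad s y - grad s (y - 1)).

Hypothesis q_flow : forall s y, 0 < s -> is_derive s 1 (q ^~ y) (flow s y).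

(** The square of the [L^2] norm with respect to the speed measure, and the
    Dirichlet form, both restricted to a window. *)
Definition mass2 s N : R := n^-1 * zsum N (fun y => tau y * q s y ^+ 2).
Definition dirichlet s N : R := n * zsum N (fun y => grad s y ^+ 2).

Let n0 : 0 < n. Proof. exact: lt_le_trans ltr01 n1. Qed.
Let tau0 y : 0 < tau y. Proof. exact: lt_le_trans ltr01 (tau1 y). Qed.

Lemma q_sum s N : 0 < s -> zsum N (q s) <= n.
Proof.
move=> s0; apply: le_trans (q_mass N s0); apply: le_zsum => y _ _.
by rewrite ler_peMl// q0.
Qed.

Lemma q_le s y : 0 < s -> q s y <= n.
Proof.
move=> s0; apply: le_trans (q_sum `|y|.+1 s0).
by apply: zsum_ge_term => // z; exact: q0.
Qed.

Lemma grad_le s y : 0 < s -> `|grad s y| <= n.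
Proof.
move=> s0; rewrite /grad ler_norml; apply/andP.
have := q0 (y + 1) s0; have := q0 y s0; have := q_le (y + 1) s0; have := q_le y s0.
by move=> *; split; lra.
Qed.

Lemma mass2_ge0 s N : 0 <= mass2 s N.
Proof.
rewrite mulr_ge0 ?invr_ge0 ?(ltW n0)//; apply: zsum_ge0 => y.
by rewrite mulr_ge0 ?sqr_ge0// ltW.
Qed.

Lemma dirichlet_ge0 s N : 0 <= dirichlet s N.
Proof. by rewrite mulr_ge0 ?(ltW n0)//; apply: zsum_ge0 => y; exact: sqr_ge0. Qed.

Lemma mass2_le_sup s N B : 0 < s -> (forall y, q s y <= B) -> mass2 s N <= B.
Proof.
move=> s0 qB; rewrite /mass2 mulrC ler_pdivrMr//.
have B0 : 0 <= B by exact: le_trans (q0 0 s0) (qB 0).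
apply: le_trans (ler_wpM2l B0 (q_mass N s0)); rewrite -zsumZ.
apply: le_zsum => y _ _; rewrite expr2 mulrA mulrC ler_wpM2r ?mulr_ge0 ?q0//.
exact: ltW.
Qed.

Section cutoff.
Variable M : nat.
Hypothesis M0 : (0 < M)%N.

(** Only finite sums of the density can be differentiated, and only the total
    mass is known to be finite; a cutoff of slope [1/M] turns the boundary terms
    of the summations by parts into errors of order [1/M]. *)
Definition cutoff y : R := Num.max 0 (1 - `|y|%N%:R / M%:R).

Let M0' : 0 < M%:R :> R. Proof. by rewrite ltr0n. Qed.

Lemma cutoff_ge0 y : 0 <= cutoff y.
Proof. by rewrite le_max lexx. Qed.

Lemma cutoff_le1 y : cutoff y <= 1.
Proof. by rewrite ge_max ler01 gerBl divr_ge0// ltW. Qed.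

Lemma cutoff0 y : (M <= `|y|)%N -> cutoff y = 0.
Proof.
move=> My; rewrite /cutoff; apply/max_idPl; rewrite subr_le0 ler_pdivlMr//.
by rewrite mul1r ler_nat.
Qed.

Lemma cutoff_ge J y : (`|y| <= J)%N -> 1 - J%:R / M%:R <= cutoff y.
Proof.
move=> yJ; rewrite le_max; apply/orP; right.
by rewrite lerB// ler_wpM2r ?invr_ge0 ?ler_nat// ltW.
Qed.

Lemma cutoff_lipschitz y : `|cutoff (y + 1) - cutoff y| <= M%:R^-1.
Proof.
have max_lip (u v : R) : `|Num.max 0 u - Num.max 0 v| <= `|u - v|.
  have h1 := ler_norm (u - v); have h2 := ler_norm (v - u); rewrite distrC in h2.
  have h3 := normr_ge0 (u - v); rewrite ler_norml /Num.max.
  by case: ltP => hu; case: ltP => hv; apply/andP; split; lra.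
apply: (le_trans (max_lip _ _)).
have -> : 1 - `|(y + 1)%R|%N%:R / M%:R - (1 - `|y|%N%:R / M%:R) =
    (`|y|%N%:R - `|(y + 1)%R|%N%:R) / M%:R :> R by field; rewrite gt_eqF.
rewrite normrM [`|_^-1|]gtr0_norm ?invr_gt0// ler_piMl ?invr_ge0 ?(ltW M0')//.
rewrite ler_norml; apply/andP; split.
  have : (`|(y + 1)%R| <= `|y| + 1)%N by lia.
  by rewrite -(ler_nat R) natrD; lra.
have : (`|y| <= `|(y + 1)%R| + 1)%N by lia.
by rewrite -(ler_nat R) natrD; lra.
Qed.

Lemma derive_cutoff_mass s : 0 < s -> is_derive s 1
   (fun r => n^-1 * zsum M.+1 (fun y => cutoff y * (tau y * q r y ^+ 2)))
   (2 * n * zsum M.+1 (fun y => cutoff y * q s y * (grad s y - grad s (y - 1)))).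
Proof.
move=> s0.
have H y := derZ (cutoff y) (derZ (tau y) (der_sqr (q_flow y s0))).
have := derZ n^-1 (derive_zsum M.+1 H).
move/is_derive_eq; apply; rewrite -!zsumZ; apply: eq_zsum => y.
rewrite /flow; field; rewrite !gt_eqF//.
Qed.

Lemma derive_grad s y : 0 < s -> is_derive s 1 (grad ^~ y) (flow s (y + 1) - flow s y).
Proof. by move=> s0; apply: derB; exact: q_flow. Qed.

Lemma derive_cutoff_energy s : 0 < s -> is_derive s 1
   (fun r => n * zsum M.+1 (fun y => cutoff y * grad r y ^+ 2))
   (2 * n * zsum M.+1 (fun y => cutoff y * grad s y * (flow s (y + 1) - flow s y))).
Proof.
move=> s0.
have H y := derZ (cutoff y) (der_sqr (derive_grad y s0)).
have := derZ n (derive_zsum M.+1 H).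
move/is_derive_eq; apply; rewrite -!zsumZ; apply: eq_zsum => y; ring.
Qed.

Let sum_grad_le s : 0 < s -> zsum M.+1 (fun y => `|grad s y|) <= 2 * n.
Proof.
move=> s0; apply: (@le_trans _ _ (zsum M.+1 (fun y => q s (y + 1) + q s y))).
  apply: le_zsum => y _ _; rewrite (le_trans (ler_normB _ _))//.
  by rewrite !ger0_norm// q0.
have qs y : 0 <= q s y by exact: q0.
rewrite zsumD; have := zsum_shift M.+1 qs; have := q_sum M.+1 s0.
by have := q_sum M.+2 s0; lra.
Qed.

Let sum_gradN_le s : 0 < s -> zsum M.+1 (fun y => `|grad s (y - 1)|) <= 2 * n.
Proof.
move=> s0; apply: (@le_trans _ _ (zsum M.+1 (fun y => q s y + q s (y - 1)))).
  apply: le_zsum => y _ _; rewrite /grad subrK (le_trans (ler_normB _ _))//.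
  by rewrite !ger0_norm// q0.
have qs y : 0 <= q s y by exact: q0.
rewrite zsumD; have := zsum_shiftN M.+1 qs; have := q_sum M.+1 s0.
by have := q_sum M.+2 s0; lra.
Qed.

Let grad_step s y : q s (y + 1) = q s y + grad s y.
Proof. by rewrite /grad; ring. Qed.

(** Summation by parts: the [L^2] norm is dissipated by the Dirichlet form. *)
Lemma cutoff_mass_decrease s : 0 < s ->
  2 * n * zsum M.+1 (fun y => cutoff y * q s y * (grad s y - grad s (y - 1))) <=
  - (2 * (n * zsum M.+1 (fun y => cutoff y * grad s y ^+ 2))) + 4 * n ^+ 3 / M%:R.
Proof.
move=> s0.
pose a y := cutoff y * q s y * grad s (y - 1).
have T := telescope_zsum M.+1 a.
rewrite {3 4}/a !cutoff0 ?mul0r ?subr0 in T; [|lia|lia].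
pose E y := grad s y * q s (y + 1) * (cutoff (y + 1) - cutoff y).
have -> : zsum M.+1 (fun y => cutoff y * q s y * (grad s y - grad s (y - 1))) =
    - zsum M.+1 (fun y => cutoff y * grad s y ^+ 2) - zsum M.+1 E.
  rewrite -[RHS]add0r -{1}T addrA -zsumN -!zsumD -zsumN -zsumD; apply: eq_zsum => y.
  by rewrite /a /E addrK grad_step; ring.
have EB : `|zsum M.+1 E| <= 2 * n ^+ 2 / M%:R.
  apply: (le_trans (ler_norm_zsum _ _)).
  apply: (@le_trans _ _ (zsum M.+1 (fun y => n / M%:R * `|grad s y|))).
    apply: le_zsum => y _ _; rewrite /E !normrM.
    rewrite -[leRHS]mulrC -mulrA ler_wpM2l//.
    apply: ler_pM => //; last exact: cutoff_lipschitz.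
    by rewrite ger0_norm ?q0// q_le.
  rewrite zsumZ; have h : 0 <= n / M%:R by rewrite divr_ge0// ltW.
  apply: (le_trans (ler_wpM2l h (sum_grad_le s0))).
  by rewrite le_eqVlt; apply/orP; left; apply/eqP; field; rewrite gt_eqF.
move: EB; rewrite ler_norml => /andP[E1 _].
have : 2 * n * - zsum M.+1 E <= 2 * n * (2 * n ^+ 2 / M%:R).
  by rewrite ler_wpM2l ?mulr_ge0 ?(ltW n0)//; lra.
have -> : 2 * n * (2 * n ^+ 2 / M%:R) = 4 * n ^+ 3 / M%:R by ring.
lra.
Qed.

Let flow_le s y : 0 < s -> `|flow s y| <= 2 * n ^+ 3.
Proof.
move=> s0; rewrite /flow normrM.
have -> : 2 * n ^+ 3 = n ^+ 2 * (2 * n) by ring.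
apply: ler_pM => //.
  rewrite ger0_norm ?divr_ge0 ?sqr_ge0 ?(ltW (tau0 y))//.
  by rewrite ler_pdivrMr// ler_peMr// sqr_ge0.
apply: (le_trans (ler_normB _ _)).
by have := grad_le y s0; have := grad_le (y - 1) s0; lra.
Qed.

(** Summation by parts once more: without the cutoff the derivative of the
    Dirichlet form is minus a weighted sum of squares of the flow. *)
Lemma cutoff_energy_decrease s : 0 < s ->
  2 * n * zsum M.+1 (fun y => cutoff y * grad s y * (flow s (y + 1) - flow s y)) <=
  8 * n ^+ 5 / M%:R.
Proof.
move=> s0.
pose a y := cutoff (y - 1) * grad s (y - 1) * flow s y.
have T := telescope_zsum M.+1 a.
rewrite {3 4}/a !cutoff0 ?mul0r ?subr0 in T; [|lia|lia].
pose E y := flow s y * (cutoff y - cutoff (y - 1)) * grad s (y - 1).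
have : zsum M.+1 (fun y => cutoff y * grad s y * (flow s (y + 1) - flow s y)) <=
    - zsum M.+1 E.
  rewrite -[leRHS]add0r -{1}T -zsumB; apply: le_zsum => y _ _.
  rewrite /a /E addrK -subr_ge0.
  have -> : cutoff y * grad s y * flow s (y + 1) -
    cutoff (y - 1) * grad s (y - 1) * flow s y -
    flow s y * (cutoff y - cutoff (y - 1)) * grad s (y - 1) -
    cutoff y * grad s y * (flow s (y + 1) - flow s y) =
    cutoff y * (flow s y * (grad s y - grad s (y - 1))) by ring.
  rewrite mulr_ge0 ?cutoff_ge0// /flow -mulrA -expr2 mulr_ge0 ?sqr_ge0//.
  by rewrite divr_ge0 ?sqr_ge0// ltW.
have EB : `|zsum M.+1 E| <= 4 * n ^+ 4 / M%:R.
  apply: (le_trans (ler_norm_zsum _ _)).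
  apply: (@le_trans _ _ (zsum M.+1 (fun y => 2 * n ^+ 3 / M%:R * `|grad s (y - 1)|))).
    apply: le_zsum => y _ _; rewrite /E normrM ler_wpM2r// normrM.
    apply: ler_pM => //; first exact: flow_le.
    by have := cutoff_lipschitz (y - 1); rewrite subrK.
  rewrite zsumZ; have h : 0 <= 2 * n ^+ 3 / M%:R.
    by rewrite divr_ge0 ?mulr_ge0 ?exprn_ge0// ltW.
  apply: (le_trans (ler_wpM2l h (sum_gradN_le s0))).
  by rewrite le_eqVlt; apply/orP; left; apply/eqP; field; rewrite gt_eqF.
move: EB; rewrite ler_norml => /andP[E1 _] Z.
have : 2 * n * zsum M.+1 (fun y => cutoff y * grad s y * (flow s (y + 1) - flow s y))
   <= 2 * n * (4 * n ^+ 4 / M%:R).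
  by rewrite ler_wpM2l ?mulr_ge0 ?(ltW n0)//; lra.
by have -> : 2 * n * (4 * n ^+ 4 / M%:R) = 8 * n ^+ 5 / M%:R by ring.
Qed.

(** The quantity [mass2 + 2 (s - a) dirichlet], with the cutoff, is a Lyapunov
    function up to the error of the cutoff: its derivative is at most the sum
    of the two boundary terms. *)
Lemma cutoff_lyapunov a b : 0 < a -> a <= b ->
  n^-1 * zsum M.+1 (fun y => cutoff y * (tau y * q b y ^+ 2)) +
  2 * (b - a) * (n * zsum M.+1 (fun y => cutoff y * grad b y ^+ 2)) <=
  n^-1 * zsum M.+1 (fun y => cutoff y * (tau y * q a y ^+ 2)) +
  (4 * n ^+ 3 + 2 * (b - a) * (8 * n ^+ 5)) / M%:R * (b - a).
Proof.
move=> a0 ab.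
set m := fun r => n^-1 * zsum M.+1 (fun y => cutoff y * (tau y * q r y ^+ 2)).
set d := fun r => n * zsum M.+1 (fun y => cutoff y * grad r y ^+ 2).
pose m' s := 2 * n * zsum M.+1 (fun y => cutoff y * q s y * (grad s y - grad s (y - 1))).
pose d' s := 2 * n * zsum M.+1 (fun y => cutoff y * grad s y * (flow s (y + 1) - flow s y)).
pose K := (4 * n ^+ 3 + 2 * (b - a) * (8 * n ^+ 5)) / M%:R.
have := @mean_value_upper _ (fun s => m s + 2 * (s - a) * d s)
  (fun s => m' s + (2 * d s + 2 * (s - a) * d' s)) a b ab.
move=> /(_ _ K); rewrite subrr mulr0 mul0r addr0 -lerBlDl; apply.
- move=> s sa sb; have s0 : 0 < s by exact: lt_le_trans sa.
  have := derD (derive_cutoff_mass s0)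
    (derM (derZ 2 (derB (deri s) (derc s a))) (derive_cutoff_energy s0)).
  by move/is_derive_eq; apply; rewrite /m' /d' /d; ring.
- move=> s sa sb; have s0 : 0 < s by exact: lt_le_trans sa.
  have h1 := cutoff_mass_decrease s0; have h2 := cutoff_energy_decrease s0.
  rewrite -/(m' s) -/(d s) in h1; rewrite -/(d' s) in h2.
  have sa0 : 0 <= 2 * (s - a) by rewrite mulr_ge0// subr_ge0.
  have h3 : 2 * (s - a) * d' s <= 2 * (s - a) * (8 * n ^+ 5 / M%:R).
    by rewrite ler_wpM2l.
  have h4 : 2 * (s - a) * (8 * n ^+ 5 / M%:R) <= 2 * (b - a) * (8 * n ^+ 5 / M%:R).
    rewrite ler_wpM2r ?divr_ge0 ?mulr_ge0 ?exprn_ge0 ?(ltW n0)//.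
    by rewrite ler_wpM2l// lerB.
  have -> : K = 4 * n ^+ 3 / M%:R + 2 * (b - a) * (8 * n ^+ 5 / M%:R).
    by rewrite /K; ring.
  lra.
Qed.

End cutoff.

(** As the width of the cutoff tends to infinity the error disappears, while on a
    fixed window the cutoff tends to 1. *)
Lemma energy_step a b A : 0 < a -> a <= b -> (forall J, mass2 a J <= A) ->
  forall J, mass2 b J + 2 * (b - a) * dirichlet b J <= A.
Proof.
move=> a0 ab mA J; have b0 : 0 < b by exact: lt_le_trans ab.
set X := mass2 b J + _.
pose K := (4 * n ^+ 3 + 2 * (b - a) * (8 * n ^+ 5)) * (b - a).
have ba0 : 0 <= b - a by rewrite subr_ge0.
have X0 : 0 <= X.
  by rewrite addr_ge0 ?mass2_ge0// mulr_ge0 ?dirichlet_ge0// mulr_ge0.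
have key M : (J < M)%N -> (X - A) * M%:R <= J%:R * X + K.
  move=> JM; have M0 : (0 < M)%N by exact: leq_ltn_trans JM.
  have M0' : 0 < M%:R :> R by rewrite ltr0n.
  have L := cutoff_lyapunov M0 a0 ab.
  have w0 : 0 <= 1 - J%:R / M%:R :> R.
    by rewrite subr_ge0 ler_pdivrMr// mul1r ler_nat ltnW.
  have restrict F : (forall y, 0 <= F y) ->
      (1 - J%:R / M%:R) * zsum J F <= zsum M.+1 (fun y => cutoff M y * F y).
    move=> F0; apply: (@le_trans _ _ (zsum J (fun y => cutoff M y * F y))); last first.
      apply: zsum_mono; last by rewrite ltnW// ltnW.
      by move=> y; rewrite mulr_ge0// cutoff_ge0.
    rewrite -zsumZ; apply: le_zsum => y y1 y2; rewrite ler_wpM2r// cutoff_ge//.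
    by clear - y1 y2; lia.
  have h1 : (1 - J%:R / M%:R) * X <=
      n^-1 * zsum M.+1 (fun y => cutoff M y * (tau y * q b y ^+ 2)) +
      2 * (b - a) * (n * zsum M.+1 (fun y => cutoff M y * grad b y ^+ 2)).
    rewrite /X mulrDr; apply: lerD.
      rewrite /mass2 mulrCA ler_wpM2l ?invr_ge0 ?(ltW n0)//; apply: restrict => y.
      by rewrite mulr_ge0 ?sqr_ge0// ltW.
    rewrite mulrCA ler_wpM2l ?mulr_ge0// /dirichlet mulrCA ler_wpM2l ?(ltW n0)//.
    by apply: restrict => y; exact: sqr_ge0.
  have h2 : n^-1 * zsum M.+1 (fun y => cutoff M y * (tau y * q a y ^+ 2)) <= A.
    apply: le_trans (mA M.+1); rewrite /mass2 ler_wpM2l ?invr_ge0 ?(ltW n0)//.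
    apply: le_zsum => y _ _; rewrite ler_piMl ?cutoff_le1//.
    by rewrite mulr_ge0 ?sqr_ge0// ltW.
  have h3 : (1 - J%:R / M%:R) * X <= A + K / M%:R.
    apply: (le_trans h1); apply: (le_trans L); rewrite lerD//.
    by rewrite /K mulrAC.
  have : (1 - J%:R / M%:R) * X * M%:R <= (A + K / M%:R) * M%:R by rewrite ler_wpM2r// ltW.
  have -> : (1 - J%:R / M%:R) * X * M%:R = X * M%:R - J%:R * X.
    by field; rewrite gt_eqF.
  have -> : (A + K / M%:R) * M%:R = A * M%:R + K by field; rewrite gt_eqF.
  lra.
rewrite leNgt; apply/negP => AX; have XA : 0 < X - A by rewrite subr_gt0.
have K0 : 0 <= J%:R * X + K.
  rewrite addr_ge0 ?mulr_ge0// addr_ge0 ?mulr_ge0 ?exprn_ge0 ?(ltW n0)//.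
have := archi_boundP (divr_ge0 K0 (ltW XA)); set m := Num.bound _.
rewrite ltr_pdivrMr// => mK.
have := key (J + m).+1 (leq_addr m J.+1).
rewrite -addn1 !natrD mulrDr mulrDr.
have : 0 <= (X - A) * J%:R by rewrite mulr_ge0// ltW.
by rewrite (mulrC m%:R) in mK; lra.
Qed.

End energy.

(** * Decay of the discrete heat kernel *)

Section nash.
Context {R : realType}.
Variables (n : R) (tau : int -> R) (q : R -> int -> R).
Implicit Types (s t a b : R) (x y z : int) (N J M : nat).
Hypothesis n1 : 1 <= n.
Hypothesis tau1 : forall y, 1 <= tau y.
Hypothesis q0 : forall s y, 0 < s -> 0 <= q s y.
Hypothesis q_mass : forall s N, 0 < s -> zsum N (fun y => tau y * q s y) <= n.
Hypothesis q_flow : forall s y, 0 < s -> is_derive s 1 (q ^~ y) (flow n tau q s y).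

Let n0 : 0 < n. Proof. exact: lt_le_trans ltr01 n1. Qed.

(** The square of a summable sequence is the sum of its increments up to
    infinity, and each increment is a gradient times a value; the inequality of
    arithmetic and geometric means, with the free parameter [l], separates
    them. *)
Lemma sobolev s Nb Eb l y : 0 < s -> 0 < l -> (forall J, mass2 n tau q s J <= Nb) ->
  (forall J, dirichlet n q s J <= Eb) ->
  q s y ^+ 2 <= l * Eb / 2 + 2 * Nb / l.
Proof.
move=> s0 l0 mN dE; apply/ler_addgt0Pl => e e0.
have qs z : 0 <= q s z by exact: q0.
have m0 : 0 < Num.min 1 e by rewrite lt_min ltr01.
have [N yN Ne] := small_term `|y|.+1 qs (fun N => q_sum tau1 q0 q_mass N s0) m0.
(* freezing the sequence below [y] makes the telescoping sum start at [y] *)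
pose F z := q s (Num.max z y) ^+ 2.
have T := telescope_zsum N F.
have FN : F (- N%:Z) = q s y ^+ 2 by rewrite /F (_ : Num.max _ _ = y)//; lia.
have FN' : F N%:Z <= e.
  rewrite /F (_ : Num.max _ _ = N%:Z); last by lia.
  move: Ne; rewrite le_min => /andP[N1 N2].
  by rewrite expr2 (le_trans _ N2)// ler_piMr.
have step z : - (l / 2 * (n * grad q s z ^+ 2) + (n * l)^-1 * (q s z ^+ 2 + q s (z + 1) ^+ 2))
    <= F (z + 1) - F z.
  have h : 0 <= l / 2 * (n * grad q s z ^+ 2) + (n * l)^-1 * (q s z ^+ 2 + q s (z + 1) ^+ 2).
    have hl : 0 <= l / 2 by rewrite divr_ge0// ltW.
    have hnl : 0 <= (n * l)^-1 by rewrite invr_ge0 mulr_ge0// ltW.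
    have hn : 0 <= n * grad q s z ^+ 2 by rewrite mulr_ge0 ?sqr_ge0// ltW.
    by rewrite addr_ge0// mulr_ge0// addr_ge0 ?sqr_ge0.
  have [zy|yz] := ltP z y.
    rewrite /F (_ : Num.max z y = y); last by clear - zy; lia.
    rewrite (_ : Num.max (z + 1) y = y); last by clear - zy; lia.
    by rewrite subrr oppr_le0.
  rewrite /F (_ : Num.max z y = z); last by clear - yz; lia.
  rewrite (_ : Num.max (z + 1) y = z + 1); last by clear - yz; lia.
  rewrite -subr_ge0.
  have -> : q s (z + 1) ^+ 2 - q s z ^+ 2 - - (l / 2 * (n * grad q s z ^+ 2) +
      (n * l)^-1 * (q s z ^+ 2 + q s (z + 1) ^+ 2)) =
    (2 * (n * l))^-1 * ((n * l * grad q s z + (q s (z + 1) + q s z)) ^+ 2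
      + (q s (z + 1) - q s z) ^+ 2).
    by rewrite /grad; field; rewrite !gt_eqF.
  by rewrite mulr_ge0 ?addr_ge0 ?sqr_ge0// invr_ge0 !mulr_ge0// ltW.
have := @le_zsum _ N _ _ (fun z _ _ => step z).
rewrite T FN zsumN zsumD !zsumZ zsumD => H.
have h1 : l / 2 * (n * zsum N (fun z => grad q s z ^+ 2)) <= l * Eb / 2.
  rewrite mulrAC ler_wpM2r ?invr_ge0// ler_wpM2l ?(ltW l0)//; exact: dE.
have m2 J : zsum J (fun z => q s z ^+ 2) <= n * Nb.
  rewrite mulrC -ler_pdivrMr//; apply: le_trans (mN J); rewrite /mass2 mulrC.
  rewrite ler_wpM2l ?invr_ge0 ?(ltW n0)//; apply: le_zsum => z _ _.
  by rewrite ler_peMl ?sqr_ge0.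
have h2 : zsum N (fun z => q s z ^+ 2) <= n * Nb by exact: m2.
have h3 : zsum N (fun z => q s (z + 1) ^+ 2) <= n * Nb.
  by apply: le_trans (m2 N.+1); apply: (zsum_shift N (fun z => sqr_ge0 (q s z))).
have h4 : (n * l)^-1 * (zsum N (fun z => q s z ^+ 2) + zsum N (fun z => q s (z + 1) ^+ 2))
    <= 2 * Nb / l.
  have -> : 2 * Nb / l = (n * l)^-1 * (n * Nb + n * Nb) by field; rewrite !gt_eqF.
  by rewrite ler_wpM2l ?lerD// invr_ge0 mulr_ge0// ltW.
by lra.
Qed.

Let bounded_has_sup (f : nat -> R) A : (forall J, f J <= A) ->
  has_sup (range f).
Proof. by move=> fA; split; [exists (f 0%N), 0%N|exists A => _ [J _ <-]]. Qed.

(** Nash's inequality [mass2^3 <= 4 * dirichlet] turns the energy inequality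
    into a contraction of [mass2] under doubling of the time. *)
Lemma mass2_doubling b : 0 < b ->
  (forall J, mass2 n tau q (b / 2) J <= 4 / Num.sqrt b) ->
  forall J, mass2 n tau q b J <= 2 / Num.sqrt b /\
    dirichlet n q b J <= 4 / (b * Num.sqrt b).
Proof.
move=> b0 mA; pose r := Num.sqrt b; rewrite -/r.
have r0 : 0 < r by rewrite sqrtr_gt0.
have bE : b = r ^+ 2 by rewrite /r sqr_sqrtr// ltW.
have b20 : 0 < b / 2 by rewrite divr_gt0.
have bb : b / 2 <= b by lra.
have step := energy_step n1 tau1 q0 q_mass q_flow b20 bb mA.
have {}step J : mass2 n tau q b J + b * dirichlet n q b J <= 4 / r.
  by have := step J; rewrite (_ : 2 * (b - b / 2) = b)//; field.
have mono J J' : mass2 n tau q b J + b * dirichlet n q b J' <= 4 / r.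
  apply: le_trans (step (maxn J J')); apply: lerD.
    rewrite /mass2 ler_wpM2l ?invr_ge0 ?(ltW n0)//; apply: zsum_mono; last exact: leq_maxl.
    by move=> y; rewrite mulr_ge0 ?sqr_ge0// (le_trans ler01).
  rewrite ler_wpM2l ?(ltW b0)// /dirichlet ler_wpM2l ?(ltW n0)//.
  by apply: zsum_mono; [move=> y; exact: sqr_ge0|exact: leq_maxr].
have d0 J : 0 <= dirichlet n q b J by exact: dirichlet_ge0.
have m0 J : 0 <= mass2 n tau q b J by exact: mass2_ge0.
have mB J : mass2 n tau q b J <= 4 / r.
  by apply: le_trans (mono J J); rewrite lerDl mulr_ge0// ltW.
have supM := bounded_has_sup mB.
set m := sup (range (mass2 n tau q b)) in supM *.
have mle J : mass2 n tau q b J <= m by apply: ub_le_sup; [case: supM|exists J].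
have m_ge0 : 0 <= m by exact: le_trans (mle 0%N).
have dB J : dirichlet n q b J <= (4 / r - m) / b.
  rewrite ler_pdivlMr// lerBrDr mulrC -lerBrDl.
  by apply: ge_sup; [case: supM|move=> _ [J' _ <-]; rewrite lerBrDr].
have E0 : 0 <= (4 / r - m) / b by exact: le_trans (dB 0%N).
set E := (4 / r - m) / b in dB E0 *.
have nash : m ^+ 3 <= 4 * E.
  have [m00|mp] := leP m 0.
    have -> : m = 0 by apply/eqP; rewrite eq_le m00.
    by rewrite expr0n /= mulr_ge0.
  (* [l = 4 / m] leaves half of [m^2] on the right-hand side below *)
  have l0 : 0 < 4 / m by rewrite divr_gt0.
  pose B2 := 4 / m * E / 2 + 2 * m / (4 / m).
  have B20 : 0 <= B2.
    apply: addr_ge0.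
      by apply: divr_ge0 => //; apply: mulr_ge0 => //; exact: ltW.
    by apply: divr_ge0; [exact: mulr_ge0|exact: ltW].
  have qB y : q b y <= Num.sqrt B2.
    have qby := q0 y b0.
    rewrite -(ger0_norm qby) -sqrtr_sqr ler_wsqrtr//.
    exact: sobolev.
  have mB2 : m <= Num.sqrt B2.
    apply: ge_sup; first by case: supM.
    by move=> _ [J _ <-]; exact: mass2_le_sup.
  have : m ^+ 2 <= B2.
    by rewrite -(sqr_sqrtr B20) ler_sqr ?nnegrE ?sqrtr_ge0.
  have -> : B2 = 2 * E / m + m ^+ 2 / 2 by rewrite /B2; field; rewrite gt_eqF.
  move=> h; have {}h : m ^+ 2 <= 4 * E / m by lra.
  by move: h; rewrite ler_pdivlMr// -exprSr.
(* with [u = m r] the inequalities read [u^3 <= 4 (4 - u)], which fails for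
   [u > 2] *)
have m2 : m <= 2 / r.
  rewrite leNgt; apply/negP => mr.
  have u2 : 2 < m * r by move: mr; rewrite ltr_pdivrMr.
  have : (m * r) ^+ 3 <= 4 * (4 - m * r).
    have -> : (m * r) ^+ 3 = m ^+ 3 * r ^+ 3 by ring.
    have -> : 4 * (4 - m * r) = 4 * E * r ^+ 3.
      by rewrite /E bE; field; rewrite gt_eqF.
    by rewrite ler_wpM2r// exprn_ge0// ltW.
  have u4 : 4 < (m * r) * (m * r) by nra.
  have : 8 < (m * r) ^+ 3 by rewrite exprS expr2; nra.
  lra.
move=> J; split; first exact: le_trans (mle J) m2.
apply: (le_trans (dB J)); rewrite /E.
have -> : 4 / (b * r) = 4 / r / b by field; rewrite !gt_eqF.
by rewrite ler_wpM2r ?invr_ge0 ?(ltW b0)// gerBl.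
Qed.

(** For times below [(2/n)^2] the crude bound of the density by [n] suffices;
    later times are reached by doublings. *)
Lemma mass2_decay s J : 0 < s -> mass2 n tau q s J <= 2 / Num.sqrt s.
Proof.
move=> s0; pose s1 := (2 / n) ^+ 2.
have s10 : 0 < s1 by rewrite exprn_gt0// divr_gt0.
suff H k : forall s, 0 < s -> s <= 2 ^+ k * s1 -> forall J, mass2 n tau q s J <= 2 / Num.sqrt s.
  have := archi_boundP (divr_ge0 (ltW s0) (ltW s10)); set m := Num.bound _.
  rewrite ltr_pdivrMr// => mK; apply: (H m) => //; apply: (le_trans (ltW mK)).
  rewrite ler_wpM2r ?(ltW s10)// -natrX ler_nat.
  by apply: ltnW; exact: ltn_expl.
elim: k => [|k IH] {s0 J} b b0.
  rewrite mul1r => bs J; have r0 : 0 < Num.sqrt b by rewrite sqrtr_gt0.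
  apply: (@le_trans _ _ n).
    by apply: mass2_le_sup => //; move=> y; exact: q_le.
  rewrite ler_pdivlMr// mulrC -ler_pdivlMr//.
  rewrite -(@ger0_norm _ (2 / n)) ?divr_ge0 ?(ltW n0)// -sqrtr_sqr.
  exact: ler_wsqrtr.
move=> bk; have b20 : 0 < b / 2 by rewrite divr_gt0.
have mA J : mass2 n tau q (b / 2) J <= 4 / Num.sqrt b.
  apply: (le_trans (IH _ b20 _ J)).
    by rewrite ler_pdivrMr// mulrAC -exprSr.
  have r0 : 0 < Num.sqrt b by rewrite sqrtr_gt0.
  have r1 : 0 < Num.sqrt (b / 2) by rewrite sqrtr_gt0.
  rewrite ler_pdivrMr// mulrAC ler_pdivlMr//.
  have : Num.sqrt b <= 2 * Num.sqrt (b / 2).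
    rewrite -[leLHS]ger0_norm ?(ltW r0)// -[leRHS]ger0_norm ?mulr_ge0 ?(ltW r1)//.
    rewrite -ler_sqr ?nnegrE// !real_normK ?num_real//.
    by rewrite exprMn !sqr_sqrtr ?(ltW b0) ?(ltW b20)//; lra.
  lra.
by move=> J; have [] := mass2_doubling b0 mA J.
Qed.

Lemma dirichlet_decay s J : 0 < s -> dirichlet n q s J <= 4 / (s * Num.sqrt s).
Proof.
move=> s0; have s20 : 0 < s / 2 by rewrite divr_gt0.
have mA J' : mass2 n tau q (s / 2) J' <= 4 / Num.sqrt s.
  apply: (le_trans (mass2_decay J' s20)).
  have r0 : 0 < Num.sqrt s by rewrite sqrtr_gt0.
  have r1 : 0 < Num.sqrt (s / 2) by rewrite sqrtr_gt0.
  rewrite ler_pdivrMr// mulrAC ler_pdivlMr//.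
  have : Num.sqrt s <= 2 * Num.sqrt (s / 2).
    rewrite -[leLHS]ger0_norm ?(ltW r0)// -[leRHS]ger0_norm ?mulr_ge0 ?(ltW r1)//.
    rewrite -ler_sqr ?nnegrE// !real_normK ?num_real//.
    by rewrite exprMn !sqr_sqrtr ?(ltW s0) ?(ltW s20)//; lra.
  lra.
by have [] := mass2_doubling s0 mA J.
Qed.

(** Applying the pointwise inequality with [l] the square root of [s] balances
    its two terms. *)
Lemma q_decay s y : 0 < s -> q s y <= 3 / Num.sqrt s.
Proof.
move=> s0; have r0 : 0 < Num.sqrt s by rewrite sqrtr_gt0.
have := sobolev y s0 r0 (fun J => mass2_decay J s0) (fun J => dirichlet_decay J s0).
have sE : s = Num.sqrt s ^+ 2 by rewrite sqr_sqrtr// ltW.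
move: r0 sE; set r := Num.sqrt s => r0 sE; rewrite {2}sE => H.
have {}H : q s y ^+ 2 <= (3 / r) ^+ 2.
  apply: (le_trans H).
  have -> : (3 / r) ^+ 2 = r * (4 / (r ^+ 2 * r)) / 2 + 2 * (2 / r) / r + 3 / r ^+ 2.
    by field; rewrite gt_eqF.
  by rewrite lerDl divr_ge0 ?exprn_ge0// ltW.
by move: H; rewrite ler_sqr ?nnegrE ?q0 ?divr_ge0 ?(ltW r0).
Qed.

End nash.

(** * Functions on the rescaled lattice *)

Section vanishing_functions.
Context {R : realType}.
Implicit Types (F G : int -> R) (y z : int) (e : R).

(** On the lattice, which is discrete and closed, this is membership in [C0]. *)
Definition vanishing F := forall e, 0 < e -> exists J : nat,
  forall y, (J <= `|y|)%N -> `|F y| <= e.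

Lemma vanishing_bounded F : vanishing F -> exists B, forall y, `|F y| <= B.
Proof.
move=> /(_ 1 ltr01)[J HJ].
exists (1 + zsum J (fun y => `|F y|)) => y.
have z0 : 0 <= zsum J (fun y => `|F y|) by apply: zsum_ge0.
have [Jy|yJ] := leqP J `|y|%N.
  by apply: le_trans (HJ _ Jy) _; rewrite lerDl.
have := @zsum_ge_term _ J (fun y => `|F y|) y (fun y => normr_ge0 _) yJ.
lra.
Qed.

Definition delta y z : R := (z == y)%:R.

Lemma vanishing_delta y : vanishing (delta y).
Proof.
move=> e e0; exists `|y|.+1%N => z yz; rewrite /delta.
have -> : (z == y) = false by lia.
by rewrite normr0 ltW.
Qed.

Lemma vanishingD F G : vanishing F -> vanishing G -> vanishing (fun y => F y + G y).
Proof.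
move=> Fv Gv e e0; have e2 : 0 < e / 2 by rewrite divr_gt0.
have [J HJ] := Fv _ e2; have [K HK] := Gv _ e2.
exists (maxn J K) => y; rewrite geq_max => /andP[Jy Ky].
rewrite (le_trans (ler_normD _ _))//; have := HJ _ Jy; have := HK _ Ky; lra.
Qed.

Lemma vanishingM F G B : (forall y, `|F y| <= B) -> vanishing G ->
  vanishing (fun y => F y * G y).
Proof.
move=> FB Gv e e0; have B0 : 0 <= B by exact: le_trans (FB 0).
have B1 : 0 < 1 + B by rewrite ltr_pwDl.
have [J HJ] := Gv _ (divr_gt0 e0 B1); exists J => y Jy.
rewrite normrM; apply: (@le_trans _ _ ((1 + B) * (e / (1 + B)))).
  by apply: ler_pM => //; [rewrite (le_trans (FB y))// lerDr|exact: HJ].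
by rewrite mulrCA divff ?mulr1// gt_eqF.
Qed.

Lemma vanishing_shift F (a : int) : vanishing F -> vanishing (fun y => F (y + a)).
Proof.
move=> Fv e e0; have [J HJ] := Fv e e0.
by exists (J + `|a|)%N => y Jy; apply: HJ; lia.
Qed.

(** The restriction of [F] to the window [-J, J-1], as a combination of Dirac
    masses. *)
Definition window J F z : R := zsum J (fun y => F y * delta y z).

Lemma windowE J F z :
  window J F z = if (- J%:Z <= z) && (z < J%:Z) then F z else 0.
Proof.
rewrite /window; elim: J => [|J IH].
  by rewrite zsum0; case: ifP => //; lia.
rewrite zsumS IH /delta.
have [->|zJ] := eqVneq z (Posz J).
  rewrite (_ : (Posz J == Negz J) = false) ?mulr0 ?mulr1 ?addr0; last by lia.
  have -> : ((- J%:Z <= J) && (J%:Z < J)) = false by lia.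
  have -> : ((- J.+1%:Z <= J) && (J%:Z < J.+1)) = true by lia.
  by rewrite add0r.
have [->|zJ'] := eqVneq z (Negz J).
  have -> : ((- J%:Z <= Negz J) && (Negz J < J)) = false by lia.
  have -> : ((- J.+1%:Z <= Negz J) && (Negz J < J.+1)) = true by lia.
  by rewrite mulr0 mulr1 !add0r.
rewrite !mulr0 !addr0.
by have -> : ((- J.+1%:Z <= z) && (z < J.+1)) = ((- J%:Z <= z) && (z < J)) by lia.
Qed.

Lemma vanishing_window J F : vanishing (window J F).
Proof.
move=> e e0; exists J.+1 => z zJ; rewrite windowE.
by case: ifP => [|_]; [lia|rewrite normr0 ltW].
Qed.

End vanishing_functions.

Section lattice_functions.
Context {R : realType}.
Variable n : nat.
Hypothesis n0 : (0 < n)%N.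
Local Notation N := (n%:R : R).
Local Notation S := (@lattice R n).
Implicit Types (F G : int -> R) (y z : int).

Let N0 : 0 < N. Proof. by rewrite ltr0n. Qed.
Let Nn : N != 0. Proof. by rewrite gt_eqF. Qed.

Definition lattice_point y : R := y%:~R / N.

Lemma point_lattice y : S (lattice_point y). Proof. by exists y. Qed.

(** Functions on the lattice have to be given on the whole line; rounding down
    extends them from the lattice. *)
Definition on_lattice F : R -> R := fun x => F (Num.floor (N * x)).

Lemma on_latticeE F y : on_lattice F (lattice_point y) = F y.
Proof. by rewrite /on_lattice /lattice_point mulrCA divff// mulr1 intrKfloor. Qed.

Lemma point_inj : injective lattice_point.
Proof.
move=> y z /(congr1 (fun x => Num.floor (N * x))).
by rewrite /lattice_point !(mulrCA N) !divff// !mulr1 !intrKfloor.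
Qed.

Lemma point_dist y z : `|lattice_point y - lattice_point z| < N^-1 -> y = z.
Proof.
rewrite /lattice_point -mulrBl -intrB normrM [`|_^-1|]gtr0_norm ?invr_gt0//.
rewrite -[ltRHS]mul1r ltr_pM2r ?invr_gt0// -intr_norm (_ : 1 = 1%:~R)// ltr_int.
by lia.
Qed.

Lemma lattice_measurable : measurable (S : set (measurableTypeR R)).
Proof.
have -> : (S : set (measurableTypeR R)) =
    \bigcup_k ([set lattice_point (Posz k)] `|` [set lattice_point (Negz k)]).
  apply/seteqP; split=> [x [[k|k] ->]|x [k _ [->|->]]].
  - by exists k => //; left.
  - by exists k => //; right.
  - exact: point_lattice.
  - exact: point_lattice.
by apply: bigcup_measurable => k _; apply: measurableU; exact: measurable_set1.
Qed.

Lemma lattice_continuous (f : R -> R) : {within S, continuous f}.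
Proof.
apply/subspace_continuousP => _ [y ->].
apply/cvgrPdist_le => e e0; rewrite near_withinE.
apply/nbhs_ballP; exists N^-1; first by rewrite /= invr_gt0.
move=> x /= xb [z xz]; rewrite xz in xb *.
by rewrite (point_dist xb) subrr normr0 ltW.
Qed.

Lemma vanishing_C0 f : vanishing (fun y => f (lattice_point y)) -> C0 S f.
Proof.
move=> fv; split; first exact: lattice_continuous.
move=> e e0; have e2 : 0 < e / 2 by rewrite divr_gt0.
have [J HJ] := fv _ e2; exists (J%:R / N) => _ [y ->] Jy.
apply: (@le_lt_trans _ _ (e / 2)); last by lra.
apply: HJ; move: Jy; rewrite normrM [`|_^-1|]gtr0_norm ?invr_gt0//.
rewrite ltr_pM2r ?invr_gt0// -intr_norm -[J%:R]/(J%:~R) ltr_int.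
by lia.
Qed.

Lemma vanishing_bounded_C0 F : vanishing F -> bounded_C0 S (on_lattice F).
Proof.
move=> Fv; split.
  apply: vanishing_C0 => e e0; have [J HJ] := Fv e e0.
  by exists J => y Jy; rewrite on_latticeE; exact: HJ.
have [B HB] := vanishing_bounded Fv.
by exists B => _ [y ->]; rewrite on_latticeE.
Qed.

Lemma C0_vanishing f : C0 S f -> vanishing (fun y => f (lattice_point y)).
Proof.
move=> [_ fv] e e0; have [M HM] := fv e e0.
pose J := Num.bound (N * `|M|).
exists J => y Jy; apply: ltW; apply: HM; first exact: point_lattice.
have MJ : N * `|M| < J%:R by apply: archi_boundP; rewrite mulr_ge0// ltW.
rewrite /lattice_point normrM [`|_^-1|]gtr0_norm ?invr_gt0// ltr_pdivlMr//.
rewrite (le_lt_trans (ler_norm _))// normrM (gtr0_norm N0) mulrC (lt_le_trans MJ)//.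
by rewrite -intr_norm -[J%:R]/(J%:~R) ler_int; lia.
Qed.

End lattice_functions.

(** * The forward equation of the chain *)

Section chain.
Context {R : realType}.
Variables (n : nat) (w : int -> R) (pn : R -> R -> R -> R).
Variable Q : R -> R -> probability (measurableTypeR R) R.
Hypothesis n0 : (0 < n)%N.
Hypothesis w1 : forall y, 1 <= w y.
Local Notation N := (n%:R : R).
Local Notation S := (@lattice R n).
Local Notation pt := (@lattice_point R n).
Local Notation onl := (@on_lattice R n).
Hypothesis QF : is_feller S Q.
Hypothesis QL : has_generator S Q (btm_generator n w).
Hypothesis Qp : is_transition_density S (lattice_measure n w) Q pn.
Implicit Types (F G : int -> R) (y z : int) (s t x : R) (J : nat).

Let N0 : 0 < N. Proof. by rewrite ltr0n. Qed.
Let Nn : N != 0. Proof. by rewrite gt_eqF. Qed.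
Let w0 y : 0 < w y. Proof. exact: lt_le_trans ltr01 (w1 y). Qed.
Let mS := @lattice_measurable R n.

Definition density s y : R := pn s 0 (pt y).
Definition transition s y : R := semigroup S Q s (onl (delta y)) 0.

Lemma origin_lattice : S 0.
Proof. by exists 0; rewrite mul0r. Qed.

Let S0 := origin_lattice.

Lemma density_ge0 s y : 0 < s -> 0 <= density s y.
Proof. by move=> s0; case: Qp => + _ _; apply=> //; exact: (@point_lattice R n y). Qed.

Lemma transitionE s y : 0 < s -> transition s y = w y * density s y / N.
Proof.
move=> s0; rewrite /transition /semigroup /Rintegral.
have mpt : measurable ([set pt y] : set (measurableTypeR R)) by exact: measurable_set1.
have -> : (\int[Q s 0]_(x in S) (onl (delta y) x)%:E = Q s 0 [set pt y])%E.
  transitivity (\int[Q s 0]_(x in S) (\1_([set pt y] : set (measurableTypeR R)) x)%:E)%E.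
    apply: eq_integral => x /set_mem[z ->].
    rewrite -/(pt z) on_latticeE// /delta indicE.
    congr (_%:E); congr (nat_of_bool _)%:R; apply/idP/idP => [/eqP ->|].
      by apply/mem_set.
    by move=> /set_mem h; rewrite (point_inj n0 (h : pt z = pt y)).
  rewrite integral_indic; [|exact: mS|exact: mpt].
  by rewrite setIidl// => x ->; exact: (@point_lattice R n y).
case: Qp => _ _ /(_ s 0 [set pt y] s0 S0 mpt) ->; last first.
  by move=> x ->; exact: (@point_lattice R n y).
transitivity (fine (\int[lattice_measure n w]_(x in [set pt y]) (density s y)%:E)%E).
  by congr fine; apply: eq_integral => x /set_mem ->.
rewrite integral_cst//.
have lm : lattice_measure n w [set pt y] = (`|w y| / N)%:E.
  rewrite /lattice_measure (_ : [set x : int | _] = [set y]); last first.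
    by apply/seteqP; split=> z /= h; [exact: (point_inj n0 (h : pt z = pt y))|rewrite h].
  by rewrite esum_set1// lee_fin divr_ge0.
transitivity (fine ((density s y)%:E * (`|w y| / N)%:E)%E).
  by congr (fine (_ * _)%E).
by rewrite -EFinM /= gtr0_norm//; ring.
Qed.

Lemma semigroup_on_lattice_eq s f F : (forall y, f (pt y) = F y) ->
  semigroup S Q s f 0 = semigroup S Q s (onl F) 0.
Proof.
move=> fF; apply: eq_Rintegral => x /set_mem[y ->].
by rewrite -/(pt y) fF; exact: (esym (on_latticeE n0 F y)).
Qed.

Lemma semigroup_window s F J : 0 <= s ->
  semigroup S Q s (onl (window J F)) 0 = zsum J (fun y => F y * transition s y).
Proof.
move=> s0; elim: J => [|J IH].
  rewrite zsum0; apply/eqP; rewrite -normr_le0.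
  apply: (semigroup_le mS QF s0 S0).
    apply: (bounded_C0_measurable mS).
    apply: (vanishing_bounded_C0 n0); exact: vanishing_window.
  move=> _ [y ->]; rewrite -/(pt y) (on_latticeE n0) /window zsum0.
  by rewrite normr0.
rewrite zsumS -IH.
have bd y : bounded_C0 S (onl (delta y)).
  apply: (vanishing_bounded_C0 n0); exact: vanishing_delta.
have bw : bounded_C0 S (onl (window J F)).
  apply: (vanishing_bounded_C0 n0); exact: vanishing_window.
have bZ a y : bounded_C0 S (fun x => a * onl (delta y) x).
  exact: bounded_C0Z.
have bD f g : bounded_C0 S f -> bounded_C0 S g -> bounded_C0 S (fun x => f x + g x).
  move=> bf bg; have := bounded_C0B bf (bounded_C0Z (-1) bg).
  by under eq_fun do rewrite mulN1r opprK.
rewrite /transition -(semigroupZ Q mS s 0 (F (Posz J)) (bd (Posz J))).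
rewrite -(semigroupZ Q mS s 0 (F (Negz J)) (bd (Negz J))).
rewrite -(semigroupD Q mS s 0 (bZ _ _) (bZ _ _)).
rewrite -(semigroupD Q mS s 0 bw (bD _ _ (bZ _ _) (bZ _ _))).
apply: eq_Rintegral => x _.
by rewrite /on_lattice /window zsumS.
Qed.

(** The semigroup applied to the indicator of a window is at most 1. *)
Lemma transition_mass s J : 0 < s -> zsum J (transition s) <= 1.
Proof.
move=> s0; have := @semigroup_window s (fun=> 1) J (ltW s0).
rewrite (@eq_zsum _ _ _ (transition s)); last by move=> y; rewrite mul1r.
move=> <-; apply: (le_trans (ler_norm _)); apply: (semigroup_le mS QF) => //.
- exact: ltW.
- by apply: bounded_C0_measurable => //; apply: vanishing_bounded_C0 => //; exact: vanishing_window.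
- move=> _ [y ->]; rewrite -/(pt y) on_latticeE// windowE.
  by case: ifP; rewrite ?normr1// normr0.
Qed.

(** A bounded function vanishing at infinity is a uniform limit of its
    windows. *)
Lemma semigroup_sum s F e : 0 < s -> vanishing F -> 0 < e -> exists J0 : nat,
  forall J, (J0 <= J)%N ->
    `|semigroup S Q s (onl F) 0 - zsum J (fun y => F y * transition s y)| <= e.
Proof.
move=> s0 Fv e0; have [J0 HJ] := Fv e e0; exists J0 => J JJ.
rewrite -semigroup_window; last exact: ltW.
apply: (semigroup_dist mS QF) => //.
- exact: ltW.
- exact: vanishing_bounded_C0.
- by apply: vanishing_bounded_C0 => //; exact: vanishing_window.
- move=> _ [y ->]; rewrite -/(pt y) !on_latticeE// windowE.
  case: ifP => [_|h]; first by rewrite subrr normr0 ltW.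
  by rewrite subr0; apply: HJ; lia.
Qed.

Lemma density_mass s J : 0 < s -> zsum J (fun y => w y * density s y) <= N.
Proof.
move=> s0; have := transition_mass J s0.
rewrite (@eq_zsum _ _ _ (fun y => N^-1 * (w y * density s y))); last first.
  by move=> y; rewrite transitionE// mulrC.
by rewrite zsumZ mulrC ler_pdivrMr// mul1r.
Qed.

Definition chain_generator F y : R :=
  N ^+ 2 / w y * ((F (y + 1) - F y) + (F (y - 1) - F y)).

Lemma btm_generator_on_lattice f F : (forall y, f (pt y) = F y) ->
  btm_generator n w f (onl (chain_generator F)).
Proof.
move=> fF y; rewrite -!/(pt _) on_latticeE// /chain_generator.
by rewrite !fF.
Qed.

Lemma vanishing_generator F : vanishing F -> vanishing (chain_generator F).
Proof.
move=> Fv; rewrite /chain_generator; apply: (@vanishingM _ _ _ (N ^+ 2)) => [y|].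
  rewrite ger0_norm ?divr_ge0 ?sqr_ge0 ?(ltW (w0 y))//.
  by rewrite ler_pdivrMr// ler_peMr// sqr_ge0.
have FN : vanishing (fun y => -1 * F y).
  by apply: (@vanishingM _ _ _ 1) => // y; rewrite normrN normr1.
have := vanishingD (vanishingD (vanishing_shift 1 Fv) FN)
   (vanishingD (vanishing_shift (-1) Fv) FN).
by under eq_fun do rewrite !mulN1r.
Qed.

(** The generator is symmetric for the speed measure, so applying it to a Dirac
    mass at [y] amounts to the generator acting on the density at [y]. *)
Lemma transition_generator s y : 0 < s ->
  semigroup S Q s (onl (chain_generator (delta y))) 0 =
  w y / N * flow N w density s y.
Proof.
move=> s0.
have E : chain_generator (delta y) =1
    window (`|y| + 2) (chain_generator (delta y)).
  move=> z; rewrite windowE; case: ifP => // h.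
  rewrite /chain_generator /delta.
  have -> : (z + 1 == y) = false by lia.
  have -> : (z == y) = false by lia.
  have -> : (z - 1 == y) = false by lia.
  by rewrite !subr0 addr0 mulr0.
have vg : vanishing (chain_generator (delta y)).
  by apply: vanishing_generator; exact: vanishing_delta.
pose D := chain_generator (delta y).
have DE z : D z * transition s z =
    N * density s (y - 1) * delta (y - 1) z + N * density s (y + 1) * delta (y + 1) z
    - 2 * (N * density s y) * delta y z.
  rewrite /D /chain_generator transitionE// /delta.
  have wz : w z != 0 by rewrite gt_eqF.
  have [->|h1] := eqVneq z y.
    have -> : (y + 1 == y) = false by lia.
    have -> : (y - 1 == y) = false by lia.
    have -> : (y == y - 1) = false by lia.
    have -> : (y == y + 1) = false by lia.
    by rewrite /=; field; rewrite Nn gt_eqF.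
  have [->|h2] := eqVneq z (y - 1).
    have -> : (y - 1 + 1 == y) = true by lia.
    have -> : (y - 1 - 1 == y) = false by lia.
    have -> : (y - 1 == y + 1) = false by lia.
    by rewrite /=; field; rewrite Nn gt_eqF.
  have [->|h3] := eqVneq z (y + 1).
    have -> : (y + 1 + 1 == y) = false by lia.
    have -> : (y + 1 - 1 == y) = true by lia.
    by rewrite /=; field; rewrite Nn gt_eqF.
  have -> : (z + 1 == y) = false by lia.
  have -> : (z - 1 == y) = false by lia.
  by rewrite /=; ring.
have pick (a : int) J : (`|a| < J)%N -> zsum J (delta a) = 1 :> R.
  move=> aJ; have := @windowE R J (fun=> 1) a.
  have -> : (- J%:Z <= a) && (a < J%:Z) = true by lia.
  move=> <-; rewrite /window; apply: eq_zsum => z.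
  by rewrite mul1r /delta eq_sym.
rewrite (@semigroup_on_lattice_eq s _ (window (`|y| + 2) D)); last first.
  by move=> z; rewrite on_latticeE// -E.
rewrite semigroup_window; last exact: ltW.
rewrite (eq_zsum _ DE) zsumB zsumD !zsumZ !pick; [|lia..].
rewrite /flow /grad subrK; field; rewrite Nn gt_eqF//.
Qed.

(** Dirac masses belong to the domain of the generator, so the semigroup calculus
    with a constant family of test functions gives the forward equation. *)
Lemma density_derive s y : 0 < s ->
  is_derive s 1 (density ^~ y) (flow N w density s y).
Proof.
move=> s0.
have bd : bounded_C0 S (onl (delta y)).
  by apply: vanishing_bounded_C0 => //; exact: vanishing_delta.
have bg : bounded_C0 S (onl (chain_generator (delta y))).
  by apply: vanishing_bounded_C0 => //; apply: vanishing_generator; exact: vanishing_delta.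
have bz : bounded_C0 S (fun=> 0 : R).
  have := bounded_C0Z 0 bd; by under eq_fun do rewrite mul0r.
have L : btm_generator n w (onl (delta y)) (onl (chain_generator (delta y))).
  by apply: btm_generator_on_lattice => z; rewrite on_latticeE.
have ss : s < s + 1 by rewrite ltrDl.
have ex (r e : R) : 0 < r -> 0 < e -> exists2 d : R, 0 < d & forall k x, `|k| < d -> S x ->
    `|onl (delta y) x - onl (delta y) x - k * 0| <= e * `|k|.
  by move=> _ e0; exists 1 => // k x _ _; rewrite subrr mulr0 subr0 normr0 mulr_ge0// ltW.
have := @semigroup_derive R S Q mS QF _ QL (fun=> onl (delta y))
  (fun=> onl (chain_generator (delta y))) (fun _ _ => 0) (s + 1) 0 S0
  (fun _ _ => bd) (fun _ _ => bg) (fun _ _ => bz) (fun _ _ => L) ex s s0 ss.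
rewrite (_ : (fun x => _ - 0) = onl (chain_generator (delta y))); last first.
  by apply/funext => x; rewrite subr0.
rewrite transition_generator// => d.
have := derZ (N / w y) d.
have wy : w y != 0 by rewrite gt_eqF.
rewrite (_ : N / w y * _ = flow N w density s y); last by field; rewrite wy Nn.
apply: near_eq_is_derive.
near=> r.
have r0 : 0 < r by near: r; exact: lt_nbhsr.
rewrite -/(transition r y) transitionE//; field; rewrite wy Nn//.
Unshelve. all: by end_near. Qed.

End chain.

(** * Summation by parts against the environment *)

Section noise.
Context {R : realType}.
Variables (N c : R) (w q F M om : int -> R).
Variables (A B Qm Em Om W2 : R).
Implicit Types (y z : int) (J : nat) (e : R).
Hypothesis N1 : 1 <= N.
Hypothesis ME : forall y, M (y + 1) - M y = N^-1 * (c - w y).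
Hypothesis om0 : forall y, 0 <= om y.
Hypothesis om1 : forall y, om y <= 1.
Hypothesis om_vanishing : vanishing om.
Hypothesis FA : forall y, `|F y| <= A * om y.
Hypothesis FB : forall y, `|F (y + 1) - F y| <= B / N * om (y + 1).
Hypothesis q0 : forall y, 0 <= q y.
Hypothesis qQ : forall y, q y <= Qm.
Hypothesis A0 : 0 <= A.
Hypothesis B0 : 0 <= B.
Hypothesis qE : forall J, N * zsum J (fun y => (q (y + 1) - q y) ^+ 2) <= Em.
Hypothesis MW : forall J, N^-1 * zsum J (fun y => M y ^+ 2 * om y) <= W2.
Hypothesis omO : forall J, N^-1 * zsum J om <= Om.

Let N0 : 0 < N. Proof. exact: lt_le_trans ltr01 N1. Qed.
Let Q0 : 0 <= Qm. Proof. exact: le_trans (q0 0) (qQ 0). Qed.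

Let term0 y : 0 <= M y ^+ 2 * om y. Proof. by rewrite mulr_ge0 ?sqr_ge0. Qed.

Let W20 : 0 <= W2.
Proof. by apply: le_trans (MW 0%N); rewrite zsum0 mulr0. Qed.

Lemma noise_vanishing : vanishing (fun y => M y * om y).
Proof.
move=> e e0; have W1 : 0 < N * W2 + 1 by rewrite ltr_wpDl// mulr_ge0// ltW.
have [J HJ] := om_vanishing (divr_gt0 (exprn_gt0 2 e0) W1).
exists J => y Jy.
have h1 : M y ^+ 2 * om y <= N * W2.
  have := MW `|y|.+1; rewrite mulrC ler_pdivrMr// (mulrC W2); apply: le_trans.
  by apply: (@zsum_ge_term _ _ (fun y => M y ^+ 2 * om y)).
have h2 : om y <= e ^+ 2 / (N * W2 + 1) by rewrite -(ger0_norm (om0 y)) HJ.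
rewrite -ler_sqr ?nnegrE ?(ltW e0)// real_normK ?num_real//.
have -> : (M y * om y) ^+ 2 = M y ^+ 2 * om y * om y by ring.
apply: (@le_trans _ _ ((N * W2 + 1) * (e ^+ 2 / (N * W2 + 1)))).
  by apply: ler_pM => //; rewrite (le_trans h1)// lerDl.
by rewrite mulrCA divff ?mulr1// gt_eqF.
Qed.

(** The noise [c - w y] is the discrete derivative of [N * M], so that it can be
    integrated by parts against [q * F]; the product of two rough terms, [M] and
    the gradient of [q], is split by the inequality of arithmetic and geometric
    means. *)
Lemma noise_bound rho nu e : 0 < rho -> 0 < nu -> 0 < e -> exists J0 : nat,
  forall J, (J0 <= J)%N ->
  `|zsum J (fun y => N^-1 * (c - w y) * (q y * F y))| <=
  A * (rho * nu * Em / 2 + W2 / (2 * (rho * nu))) +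
  Qm * B * (nu * Om / 2 + W2 / (2 * nu)) + e.
Proof.
move=> rho0 nu0 e0; have rn0 : 0 < rho * nu by rewrite mulr_gt0.
have QA : 0 < Qm * A + 1 by rewrite ltr_wpDl// mulr_ge0.
have [J0 HJ] := noise_vanishing (divr_gt0 (divr_gt0 e0 (@ltr0n R 2)) QA).
exists J0 => J JJ.
have bd y : (J0 <= `|y|)%N -> `|q y * F y * M y| <= e / 2.
  move=> Jy; rewrite !normrM (ger0_norm (q0 y)).
  apply: (@le_trans _ _ ((Qm * A + 1) * (e / 2 / (Qm * A + 1)))).
    apply: (@le_trans _ _ ((Qm * A + 1) * `|M y * om y|)); last first.
      by rewrite ler_wpM2l ?(ltW QA)//; exact: HJ.
    rewrite normrM (ger0_norm (om0 y)).
    apply: (@le_trans _ _ (Qm * (A * om y) * `|M y|)).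
      by rewrite ler_wpM2r// ler_pM.
    have -> : Qm * (A * om y) * `|M y| = Qm * A * (`|M y| * om y) by ring.
    by rewrite ler_wpM2r ?mulr_ge0// lerDl.
  by rewrite mulrCA divff ?mulr1// gt_eqF.
rewrite (@eq_zsum _ _ _ (fun y => (q y * F y) * (M (y + 1) - M y))); last first.
  by move=> y; rewrite ME; ring.
rewrite (abel_zsum J (fun y => q y * F y) M).
have b1 := bd J%:Z JJ.
have b2 : `|q (- J%:Z) * F (- J%:Z) * M (- J%:Z)| <= e / 2.
  by apply: bd; rewrite abszN.
set Z := zsum J _.
suff ZB : `|Z| <= A * (rho * nu * Em / 2 + W2 / (2 * (rho * nu))) +
  Qm * B * (nu * Om / 2 + W2 / (2 * nu)).
  move: b1 b2 ZB; rewrite !ler_norml => /andP[? ?] /andP[? ?] /andP[? ?].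
  by apply/andP; split; lra.
pose g y := q (y + 1) - q y.
pose P1 y := A * (rho * nu / 2 * (N * g y ^+ 2) +
   (2 * (rho * nu))^-1 * (N^-1 * (M (y + 1) ^+ 2 * om (y + 1)))).
pose P2 y := Qm * B * (nu / 2 * (N^-1 * om (y + 1)) +
   (2 * nu)^-1 * (N^-1 * (M (y + 1) ^+ 2 * om (y + 1)))).
apply: (le_trans (ler_norm_zsum _ _)).
apply: (@le_trans _ _ (zsum J (fun y => P1 y + P2 y))).
  apply: le_zsum => y _ _; set m := M (y + 1); set o := om (y + 1).
  have o0 : 0 <= o by exact: om0.
  have o1 : o <= 1 by exact: om1.
  have -> : q (y + 1) * F (y + 1) - q y * F y =
    g y * F (y + 1) + q y * (F (y + 1) - F y) by rewrite /g; ring.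
  rewrite mulrDr; apply: (le_trans (ler_normD _ _)); apply: lerD.
    rewrite !normrM.
    apply: (@le_trans _ _ (A * (`|m| * `|g y| * o))).
      have -> : A * (`|m| * `|g y| * o) = `|m| * (`|g y| * (A * o)) by ring.
      by rewrite ler_wpM2l// ler_wpM2l//; exact: FA.
    rewrite /P1 ler_wpM2l// -/m -/o -(real_normK (num_real (g y))) -(real_normK (num_real m)).
    set u := `|m|; set v := `|g y|.
    have oo : o ^+ 2 <= o by rewrite expr2 ler_piMr.
    have k0 : 0 <= (2 * (rho * nu))^-1 * N^-1.
      by rewrite mulr_ge0// invr_ge0 ?mulr_ge0// ltW.
    have : (2 * (rho * nu))^-1 * N^-1 * (u ^+ 2 * o ^+ 2) <=
       (2 * (rho * nu))^-1 * N^-1 * (u ^+ 2 * o).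
      by rewrite ler_wpM2l// ler_wpM2l ?sqr_ge0.
    have : 0 <= (2 * (rho * nu) * N)^-1 * (rho * nu * N * v - u * o) ^+ 2.
      by rewrite mulr_ge0 ?sqr_ge0// invr_ge0 !mulr_ge0// ltW.
    have -> : (2 * (rho * nu) * N)^-1 * (rho * nu * N * v - u * o) ^+ 2 =
      rho * nu / 2 * (N * v ^+ 2) + (2 * (rho * nu))^-1 * N^-1 * (u ^+ 2 * o ^+ 2)
      - u * v * o by field; rewrite !gt_eqF.
    lra.
  rewrite normrM normrM (ger0_norm (q0 y)).
  apply: (@le_trans _ _ (Qm * B * (N^-1 * (`|m| * o)))).
    have -> : Qm * B * (N^-1 * (`|m| * o)) = `|m| * (Qm * (B / N * o)) by ring.
    by rewrite ler_wpM2l// ler_pM//; exact: FB.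
  rewrite /P2 ler_wpM2l ?mulr_ge0// -/m -/o -(real_normK (num_real m)).
  set u := `|m|.
  have : 0 <= N^-1 * (2 * nu)^-1 * o * (nu - u) ^+ 2.
    have hN : 0 <= N^-1 by rewrite invr_ge0 ltW.
    have hnu : 0 <= (2 * nu)^-1 by rewrite invr_ge0 mulr_ge0// ltW.
    by rewrite mulr_ge0 ?sqr_ge0// mulr_ge0// mulr_ge0.
  have -> : N^-1 * (2 * nu)^-1 * o * (nu - u) ^+ 2 =
    nu / 2 * (N^-1 * o) + (2 * nu)^-1 * (N^-1 * (u ^+ 2 * o)) - N^-1 * (u * o).
    by field; rewrite !gt_eqF.
  lra.
have sM : N^-1 * zsum J (fun y => M (y + 1) ^+ 2 * om (y + 1)) <= W2.
  apply: le_trans (MW J.+1); rewrite ler_wpM2l ?invr_ge0 ?(ltW N0)//.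
  exact: (zsum_shift J term0).
have sO : N^-1 * zsum J (fun y => om (y + 1)) <= Om.
  apply: le_trans (omO J.+1); rewrite ler_wpM2l ?invr_ge0 ?(ltW N0)//.
  exact: (zsum_shift J om0).
rewrite zsumD /P1 /P2 !zsumZ !zsumD !zsumZ; apply: lerD.
  rewrite ler_wpM2l//; apply: lerD.
    by rewrite mulrAC ler_wpM2r ?invr_ge0// ler_wpM2l ?(ltW rn0).
  by rewrite [leRHS]mulrC ler_wpM2l// invr_ge0 mulr_ge0// ltW.
rewrite ler_wpM2l ?mulr_ge0//; apply: lerD.
  by rewrite mulrAC ler_wpM2r ?invr_ge0// ler_wpM2l ?(ltW nu0).
by rewrite [leRHS]mulrC ler_wpM2l// invr_ge0 mulr_ge0// ltW.
Qed.

End noise.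

Section weight_sums.
Context {R : realType}.
Variable n : nat.
Hypothesis n0 : (0 < n)%N.
Local Notation N := (n%:R : R).
Local Notation pt := (@lattice_point R n).

Let N0 : 0 < N. Proof. by rewrite ltr0n. Qed.
Let N1 : 1 <= N. Proof. by rewrite ler1n. Qed.

(** A term at distance [k/n] is at most the increment of a telescoping series in
    [1 / (n + k)]. *)
Lemma cauchy_weight_sum J : N^-1 * zsum J (fun y => (1 + pt y ^+ 2)^-1) <= 8.
Proof.
have key (k : nat) (z : R) : k%:R / N <= `|z| ->
    N^-1 * (1 + z ^+ 2)^-1 <= 4 * N * ((N + k%:R)^-1 - (N + k.+1%:R)^-1).
  move=> kz; have k0 : 0 <= k%:R :> R by [].
  have Nk : 0 < N + k%:R by rewrite ltr_pwDl.
  have Nk1 : 0 < N + k.+1%:R by rewrite ltr_pwDl.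
  have -> : 4 * N * ((N + k%:R)^-1 - (N + k.+1%:R)^-1) =
     4 * N / ((N + k%:R) * (N + k.+1%:R)).
    by rewrite -natr1; field; rewrite !gt_eqF//; move: Nk1; rewrite -natr1 addrA.
  have kN : k%:R <= N * `|z| by rewrite mulrC -ler_pdivrMr.
  have z0 : 0 < 1 + z ^+ 2 by exact: weight_den_gt0.
  rewrite -invfM -[leLHS]mul1r ler_pdivrMr ?mulr_gt0// mulrAC ler_pdivlMr ?mulr_gt0//.
  rewrite mul1r -(real_normK (num_real z)).
  set u := `|z| in kN *; have u0 : 0 <= u by exact: normr_ge0.
  apply: (@le_trans _ _ ((N + N * u) * (2 * (N + N * u)))).
    apply: ler_pM; rewrite ?(ltW Nk) ?(ltW Nk1) ?lerD2l//.
    by rewrite -natr1; have := N1; lra.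
  have := sqr_ge0 (N * (1 - u)); nra.
have tele : zsum J (fun y => N^-1 * (1 + pt y ^+ 2)^-1) <=
    8 * N * (N^-1 - (N + J%:R)^-1).
  elim: J => [|J IH]; first by rewrite zsum0 addr0 subrr mulr0.
  rewrite zsumS.
  have h1 : J%:R / N <= `|pt (Posz J)|.
    by rewrite /lattice_point ger0_norm.
  have h2 : J%:R / N <= `|pt (Negz J)|.
    rewrite /lattice_point NegzE mulrNz mulNr normrN ger0_norm// ler_wpM2r ?invr_ge0 ?(ltW N0)//.
    by rewrite ler_nat.
  have := key _ _ h1; have := key _ _ h2; lra.
rewrite -zsumZ; apply: (le_trans tele).
have i0 : 0 <= (N + J%:R)^-1 by rewrite invr_ge0 addr_ge0// ltW.
rewrite mulrBr -mulrA divff ?gt_eqF// mulr1 gerBl mulr_ge0// mulr_ge0// ltW.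
Qed.

Lemma weight_le_cauchy (z : R) : weight z <= (1 + z ^+ 2)^-1.
Proof.
rewrite /weight lef_pV2 ?posrE ?exprn_gt0 ?weight_den_gt0//.
by rewrite expr2 ler_peMr ?weight_den_ge1// ltW// weight_den_gt0.
Qed.

Lemma weight_sum J : N^-1 * zsum J (fun y => weight (pt y)) <= 8.
Proof.
apply: le_trans (cauchy_weight_sum J); rewrite ler_wpM2l ?invr_ge0 ?(ltW N0)//.
by apply: le_zsum => y _ _; exact: weight_le_cauchy.
Qed.

Lemma weight_moment_sum J : N^-1 * zsum J (fun y => `|pt y| * weight (pt y)) <= 8.
Proof.
apply: le_trans (cauchy_weight_sum J); rewrite ler_wpM2l ?invr_ge0 ?(ltW N0)//.
apply: le_zsum => y _ _; set z := pt y.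
have z0 := weight_den_gt0 z.
rewrite /weight -[leRHS]mul1r -[(_ ^+ 2)^-1]exprVn expr2 mulrA ler_wpM2r ?invr_ge0 ?(ltW z0)//.
rewrite ler_pdivrMr// mul1r.
have := sqr_ge0 (`|z| - 1); rewrite -(real_normK (num_real z)).
by have := sqr_ge0 `|z|; lra.
Qed.

Lemma weight_vanishing : vanishing (fun y => weight (pt y)).
Proof.
have n0' := n0.
move=> e e0; pose J := Num.bound (N / e).
have JN : N / e < J%:R by apply: archi_boundP; rewrite divr_ge0// ltW.
exists J => y Jy; rewrite ger0_norm; last by rewrite ltW// weight_gt0.
apply: (le_trans (weight_le_cauchy _)).
have yJ : e^-1 <= `|pt y|.
  rewrite /lattice_point normrM [`|_^-1|]gtr0_norm ?invr_gt0// ler_pdivlMr// mulrC.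
  apply: (le_trans (ltW JN)); rewrite -intr_norm -[J%:R]/(J%:~R) ler_int.
  by lia.
rewrite -[leRHS]invrK lef_pV2 ?posrE ?invr_gt0 ?weight_den_gt0//.
apply: (le_trans yJ); have := sqr_ge0 (`|pt y| - 1).
rewrite -(real_normK (num_real (pt y))); have := sqr_ge0 `|pt y|; lra.
Qed.

End weight_sums.

(** * Gaussians transported by the chain *)

Section gaussian_on_lattice.
Context {R : realType}.
Variable n : nat.
Hypothesis n0 : (0 < n)%N.
Local Notation N := (n%:R : R).
Local Notation pt := (@lattice_point R n).
Implicit Types (x z K G : R) (y : int).

Let N0 : 0 < N. Proof. by rewrite ltr0n. Qed.
Let N1 : 1 <= N. Proof. by rewrite ler1n. Qed.

Lemma pointS y : pt (y + 1) = pt y + N^-1.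
Proof. by rewrite /lattice_point intrD mulrDl mul1r. Qed.

Lemma pointB y : pt (y - 1) = pt y - N^-1.
Proof. by rewrite /lattice_point intrB mulrBl mul1r. Qed.

(** The constant of [weight_shift] on the interval [-K-1, K+1]; the margin of 1
    accommodates a neighbouring lattice point. *)
Definition shift_cst K : R := 4 * (1 + (K + 1) ^+ 2) ^+ 2.

Lemma shift_cst_ge0 K : 0 <= shift_cst K.
Proof. by rewrite mulr_ge0// exprn_ge0// addr_ge0// sqr_ge0. Qed.

Lemma weighted_on_lattice (h h' : R -> R) K G x : `|x| <= K ->
  (forall z, is_derive z 1 h (h' z)) ->
  (forall z, `|h z| <= G * weight z) -> (forall z, `|h' z| <= G * weight z) ->
  (forall y, `|h (x - pt y)| <= shift_cst K * G * weight (pt y)) /\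
  (forall y, `|h (x - pt (y + 1)) - h (x - pt y)| <=
     shift_cst K * G / N * weight (pt (y + 1))).
Proof.
move=> xK hd hG h'G.
have G0 : 0 <= G.
  by have := le_trans (normr_ge0 _) (hG 0); rewrite pmulr_lge0// weight_gt0.
have xK1 : `|x| <= K + 1 by rewrite (le_trans xK)// lerDl.
split=> y.
  apply: (le_trans (hG _)); rewrite (mulrC (shift_cst K)) -mulrA ler_wpM2l//.
  exact: weight_shift.
rewrite mulrAC.
have -> : shift_cst K * G * weight (pt (y + 1)) / N =
   G * (shift_cst K * weight (pt (y + 1))) * (pt (y + 1) - pt y).
  by rewrite pointS addrAC subrr add0r; ring.
have yy : pt y <= pt (y + 1) by rewrite pointS lerDl invr_ge0 ltW.
have dd z : is_derive z 1 (fun z => h (x - z)) (- h' (x - z)).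
  have := dercomp (derB (derc z x) (deri z)) (hd (x - z)).
  by move/is_derive_eq; apply; ring.
apply: (@mean_value_le _ (fun z => h (x - z)) (fun z => - h' (x - z))) => //.
- move=> z z1 z2; rewrite normrN; apply: (le_trans (h'G _)); rewrite ler_wpM2l//.
  have -> : x - z = (x - z + pt (y + 1)) - pt (y + 1) by rewrite addrK.
  apply: weight_shift; rewrite -addrA (le_trans (ler_normD _ _))// lerD//.
  have Ni : N^-1 <= 1 by rewrite invf_le1.
  by move: z1 z2; rewrite pointS ler_norml => *; apply/andP; split; lra.
- by apply: derivable_within_continuous => z _; have [] := dd z.
Qed.

Variable c : R.
Hypothesis c0 : 0 < c.

(** The rescaled second difference is the second derivative up to [1/n], and the
    Gaussian solves the heat equation. *)
Lemma gauss_laplacian s T e z : 0 < T -> 0 < e -> e <= 1 -> e <= s -> s <= T ->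
  `|N ^+ 2 * (gauss c s (z + N^-1) + gauss c s (z - N^-1) - 2 * gauss c s z)
    - c * gauss_t c s z| <= 2 * (c * (gauss_bound c T / e ^+ 4)) / N.
Proof.
move=> T0 e0 e1 es sT; have s0 : 0 < s by exact: lt_le_trans es.
have sn : s != 0 by rewrite gt_eqF.
set B := c * (gauss_bound c T / e ^+ 4).
have fB u : `|c * gauss_tz c s u| <= B.
  rewrite normrM (gtr0_norm c0) ler_wpM2l ?(ltW c0)//.
  apply: (le_trans (gauss_tz_le c0 T0 e0 e1 u es sT)).
  by rewrite ler_piMr ?weight_le1// divr_ge0 ?gauss_bound_ge0// exprn_ge0// ltW.
have H := @second_difference R (gauss c s) (gauss_z c s) (fun u => c * gauss_t c s u)
  (fun u => c * gauss_tz c s u) z B (derive_gauss_z c s)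
  (fun u => derive_gauss_zz c u sn) (fun u => derZ c (derive_gauss_tz c u sn)) fB N^-1.
have -> : N ^+ 2 * (gauss c s (z + N^-1) + gauss c s (z - N^-1) - 2 * gauss c s z)
    - c * gauss_t c s z = N ^+ 2 * (gauss c s (z + N^-1) + gauss c s (z - N^-1)
    - 2 * gauss c s z - N^-1 ^+ 2 * (c * gauss_t c s z)).
  by field; rewrite gt_eqF.
rewrite normrM [`|N ^+ 2|]ger0_norm ?sqr_ge0//.
apply: (le_trans (ler_wpM2l (sqr_ge0 N) H)).
rewrite (@ger0_norm _ N^-1) ?invr_ge0 ?(ltW N0)//.
by rewrite le_eqVlt; apply/orP; left; apply/eqP; field; rewrite gt_eqF.
Qed.

End gaussian_on_lattice.

Section chain_smoothing.
Context {R : realType}.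
Variables (n : nat) (w : int -> R) (pn : R -> R -> R -> R).
Variable Q : R -> R -> probability (measurableTypeR R) R.
Hypothesis n0 : (0 < n)%N.
Hypothesis w1 : forall y, 1 <= w y.
Local Notation N := (n%:R : R).
Local Notation S := (@lattice R n).
Local Notation pt := (@lattice_point R n).
Local Notation onl := (@on_lattice R n).
Hypothesis QF : is_feller S Q.
Hypothesis QL : has_generator S Q (btm_generator n w).
Hypothesis Qp : is_transition_density S (lattice_measure n w) Q pn.
Implicit Types (F G : int -> R) (y z : int) (s t x r : R) (J : nat).

Variables (c theta K e x W2 nu : R) (M : int -> R).
Hypotheses (c0 : 0 < c) (theta0 : 0 < theta) (e0 : 0 < e) (e1 : e <= 1) (nu0 : 0 < nu).
Hypothesis xK : `|x| <= K.
Hypothesis ME : forall y, M (y + 1) - M y = N^-1 * (c - w y).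
Hypothesis MW : forall J, N^-1 * zsum J (fun y => M y ^+ 2 * weight (pt y)) <= W2.

Let t := theta ^+ 4.
Let T := t + 1.
Let N0 : 0 < N. Proof. by rewrite ltr0n. Qed.
Let N1 : 1 <= N. Proof. by rewrite ler1n. Qed.
Let Nn : N != 0. Proof. by rewrite gt_eqF. Qed.
Let w0 y : 0 < w y. Proof. exact: lt_le_trans ltr01 (w1 y). Qed.
Let mS := @lattice_measurable R n.
Let t0 : 0 < t. Proof. exact: exprn_gt0. Qed.
Let T0 : 0 < T. Proof. by rewrite addr_gt0. Qed.

Local Notation q := (density n pn).

Let q0 s y : 0 < s -> 0 <= q s y.
Proof. by move=> s0; exact: (density_ge0 Qp y s0). Qed.
Let q_mass s J : 0 < s -> zsum J (fun y => w y * q s y) <= N.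
Proof. by move=> s0; exact: (density_mass n0 w1 QF Qp J s0). Qed.
Let q_flow s y : 0 < s -> is_derive s 1 (q ^~ y) (flow N w q s y).
Proof. by move=> s0; exact: (density_derive n0 w1 QF QL Qp y s0). Qed.

Lemma sqrt_pow4 r : 0 < r -> Num.sqrt (r ^+ 4) = r ^+ 2.
Proof.
by move=> r0; rewrite (exprM r 2 2) sqrtr_sqr ger0_norm// sqr_ge0.
Qed.

(** Times are written as fourth powers: with [s = r^4] the decay bounds involve
    only integer powers of [r], and the singularity of order [s^(-3/4)] met below
    is cancelled by [ds = 4 r^3 dr]. *)
Lemma density_le r y : 0 < r -> q (r ^+ 4) y <= 3 / r ^+ 2.
Proof.
move=> r0; have r40 : 0 < r ^+ 4 by exact: exprn_gt0.
by rewrite -sqrt_pow4//; exact: (q_decay N1 w1 q0 q_mass q_flow).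
Qed.

Lemma density_dirichlet r J : 0 < r ->
  N * zsum J (fun y => (q (r ^+ 4) (y + 1) - q (r ^+ 4) y) ^+ 2) <= 4 / r ^+ 6.
Proof.
move=> r0; have r40 : 0 < r ^+ 4 by exact: exprn_gt0.
have := dirichlet_decay N1 w1 q0 q_mass q_flow J r40.
by rewrite sqrt_pow4// -exprD.
Qed.

Let Y := 4 * nu + W2 / (2 * nu).

Let W20 : 0 <= W2.
Proof. by apply: le_trans (MW 0%N); rewrite zsum0 mulr0. Qed.

(** The choice [rho = r^3] balances the Dirichlet energy, of order [r^(-6)],
    against the fluctuations; the resulting factor [r^(-3)] dominates the
    supremum of the density, of order [r^(-2)]. *)
Lemma noise_on_density F A r d : 0 <= A -> 0 < r -> r <= theta -> 0 < d ->
  (forall y, `|F y| <= A * weight (pt y)) ->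
  (forall y, `|F (y + 1) - F y| <= A / N * weight (pt (y + 1))) ->
  exists J0 : nat, forall J, (J0 <= J)%N ->
  `|zsum J (fun y => N^-1 * (c - w y) * (q (r ^+ 4) y * F y))| <=
   A / r ^+ 3 * (1 + 3 * theta) * Y + d.
Proof.
move=> A0 r0 rt d0 FA FB; have r40 : 0 < r ^+ 4 by exact: exprn_gt0.
have r30 : 0 < r ^+ 3 by exact: exprn_gt0.
have om0 y : 0 <= weight (pt y) by exact/ltW/weight_gt0.
have om1 y : weight (pt y) <= 1 by exact: weight_le1.
have [J0 HJ] := @noise_bound R N c w (q (r ^+ 4)) F M (fun y => weight (pt y))
  A A (3 / r ^+ 2) (4 / r ^+ 6) 8 W2 N1 ME om0 om1 (weight_vanishing n0) FA FB
  (fun y => q0 y r40) (fun y => density_le y r0) A0 A0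
  (fun J => density_dirichlet J r0) MW (weight_sum n0) (r ^+ 3) nu d r30 nu0 d0.
exists J0 => J JJ; apply: (le_trans (HJ J JJ)); rewrite lerD2r.
have -> : A * (r ^+ 3 * nu * (4 / r ^+ 6) / 2 + W2 / (2 * (r ^+ 3 * nu))) +
    3 / r ^+ 2 * A * (nu * 8 / 2 + W2 / (2 * nu)) =
    A / r ^+ 3 * (2 * nu + W2 / (2 * nu) + 3 * r * Y).
  by rewrite /Y; field; rewrite !gt_eqF.
rewrite -[leRHS]mulrA ler_wpM2l ?divr_ge0 ?(ltW r30)//.
have Y0 : 0 <= Y by rewrite addr_ge0 ?divr_ge0 ?mulr_ge0// ltW.
have -> : (1 + 3 * theta) * Y = Y + 3 * theta * Y by ring.
apply: lerD; last by rewrite ler_wpM2r// ler_wpM2l.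
by rewrite /Y; have := nu0; lra.
Qed.

Local Notation Gb := (gauss_bound c T / e ^+ 4).
Local Notation A := (shift_cst K * Gb).

Let Gb0 : 0 <= Gb.
Proof. by rewrite divr_ge0 ?gauss_bound_ge0// exprn_ge0// ltW. Qed.
Let A0 : 0 <= A. Proof. by rewrite mulr_ge0// shift_cst_ge0. Qed.

Let U s (y : R) : R := gauss c s (x - y).
Let dU s (y : R) : R := gauss_t c s (x - y).
Let V s : R -> R := onl (chain_generator n w (fun y => U s (pt y))).

Let bU s : 0 < s -> bounded_C0 S (U s). Proof. by move=> s0; exact: gauss_bounded_C0. Qed.
Let bdU s : 0 < s -> bounded_C0 S (dU s). Proof. by move=> s0; exact: gauss_t_bounded_C0. Qed.
Let vU s : 0 < s -> vanishing (fun y => U s (pt y)).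
Proof. by move=> s0; apply: (C0_vanishing n0); case: (bU s0). Qed.
Let vdU s : 0 < s -> vanishing (fun y => dU s (pt y)).
Proof. by move=> s0; apply: (C0_vanishing n0); case: (bdU s0). Qed.
Let bV s : 0 < s -> bounded_C0 S (V s).
Proof.
move=> s0; apply: (vanishing_bounded_C0 n0).
exact: (vanishing_generator n w1 (vU s0)).
Qed.
Let LUV s : 0 < s -> btm_generator n w (U s) (V s).
Proof. by move=> s0; apply: (btm_generator_on_lattice w n0 (f := U s) (F := fun y => U s (pt y))). Qed.
Let expU s (h : R) : 0 < s -> 0 < h -> exists2 d : R, 0 < d & forall k (y : R), `|k| < d -> S y ->
    `|U (s + k) y - U s y - k * dU s y| <= h * `|k|.
Proof.
move=> s0 h0; have [d d0 Hd] := gauss_time_expansion c0 x s0 h0.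
by exists d => // k y kd _; exact: Hd.
Qed.

Let X := 2 * (c * Gb) / N.

(** The defect of the Gaussian as a solution of the discrete heat equation is a
    discretisation error plus a noise term. *)
Lemma generator_defect r s : 0 < r -> r <= theta -> e <= s -> s <= T ->
  `|semigroup S Q (r ^+ 4) (fun y : R => V s y - dU s y) 0| <=
  X + A / r ^+ 3 * (1 + 3 * theta) * Y.
Proof.
move=> r0 rt es sT; have s0 : 0 < s by exact: lt_le_trans es.
have r40 : 0 < r ^+ 4 by exact: exprn_gt0.
have sn : s != 0 by rewrite gt_eqF.
pose u y := U s (pt y).
pose F y := chain_generator n w u y - dU s (pt y).
have vF : vanishing F.
  apply: vanishingD; first exact: (vanishing_generator n w1 (vU s0)).
  move=> h h0; have [J HJ] := vdU s0 h0.
  by exists J => y Jy; rewrite normrN; exact: HJ.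
rewrite (@semigroup_on_lattice_eq R n Q n0 (r ^+ 4) _ F); last first.
  by move=> y; rewrite /V on_latticeE.
apply/ler_addgt0Pl => d d0; have d20 : 0 < d / 2 by rewrite divr_gt0.
have [J1 HJ1] := semigroup_sum n0 QF r40 vF d20.
have [B1 B2] := weighted_on_lattice n0 xK (fun z : R => derive_gauss_tz c z sn)
  (fun z : R => gauss_t_le c0 T0 e0 e1 z es sT) (fun z : R => gauss_tz_le c0 T0 e0 e1 z es sT).
have [J2 HJ2] := noise_on_density A0 r0 rt d20 B1 B2.
have J1J : (J1 <= maxn J1 J2)%N by exact: leq_maxl.
have J2J : (J2 <= maxn J1 J2)%N by exact: leq_maxr.
have {}HJ1 := HJ1 _ J1J; have {}HJ2 := HJ2 _ J2J.
set J := maxn J1 J2 in HJ1 HJ2.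
pose L y := N ^+ 2 * (u (y + 1) + u (y - 1) - 2 * u y) - c * dU s (pt y).
have LB y : `|L y| <= X.
  have up : x - pt (y + 1) = x - pt y - N^-1 by rewrite pointS//; ring.
  have down : x - pt (y - 1) = x - pt y + N^-1 by rewrite pointB//; ring.
  rewrite /L /u /U up down (addrC (gauss c s (x - pt y - N^-1))).
  exact: (gauss_laplacian n0 c0 (x - pt y) T0 e0 e1 es sT).
have E : zsum J (fun y => F y * transition n Q (r ^+ 4) y) =
    zsum J (fun y => N^-1 * q (r ^+ 4) y * L y) +
    zsum J (fun y => N^-1 * (c - w y) * (q (r ^+ 4) y * dU s (pt y))).
  rewrite -zsumD; apply: eq_zsum => y.
  rewrite (transitionE n0 w1 Qp)// /F /chain_generator /L.
  by field; rewrite Nn gt_eqF.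
have LS : `|zsum J (fun y => N^-1 * q (r ^+ 4) y * L y)| <= X.
  apply: (le_trans (ler_norm_zsum _ _)).
  apply: (@le_trans _ _ (zsum J (fun y => X / N * q (r ^+ 4) y))).
    apply: le_zsum => y _ _; rewrite normrM.
    rewrite (@ger0_norm _ (N^-1 * _)) ?mulr_ge0 ?invr_ge0 ?(ltW N0) ?q0//.
    have -> : X / N * q (r ^+ 4) y = N^-1 * q (r ^+ 4) y * X by ring.
    by rewrite ler_wpM2l ?mulr_ge0 ?invr_ge0 ?(ltW N0) ?q0.
  have X0 : 0 <= X by exact: le_trans (LB 0).
  rewrite zsumZ -mulrA ler_piMr// mulrC ler_pdivrMr// mul1r.
  exact: (q_sum w1 q0 q_mass).
rewrite E in HJ1; move: HJ1 HJ2 LS; rewrite !ler_norml.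
by move=> /andP[? ?] /andP[? ?] /andP[? ?]; apply/andP; split; lra.
Qed.

(** The semigroup at time [s] acts on the Gaussian at time [t + e - s]: for
    [s = 0] this is the Gaussian at time [t + e], for [s = t] the average of the
    discrete kernel against a narrow Gaussian, and in between the derivative is
    the defect. *)
Lemma smoothing_dynamics :
  `|semigroup S Q t (U e) 0 - gauss c (t + e) x| <=
  (4 * theta ^+ 3 * X + 4 * A * (1 + 3 * theta) * Y) * theta.
Proof.
set Lam := 4 * theta ^+ 3 * X + _.
have S0 : S 0 by exact: origin_lattice.
have te0 : 0 < t + e by rewrite addr_gt0.
pose D s := semigroup S Q s (U (t + e - s)) 0.
pose Dr r := D (r ^+ 4).
pose dD s := semigroup S Q s (fun y : R => V (t + e - s) y - dU (t + e - s) y) 0.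
have DD s : 0 < s -> s < t + e -> is_derive s 1 D (dD s).
  by move=> s0 st; exact: (semigroup_derive mS QF QL S0 bU bV bdU LUV expU s0 st).
have pow4 r : is_derive r 1 (fun r => r ^+ 4) (4 * r ^+ 3).
  have := der_sqr (der_sqr (deri r)); under eq_fun do rewrite -exprM.
  by move/is_derive_eq; apply; ring.
have DDr r : 0 < r -> r <= theta -> is_derive r 1 Dr (dD (r ^+ 4) * (4 * r ^+ 3)).
  move=> r0 rt; apply: (dercomp (pow4 r)); apply: DD; first exact: exprn_gt0.
  have : r ^+ 4 <= t by apply: lerXn2r; rewrite ?nnegrE// ltW.
  by move=> /= h; apply: (le_lt_trans h); rewrite ltrDl.
have D0 : Dr 0 = gauss c (t + e) x.
  rewrite /Dr /D expr0n /= subr0 (semigroup0 mS QF)//; last exact: bU.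
  by rewrite /U subr0.
have Dt : Dr theta = semigroup S Q t (U e) 0.
  by rewrite /Dr /D -/t (_ : t + e - t = e)//; ring.
rewrite -Dt -D0 -[X in _ * X]subr0.
apply: (@mean_value_le _ Dr (fun r => dD (r ^+ 4) * (4 * r ^+ 3))); first exact: ltW.
- by move=> r r0 rt; apply: DDr => //; exact: ltW.
- move=> r r0 rt; have r4t : r ^+ 4 <= t by apply: lerXn2r; rewrite ?nnegrE// ltW.
  have r30 : 0 < r ^+ 3 by exact: exprn_gt0.
  have r40 : 0 < r ^+ 4 by exact: exprn_gt0.
  have h1 : e <= t + e - r ^+ 4 by lra.
  have h2 : t + e - r ^+ 4 <= T by rewrite /T; have := e1; lra.
  have H := generator_defect r0 (ltW rt) h1 h2.
  have k0 : 0 <= 4 * r ^+ 3 by rewrite mulr_ge0// ltW.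
  rewrite normrM (ger0_norm k0).
  apply: (le_trans (ler_wpM2r k0 H)).
  have -> (a b b' : R) : (b + a / r ^+ 3 * (1 + 3 * theta) * b') * (4 * r ^+ 3) =
      4 * r ^+ 3 * b + 4 * a * (1 + 3 * theta) * b' by field; rewrite gt_eqF.
  rewrite /Lam lerD2r ler_wpM2r//.
    by rewrite /X divr_ge0// mulr_ge0// mulr_ge0// ltW.
  by rewrite ler_wpM2l//; apply: lerXn2r; rewrite ?nnegrE// ltW.
- apply: (@derivable_continuous_itv _ Dr (fun r => dD (r ^+ 4) * (4 * r ^+ 3)) 0 theta theta0) => //.
  move=> h h0; rewrite D0.
  have [d d0 Hd] := semigroup_right_continuous mS QF S0 bU bdU expU te0 h0.
  have m0 : 0 < Num.min 1 d by rewrite lt_min ltr01.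
  exists (Num.min 1 d) => // s s0; rewrite add0r lt_min => /andP[s1 sd].
  rewrite /Dr /D.
  have -> : gauss c (t + e) x = U (t + e) 0 by rewrite /U subr0.
  apply: Hd; first by rewrite exprn_ge0.
  have s4 : s ^+ 3 <= 1 by apply: exprn_ile1 => //; exact: ltW.
  by apply: le_lt_trans sd; rewrite exprSr ler_piMl.
Qed.

(** The speed measure is replaced by its mean, at the cost of one more noise
    term. *)
Lemma chain_smoothing d : 0 < d -> exists J0 : nat, forall J, (J0 <= J)%N ->
  `|gauss c (t + e) x - zsum J (fun y => c / N * (q t y * gauss c e (x - pt y)))| <=
  (4 * theta ^+ 3 * X + 4 * A * (1 + 3 * theta) * Y) * theta +
  A / theta ^+ 3 * (1 + 3 * theta) * Y + d.
Proof.
move=> d0; have d20 : 0 < d / 2 by rewrite divr_gt0.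
have eT : e <= T by rewrite /T; have := t0; have := e1; lra.
have [J1 HJ1] := semigroup_sum n0 QF t0 (vU e0) d20.
have [B1 B2] := weighted_on_lattice n0 xK (fun z : R => derive_gauss_z c e z)
  (fun z : R => gauss_le c0 T0 e0 e1 z (lexx e) eT)
  (fun z : R => gauss_z_le c0 T0 e0 e1 z (lexx e) eT).
have [J2 HJ2] := noise_on_density A0 theta0 (lexx theta) d20 B1 B2.
exists (maxn J1 J2) => J; rewrite geq_max => /andP[J1J J2J].
have {}HJ1 := HJ1 _ J1J; have {}HJ2 := HJ2 _ J2J; rewrite -/t in HJ2.
have H := smoothing_dynamics.
rewrite (@semigroup_on_lattice_eq R n Q n0 t _ (fun y => U e (pt y))) in H; last by [].
have E : zsum J (fun y => U e (pt y) * transition n Q t y) =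
    zsum J (fun y => c / N * (q t y * gauss c e (x - pt y))) -
    zsum J (fun y => N^-1 * (c - w y) * (q t y * gauss c e (x - pt y))).
  rewrite -zsumB; apply: eq_zsum => y.
  by rewrite (transitionE n0 w1 Qp)// /U; field.
rewrite E in HJ1; move: HJ1 HJ2 H; rewrite !ler_norml.
by move=> /andP[? ?] /andP[? ?] /andP[? ?]; apply/andP; split; lra.
Qed.

End chain_smoothing.

(** * From smoothed values to point values *)

Section interval_sums.
Context {R : realType}.
Local Notation leb := (@lebesgue_measure R).
Variable f : R -> R.
Hypothesis intf : leb.-integrable setT (EFin \o f).
Implicit Types a b c : R.

Definition itv_integral a b : R := \int[leb]_(z in `[a, b[) f z.

Let intf_itv a b : leb.-integrable `[a, b[ (EFin \o f).
Proof. by apply: integrableS intf. Qed.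

Lemma itv_integral_cat a b c : a <= b -> b <= c ->
  itv_integral a c = itv_integral a b + itv_integral b c.
Proof.
move=> ab bc; rewrite /itv_integral.
have E : `[a, c[%classic = (`[a, b[ `|` `[b, c[)%classic :> set R.
  by apply: itv_bndbnd_setU; rewrite bnd_simp.
rewrite E Rintegral_setU//; first by rewrite -E; exact: intf_itv.
apply/disj_setPS => z [] /=; rewrite !in_itv /= => /andP[_ zb] /andP[bz _].
by move: zb; rewrite ltNge bz.
Qed.

Variable n : nat.
Hypothesis n0 : (0 < n)%N.
Local Notation pt := (@lattice_point R n).

Lemma cells_sum J : zsum J (fun y => itv_integral (pt y) (pt (y + 1))) =
  itv_integral (pt (- J%:Z)) (pt J%:Z).
Proof.
have mono (y z : int) : y <= z -> pt y <= pt z.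
  by move=> yz; rewrite /lattice_point ler_wpM2r ?invr_ge0// ler_int.
elim: J => [|J IH].
  rewrite zsum0 oppr0 /itv_integral.
  by rewrite set_itv_ge ?Rintegral_set0// bnd_simp ltxx.
rewrite zsumS IH.
have -> : Negz J + 1 = - J%:Z by lia.
have -> : J%:Z + 1 = J.+1%:Z by lia.
have -> : - J.+1%:Z = Negz J by lia.
rewrite (@itv_integral_cat (pt (Negz J)) (pt (- J%:Z)) (pt J.+1%:Z)); first last.
- by apply: mono; lia.
- by apply: mono; lia.
rewrite (@itv_integral_cat (pt (- J%:Z)) (pt J%:Z) (pt J.+1%:Z)); first last.
- by apply: mono; lia.
- by apply: mono; lia.
by rewrite addrA addrC.
Qed.

End interval_sums.

Section point_smoothing.
Context {R : realType}.
Variables (n : nat) (c kap x Qm Em Gz : R) (q : int -> R).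
Hypotheses (n0 : (0 < n)%N) (c0 : 0 < c) (kap0 : 0 < kap).
Local Notation N := (n%:R : R).
Local Notation pt := (@lattice_point R n).
Local Notation leb := (@lebesgue_measure R).
Hypothesis q0 : forall y, 0 <= q y.
Hypothesis qQ : forall y, q y <= Qm.
Hypothesis q_sum1 : forall J, zsum J q <= N.
Hypothesis qE : forall J, N * zsum J (fun y => (q (y + 1) - q y) ^+ 2) <= Em.
Hypothesis GzB : forall z, `|gauss_z c (kap ^+ 4) z| <= Gz.
Implicit Types (y u v : int) (J : nat) (z r d : R).

Let N0 : 0 < N. Proof. by rewrite ltr0n. Qed.
Let Nn : N != 0. Proof. by rewrite gt_eqF. Qed.

(** The Dirichlet energy controls the modulus of continuity of order 1/2; the
    Cauchy-Schwarz inequality appears in its additive form. *)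
Lemma holder_le u v : u <= v ->
  `|q v - q u| <= kap * Em / 2 + (pt v - pt u) / (2 * kap).
Proof.
move=> uv.
pose P (y : int) := Num.max (Num.min y v) u.
pose J := (`|u| + `|v|).+1.
have T1 := telescope_zsum J (fun y => q (P y)).
have T2 := telescope_zsum J (fun y => (P y)%:~R : R).
have P1 : P J%:Z = v by rewrite /P; lia.
have P2 : P (- J%:Z) = u by rewrite /P; lia.
rewrite P1 P2 in T1 T2; rewrite -T1.
apply: (le_trans (ler_norm_zsum _ _)).
apply: (@le_trans _ _ (zsum J (fun y => kap / 2 * (N * (q (y + 1) - q y) ^+ 2) +
    (2 * kap * N)^-1 * ((P (y + 1))%:~R - (P y)%:~R)))).
  apply: le_zsum => y _ _; set g := q (y + 1) - q y.
  have kN : 0 <= kap / 2 * (N * g ^+ 2).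
    by rewrite mulr_ge0 ?divr_ge0 ?(ltW kap0)// mulr_ge0 ?sqr_ge0// ltW.
  have [yu|uy] := ltP y u.
    have -> : P (y + 1) = P y by rewrite /P; lia.
    by rewrite !subrr normr0 mulr0 addr0.
  have [vy|yv] := leP v y.
    have -> : P (y + 1) = P y by rewrite /P; lia.
    by rewrite !subrr normr0 mulr0 addr0.
  have -> : P (y + 1) = y + 1 by rewrite /P; lia.
  have -> : P y = y by rewrite /P; lia.
  rewrite -/g intrD addrAC subrr add0r mulr1.
  have : 0 <= (2 * kap * N)^-1 * (kap * N * `|g| - 1) ^+ 2.
    by rewrite mulr_ge0 ?sqr_ge0// invr_ge0 mulr_ge0// mulr_ge0// ltW.
  rewrite -(real_normK (num_real g)); set a := `|g|.
  have -> : (2 * kap * N)^-1 * (kap * N * a - 1) ^+ 2 =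
    kap / 2 * (N * a ^+ 2) + (2 * kap * N)^-1 - a by field; rewrite !gt_eqF.
  lra.
rewrite zsumD !zsumZ T2; apply: lerD.
  by rewrite [leRHS]mulrAC ler_wpM2l ?divr_ge0 ?(ltW kap0).
by rewrite /lattice_point le_eqVlt; apply/orP; left; apply/eqP; field; rewrite !gt_eqF.
Qed.

Lemma holder_dist u v : `|q v - q u| <= kap * Em / 2 + `|pt v - pt u| / (2 * kap).
Proof.
wlog uv : u v / u <= v => [H|].
  have [uv|/ltW vu] := leP u v; first exact: H.
  by rewrite distrC (distrC (pt v)); exact: H.
apply: (le_trans (holder_le uv)); rewrite lerD2l ler_wpM2r ?ler_norm//.
by rewrite invr_ge0 mulr_ge0// ltW.
Qed.

Local Notation e := (kap ^+ 4).
Let e0 : 0 < e. Proof. exact: exprn_gt0. Qed.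
Let e20 : 0 < 2 * e. Proof. by rewrite mulr_gt0. Qed.

Let phi z := c * gauss c e (x - z).
Let psi z := c * gauss c (2 * e) (x - z).

Let phi0 z : 0 <= phi z. Proof. by rewrite mulr_ge0 ?gauss_ge0// ltW. Qed.
Let psi0 z : 0 <= psi z. Proof. by rewrite mulr_ge0 ?gauss_ge0// ltW. Qed.

Let gauss_integrable s : 0 < s ->
  leb.-integrable setT (EFin \o (fun z => c * gauss c s (x - z))).
Proof.
move=> s0; rewrite (_ : (fun z => _) = normal_pdf x (Num.sqrt (2 * s / c))).
  exact: integrable_normal_pdf.
by apply/funext => z; exact: gauss_normal_pdf.
Qed.

Let int_phi : leb.-integrable setT (EFin \o phi). Proof. exact: gauss_integrable. Qed.
Let int_psi : leb.-integrable setT (EFin \o psi). Proof. exact: gauss_integrable. Qed.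

Let itv_le1 s a b : 0 < s ->
  itv_integral (fun z => c * gauss c s (x - z)) a b <= 1.
Proof.
move=> s0; rewrite /itv_integral /Rintegral -lee_fin fineK; last first.
  by apply: integrable_fin_num => //; apply: integrableS (gauss_integrable s0).
rewrite -(integral_gauss c0 x s0); apply: ge0_subset_integral => //.
  by apply/measurable_EFinP; apply: measurable_funM => //; exact: measurable_gauss.
by move=> z _; rewrite lee_fin mulr_ge0 ?gauss_ge0// ltW.
Qed.

Let window_mass d : 0 < d -> exists J0 : nat, forall J, (J0 <= J)%N ->
  1 - d <= itv_integral phi (pt (- J%:Z)) (pt J%:Z).
Proof.
move=> d0; pose r := Num.max 1 (16 * e / (c * d)).
have r1 : 1 <= r by rewrite le_max lexx.
have r0 : 0 < r by exact: lt_le_trans r1.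
have rr : 16 * e / c / r ^+ 2 <= d.
  rewrite ler_pdivrMr ?exprn_gt0//.
  have h1 : 16 * e / (c * d) <= r by rewrite le_max lexx orbT.
  have h2 : 16 * e / c <= d * r.
    move: h1; rewrite invfM mulrA ler_pdivrMr// => h; by rewrite (mulrC d).
  apply: (le_trans h2); rewrite ler_wpM2l ?(ltW d0)//.
  by rewrite expr2 ler_peMl// ltW.
pose J0 := Num.bound (N * (`|x| + r)).
have JB : N * (`|x| + r) < J0%:R.
  by apply: archi_boundP; rewrite mulr_ge0 ?addr_ge0 ?(ltW r0)// ltW.
exists J0 => J JJ.
have Jx : `|x| + r <= J%:R / N.
  rewrite ler_pdivlMr// mulrC (le_trans (ltW JB))// ler_nat//.
have mI : measurable (`[pt (- J%:Z), pt J%:Z[%classic : set R) by [].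
have mIC : measurable (~` `[pt (- J%:Z), pt J%:Z[%classic : set R) by exact: measurableC.
have mphi : measurable_fun (setT : set R) (EFin \o phi).
  by apply/measurable_EFinP; apply: measurable_funM => //; exact: measurable_gauss.
have pe z : (0 <= (phi z)%:E)%E by rewrite lee_fin.
have disjI : [disjoint (`[pt (- J%:Z), pt J%:Z[%classic : set R) &
    ~` (`[pt (- J%:Z), pt J%:Z[%classic : set R)] by apply/disj_setPS; rewrite setICr.
have tot : (\int[leb]_(z in `[pt (- J%:Z), pt J%:Z[) (phi z)%:E +
    \int[leb]_(z in ~` `[pt (- J%:Z), pt J%:Z[%classic) (phi z)%:E = 1)%E.
  by rewrite -ge0_integral_setU ?setUv//; exact: integral_gauss.
have far : (\int[leb]_(z in ~` `[pt (- J%:Z), pt J%:Z[%classic) (phi z)%:E <= d%:E)%E.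
  apply: (@le_trans _ _ (16 * e / c / r ^+ 2)%:E); last by rewrite lee_fin.
  apply: le_trans (integral_gauss_far c0 x e0 r0).
  apply: ge0_subset_integral => //.
  - rewrite -[X in measurable X]setTI; apply: measurable_fun_le => //.
    by apply: measurableT_comp => //; exact: measurable_funB.
  - exact: measurable_funTS.
  move=> z /=; rewrite in_itv /= /lattice_point => /negP; rewrite negb_and -leNgt -ltNge.
  rewrite mulrNz mulNr -[J%:~R]/(J%:R) => /orP[zJ|Jz].
    have h := ler_norm (x - z); have := ler_norm (- x); rewrite normrN; move: Jx zJ h; lra.
  have h := ler_norm (z - x); rewrite distrC in h; have := ler_norm x; move: Jx Jz h; lra.
rewrite /itv_integral /Rintegral.
have fI : (\int[leb]_(z in `[pt (- J%:Z), pt J%:Z[) (phi z)%:E)%E \is a fin_num.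
  by apply: integrable_fin_num => //; apply: integrableS int_phi.
rewrite -lee_fin fineK// EFinB -tot leeBlDr//.
by rewrite leeD2l.
Qed.

Let xn := Num.floor (N * x).

Lemma floor_point_dist : `|x - pt xn| <= N^-1.
Proof.
have /andP[h1 h2] := floor_itv (N * x).
have e1 : x - pt xn = (N * x - xn%:~R) / N by rewrite /lattice_point; field.
rewrite e1 normrM [`|_^-1|]gtr0_norm ?invr_gt0// ler_piMl ?invr_ge0 ?(ltW N0)//.
rewrite intrD in h2.
by rewrite ler_norml; apply/andP; split; rewrite /xn; lra.
Qed.

Let near_cst := kap * Em / 2 + kap / 4 + (N * kap)^-1.

Let Em0 : 0 <= Em. Proof. by apply: le_trans (qE 0%N); rewrite zsum0 mulr0. Qed.

(** Within a cell, the modulus of continuity is of order [kap] plus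
    [(x - z)^2 / kap^3]; the second part is integrable against a Gaussian of
    variance of order [kap^4], up to doubling the variance. *)
Let cell_le y :
  `|(q y - q xn) * itv_integral phi (pt y) (pt (y + 1))| <=
  near_cst * itv_integral phi (pt y) (pt (y + 1)) +
  4 * kap / c * itv_integral psi (pt y) (pt (y + 1)).
Proof.
have I0 : 0 <= itv_integral phi (pt y) (pt (y + 1)) by apply: Rintegral_ge0.
have mI : measurable (`[pt y, pt (y + 1)[%classic : set (measurableTypeR R)) by [].
rewrite normrM (ger0_norm I0) /itv_integral.
have i1 : leb.-integrable `[pt y, pt (y + 1)[ (EFin \o phi) by apply: integrableS int_phi.
have i2 : leb.-integrable `[pt y, pt (y + 1)[ (EFin \o psi) by apply: integrableS int_psi.
have iZ a (f : R -> R) : leb.-integrable `[pt y, pt (y + 1)[ (EFin \o f) ->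
    leb.-integrable `[pt y, pt (y + 1)[ (EFin \o (fun z => a * f z)).
  move=> fi; have := integrableZl mI a fi.
  by apply: eq_integrable => // z _.
rewrite -!RintegralZl// -RintegralD//; [|exact: iZ..].
apply: le_Rintegral => //; first exact: iZ.
  have := integrableD mI (iZ near_cst _ i1) (iZ (4 * kap / c) _ i2).
  by apply: eq_integrable => // z _.
move=> z /=; rewrite in_itv /= pointS// => /andP[yz zy].
have h1 : `|pt y - z| <= N^-1 by rewrite ler_norml; apply/andP; split; lra.
have h2 : `|pt y - pt xn| <= `|x - z| + 2 * N^-1.
  have -> : pt y - pt xn = (pt y - z) - (x - z) + (x - pt xn) by ring.
  rewrite (le_trans (ler_normD _ _))//.
  have := ler_normB (pt y - z) (x - z); have := floor_point_dist; lra.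
have k3 : 0 < kap ^+ 3 by exact: exprn_gt0.
have h3 : `|q y - q xn| <= near_cst + (x - z) ^+ 2 / (4 * kap ^+ 3).
  apply: (le_trans (holder_dist _ _)).
  have h4 : `|pt y - pt xn| / (2 * kap) <= (`|x - z| + 2 * N^-1) / (2 * kap).
    by rewrite ler_wpM2r// invr_ge0 mulr_ge0// ltW.
  have h5 : 0 <= (4 * kap ^+ 3)^-1 * (kap ^+ 2 - `|x - z|) ^+ 2.
    by rewrite mulr_ge0 ?sqr_ge0// invr_ge0 mulr_ge0// ltW.
  have h6 : (4 * kap ^+ 3)^-1 * (kap ^+ 2 - `|x - z|) ^+ 2 =
    kap / 4 + (x - z) ^+ 2 / (4 * kap ^+ 3) - `|x - z| / (2 * kap).
    by rewrite -(real_normK (num_real (x - z))); field; rewrite gt_eqF.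
  have h7 : (`|x - z| + 2 * N^-1) / (2 * kap) = `|x - z| / (2 * kap) + (N * kap)^-1.
    by field; rewrite !gt_eqF.
  by rewrite /near_cst; lra.
have h8 : (x - z) ^+ 2 / (4 * kap ^+ 3) * phi z <= 4 * kap / c * psi z.
  have m := gauss_moment c0 (x - z) e0.
  have -> : (x - z) ^+ 2 / (4 * kap ^+ 3) * phi z =
    c / (4 * kap ^+ 3) * ((x - z) ^+ 2 * gauss c e (x - z)) by rewrite /phi; ring.
  have k0 : 0 <= c / (4 * kap ^+ 3) by rewrite divr_ge0 ?mulr_ge0// ltW.
  apply: (le_trans (ler_wpM2l k0 m)); rewrite /psi.
  by rewrite le_eqVlt; apply/orP; left; apply/eqP; field; rewrite !gt_eqF.
by have := ler_wpM2r (phi0 z) h3; rewrite mulrDl; lra.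
Qed.

Let cell_riemann y :
  `|c / N * gauss c e (x - pt y) - itv_integral phi (pt y) (pt (y + 1))| <= c * Gz / N ^+ 2.
Proof.
have mI : measurable (`[pt y, pt (y + 1)[%classic : set (measurableTypeR R)) by [].
have yy : pt y <= pt (y + 1) by rewrite pointS// lerDl invr_ge0 ltW.
have lebI : leb `[pt y, pt (y + 1)[%classic = (N^-1)%:E.
  rewrite lebesgue_measure_itv /= lte_fin pointS// ltrDl invr_gt0 N0.
  by rewrite -EFinB addrAC subrr add0r.
have cstI k : \int[leb]_(z in `[pt y, pt (y + 1)[) k = k / N.
  by rewrite Rintegral_cst//; have := congr1 fine lebI => /= ->.
have icst k : leb.-integrable `[pt y, pt (y + 1)[ (EFin \o cst k).
  apply/integrableP; split; first exact/measurable_EFinP.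
  rewrite /= integral_cst//.
  apply: (@le_lt_trans _ _ (`|k|%:E * (N^-1)%:E)%E); last by rewrite -EFinM ltry.
  by rewrite lee_wpmul2l ?lee_fin// -lebI lexx.
have i1 : leb.-integrable `[pt y, pt (y + 1)[ (EFin \o phi) by apply: integrableS int_phi.
have -> : c / N * gauss c e (x - pt y) =
    \int[leb]_(z in `[pt y, pt (y + 1)[) (cst (c * gauss c e (x - pt y)) z).
  by rewrite cstI; ring.
have -> : c * Gz / N ^+ 2 = \int[leb]_(z in `[pt y, pt (y + 1)[) (cst (c * Gz / N) z).
  by rewrite cstI; field.
rewrite /itv_integral -RintegralB//.
have iB : leb.-integrable `[pt y, pt (y + 1)[
    (EFin \o (fun z => cst (c * gauss c e (x - pt y)) z - phi z)).
  have := integrableB mI (icst (c * gauss c e (x - pt y))) i1.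
  by apply: eq_integrable => // z _.
apply: (le_trans (le_normr_Rintegral mI iB)).
apply: le_Rintegral => //.
  have := integrable_norm iB.
  by apply: eq_integrable => // z _.
move=> z /=; rewrite in_itv /= pointS// => /andP[yz zy].
rewrite /phi -mulrBr normrM (gtr0_norm c0) -!mulrA ler_wpM2l ?(ltW c0)//.
have := @mean_value_le _ (gauss c e) (gauss_z c e) (x - z) (x - pt y) Gz.
have -> : x - pt y - (x - z) = z - pt y by ring.
move=> H; apply: (le_trans (H _ _ _ _)).
- lra.
- by move=> u _ _; exact: derive_gauss_z.
- by move=> u _ _; exact: GzB.
- by apply: derivable_within_continuous => u _; have [] := derive_gauss_z c e u.
have Gz0 : 0 <= Gz by exact: le_trans (GzB 0).
by rewrite ler_wpM2l//; lra.
Qed.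

(** Three replacements: the Riemann sum by the integral over the cells, the value
    [q y] by the value at [x], and the mass of the window by 1. *)
Lemma smoothing_at_point d : 0 < d -> exists J0 : nat, forall J, (J0 <= J)%N ->
  `|zsum J (fun y => c / N * (q y * gauss c e (x - pt y))) - q xn| <=
  kap * (Em / 2 + 1 / 4 + 4 / c) + (N * kap)^-1 + c * Gz / N + d.
Proof.
move=> d0.
have Q1 : 0 < Qm + 1 by rewrite ltr_wpDl// (le_trans (q0 0)).
have [J0 HJ] := window_mass (divr_gt0 d0 Q1).
exists J0 => J JJ; have {}HJ := HJ J JJ.
have Gz0 : 0 <= Gz by exact: le_trans (GzB 0).
pose nu y := itv_integral phi (pt y) (pt (y + 1)).
pose r y := c / N * gauss c e (x - pt y) - nu y.
have E : zsum J (fun y => c / N * (q y * gauss c e (x - pt y))) - q xn =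
   zsum J (fun y => q y * r y) + zsum J (fun y => (q y - q xn) * nu y)
   - q xn * (1 - zsum J nu).
  rewrite mulrBr mulr1 -zsumZ opprB addrA -!zsumD; congr (_ - _).
  by apply: eq_zsum => y; rewrite /r; ring.
have B1 : `|zsum J (fun y => q y * r y)| <= c * Gz / N.
  apply: (le_trans (ler_norm_zsum _ _)).
  apply: (@le_trans _ _ (zsum J (fun y => c * Gz / N ^+ 2 * q y))).
    apply: le_zsum => y _ _; rewrite normrM (ger0_norm (q0 y)) mulrC.
    by rewrite ler_wpM2r//; exact: cell_riemann.
  rewrite zsumZ.
  have k0 : 0 <= c * Gz / N ^+ 2 by rewrite divr_ge0 ?sqr_ge0// mulr_ge0// ltW.
  apply: (le_trans (ler_wpM2l k0 (q_sum1 J))).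
  by rewrite le_eqVlt; apply/orP; left; apply/eqP; field.
have nc0 : 0 <= near_cst.
  by rewrite /near_cst !addr_ge0// ?divr_ge0 ?mulr_ge0 ?invr_ge0 ?mulr_ge0// ltW.
have B2 : `|zsum J (fun y => (q y - q xn) * nu y)| <= near_cst + 4 * kap / c.
  apply: (le_trans (ler_norm_zsum _ _)).
  apply: (le_trans (le_zsum (fun y _ _ => cell_le y))).
  rewrite zsumD !zsumZ (cells_sum int_phi n0) (cells_sum int_psi n0).
  apply: lerD; rewrite ler_piMr//; [exact: itv_le1| |exact: itv_le1].
  by rewrite divr_ge0 ?mulr_ge0// ltW.
have M1 : zsum J nu <= 1 by rewrite /nu (cells_sum int_phi n0); exact: itv_le1.
have M2 : 1 - d / (Qm + 1) <= zsum J nu by rewrite /nu (cells_sum int_phi n0).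
have B3 : `|q xn * (1 - zsum J nu)| <= d.
  rewrite normrM (ger0_norm (q0 _)) ger0_norm ?subr_ge0//.
  apply: (@le_trans _ _ ((Qm + 1) * (d / (Qm + 1)))).
    apply: ler_pM => //; rewrite ?subr_ge0//; first by rewrite (le_trans (qQ _))// lerDl.
    by lra.
  by rewrite mulrCA divff ?mulr1// gt_eqF.
rewrite E; move: B1 B2 B3; rewrite /near_cst !ler_norml.
move=> /andP[? ?] /andP[? ?] /andP[? ?]; apply/andP; split; lra.
Qed.

End point_smoothing.

(** * The deterministic error bound *)

Section deterministic_bound.
Context {R : realType}.
Variables (c t K : R).
Hypotheses (c0 : 0 < c) (t0 : 0 < t).
Implicit Types (x kap : R) (n : nat).

(** The error splits as the smoothing of the limit kernel, the smoothed
    comparison, and the smoothing of the discrete kernel. With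
    [kap = n^(-1/42)] and Gaussians of variance of order [kap^4], all terms are
    at most of order [kap], except for the noise. *)
Lemma pointwise_error : exists2 C, 0 < C &
  forall n (w : int -> R) pn (M : int -> R) kap W2 x, (0 < n)%N ->
  (forall y, 1 <= w y) -> is_btm_heat_kernel n w pn ->
  0 < kap -> kap <= 1 -> kap ^+ 42 = n%:R^-1 ->
  (forall y, M (y + 1) - M y = n%:R^-1 * (c - w y)) ->
  (forall J, n%:R^-1 * zsum J (fun y => M y ^+ 2 * weight (lattice_point n y)) <= W2) ->
  `|x| <= K ->
  `|gauss c t x - pn t 0 (lattice_point n (Num.floor (n%:R * x)))| <=
    C * (kap + kap ^- 37 * W2).
Proof.
pose theta := Num.sqrt (Num.sqrt t).
have th0 : 0 < theta by rewrite !sqrtr_gt0.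
have tE : t = theta ^+ 4.
  by rewrite (exprM theta 2 2) !sqr_sqrtr ?sqrtr_ge0// ltW.
pose T := t + 1; have T0 : 0 < T by rewrite addr_gt0.
pose e1 := Num.min 1 t.
have e10 : 0 < e1 by rewrite lt_min ltr01.
have e11 : e1 <= 1 by rewrite ge_min lexx.
have e1t : e1 <= t by rewrite ge_min lexx orbT.
pose C1 := gauss_bound c T / e1 ^+ 4.
pose GB := gauss_bound c T.
have GB0 : 0 <= GB by exact: gauss_bound_ge0.
have C10 : 0 <= C1 by rewrite divr_ge0// exprn_ge0// ltW.
pose Sc := shift_cst K.
have Sc0 : 0 <= Sc by exact: shift_cst_ge0.
pose C2 := 8 * theta ^+ 4 * c * GB.
pose C3 := Sc * GB * (1 + 3 * theta) * (4 * theta + theta ^- 3).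
have C20 : 0 <= C2.
  by rewrite /C2 mulr_ge0// mulr_ge0 ?(ltW c0)// mulr_ge0// exprn_ge0// ltW.
have C30 : 0 <= C3.
  have h1 : 0 <= 1 + 3 * theta by rewrite addr_ge0// mulr_ge0// ltW.
  have h2 : 0 <= 4 * theta + theta ^- 3.
    by rewrite addr_ge0 ?mulr_ge0 ?invr_ge0 ?exprn_ge0 ?(ltW th0).
  by rewrite /C3 mulr_ge0// mulr_ge0// mulr_ge0.
pose C4 := 4 / theta ^+ 6 / 2 + 1 / 4 + 4 / c.
have C40 : 0 <= C4.
  by rewrite /C4 !addr_ge0// !divr_ge0 ?exprn_ge0// ltW.
pose C := 1 + C1 + C2 + 4 * C3 + C4 + 1 + c * GB.
have cGB0 : 0 <= c * GB by rewrite mulr_ge0// ltW.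
have Cp : 0 < C by rewrite /C; lra.
exists C => // n w pn M kap W2 x n0 w1 [Q [QF QL Qp]] kap0 kap1 kapN ME MW xK.
set e := kap ^+ 4.
have e0 : 0 < e by exact: exprn_gt0.
have ee1 : e <= 1 by rewrite exprn_ile1// ltW.
have N0 : 0 < n%:R :> R by rewrite ltr0n.
have nu0 : 0 < kap ^+ 21 by exact: exprn_gt0.
have W20 : 0 <= W2 by apply: le_trans (MW 0%N); rewrite zsum0 mulr0.
have kk (j : nat) : kap ^+ j.+1 <= kap.
  by rewrite exprS ler_piMr ?(ltW kap0)// exprn_ile1// ltW.
have ek : e <= kap by exact: kk.
have kapn : kap != 0 by rewrite gt_eqF.
apply/ler_addgt0Pl => d d0; have d20 : 0 < d / 2 by rewrite divr_gt0.
have [J1 HJ1] := chain_smoothing n0 w1 QF QL Qp c0 th0 e0 ee1 nu0 xK ME MW d20.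
have Gz z : `|gauss_z c (kap ^+ 4) z| <= GB / e ^+ 4.
  have eT : e <= T by rewrite /T; have := t0; lra.
  apply: (le_trans (gauss_z_le c0 T0 e0 ee1 z (lexx e) eT)).
  by rewrite ler_piMr ?weight_le1//; apply: divr_ge0 => //; apply: exprn_ge0; exact: ltW.
have q0 y : 0 <= density n pn t y by exact: (density_ge0 Qp y t0).
have qQ y : density n pn t y <= 3 / theta ^+ 2.
  by rewrite tE; exact: (density_le n0 w1 QF QL Qp y th0).
have qs J : zsum J (density n pn t) <= n%:R.
  apply: le_trans (density_mass n0 w1 QF Qp J t0); apply: le_zsum => y _ _.
  by rewrite ler_peMl.
have qE J : n%:R * zsum J (fun y => (density n pn t (y + 1) - density n pn t y) ^+ 2)
    <= 4 / theta ^+ 6.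
  by rewrite tE; exact: (density_dirichlet n0 w1 QF QL Qp J th0).
have [J2 HJ2] := smoothing_at_point x n0 c0 kap0 q0 qQ qs qE Gz d20.
pose J := maxn J1 J2.
have J1J : (J1 <= J)%N by exact: leq_maxl.
have J2J : (J2 <= J)%N by exact: leq_maxr.
have {}HJ1 := HJ1 _ J1J; have {}HJ2 := HJ2 _ J2J.
rewrite -tE in HJ1; rewrite -/T -/GB -/Sc -/(density n pn t _) in HJ1 HJ2 *.
have HG : `|gauss c (t + e) x - gauss c t x| <= C1 * e.
  rewrite -[X in C1 * X](_ : t + e - t = e); last by ring.
  have tte : t <= t + e by rewrite lerDl ltW.
  apply: (@mean_value_le _ (fun s => gauss c s x) (fun s => gauss_t c s x)); first exact: tte.
  - by move=> s ts _; apply: derive_gauss_t; exact: lt_trans ts.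
  - move=> s ts se; apply: le_trans (gauss_t_le c0 T0 e10 e11 x _ _) _.
    + exact: le_trans e1t (ltW ts).
    + by rewrite (le_trans (ltW se))// lerD2l.
    + by rewrite ler_piMr ?weight_le1.
  - apply: derivable_within_continuous => s; rewrite in_itv /= => /andP[ts _].
    by have [] := derive_gauss_t c x (lt_le_trans t0 ts).
have e16 : e ^+ 4 = kap ^+ 16 by rewrite /e -exprM.
have HA : (4 * theta ^+ 3 * (2 * (c * (GB / e ^+ 4)) / n%:R) +
      4 * (Sc * (GB / e ^+ 4)) * (1 + 3 * theta) * (4 * kap ^+ 21 + W2 / (2 * kap ^+ 21))) * theta +
    Sc * (GB / e ^+ 4) / theta ^+ 3 * (1 + 3 * theta) * (4 * kap ^+ 21 + W2 / (2 * kap ^+ 21))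
    = C2 * kap ^+ 26 + C3 * (4 * kap ^+ 5 + kap ^- 37 * W2 / 2).
  rewrite e16 -kapN /C2 /C3; field; rewrite kapn gt_eqF//.
rewrite HA in HJ1.
have HB : (n%:R * kap)^-1 = kap ^+ 41.
  by rewrite invfM -kapN; field.
have HC : c * (GB / e ^+ 4) / n%:R = c * GB * kap ^+ 26.
  by rewrite e16 -kapN; field.
rewrite HB HC in HJ2.
have k26 : kap ^+ 26 <= kap by exact: kk.
have k5 : kap ^+ 5 <= kap by exact: kk.
have k41 : kap ^+ 41 <= kap by exact: kk.
have kW : 0 <= kap ^- 37 * W2 by rewrite mulr_ge0 ?invr_ge0 ?exprn_ge0 ?(ltW kap0).
have i1 := ler_wpM2l C10 ek.
have i2 := ler_wpM2l C20 k26.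
have i3 := ler_wpM2l C30 k5.
have i4 := ler_wpM2l cGB0 k26.
have i5 : C3 * (kap ^- 37 * W2) <= C * (kap ^- 37 * W2).
  by rewrite ler_wpM2r// /C; clear - C10 C20 C30 C40 cGB0; lra.
have i6 : 0 <= C3 * (kap ^- 37 * W2) by rewrite mulr_ge0.
have -> : C * (kap + kap ^- 37 * W2) = (1 + C1 + C2 + 4 * C3 + C4 + 1 + c * GB) * kap
   + C * (kap ^- 37 * W2) by rewrite /C; ring.
rewrite -/C4 in HJ2.
move: HJ1 HJ2 HG; rewrite !ler_norml => /andP[a1 a2] /andP[b1 b2] /andP[g1 g2].
clear - a1 a2 b1 b2 g1 g2 i1 i2 i3 i4 i5 i6 k41 kW kap0.
by apply/andP; split; lra.
Qed.

End deterministic_bound.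

(** * Fluctuations of the environment *)

(** The joint law of two independent variables is the product of their laws, so
    that expectations of products factor by Fubini-Tonelli. *)
Lemma independent_product d d' (T : measurableType d) (T' : measurableType d')
    (R : realType) (P : probability T R) (X Y : {mfun T >-> T'}) (f g : T' -> \bar R) :
  (forall B C, measurable B -> measurable C ->
     P (X @^-1` B `&` Y @^-1` C) = (P (X @^-1` B) * P (Y @^-1` C))%E) ->
  measurable_fun setT f -> measurable_fun setT g ->
  (forall v, (0 <= f v)%E) -> (forall v, (0 <= g v)%E) ->
  (\int[P]_w (f (X w) * g (Y w)) = \int[P]_w f (X w) * \int[P]_w g (Y w))%E.
Proof.
move=> XY mf mg f0 g0.
pose h (w : T) := (X w, Y w).
have mh : measurable_fun setT h.
  exact: (measurable_fun_pair (measurable_funP X) (measurable_funP Y)).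
pose hM := isMeasurableFun.Build _ _ _ _ _ mh.
pose Z : {mfun T >-> (T' * T')%type} := HB.pack h hM.
pose mx : probability T' R := distribution P X.
pose my : probability T' R := distribution P Y.
pose k (z : T' * T') : \bar R := (f z.1 * g z.2)%E.
have mk : measurable_fun setT k.
  apply: emeasurable_funM; apply: measurableT_comp => //.
have k0 z : (0 <= k z)%E by exact: mule_ge0.
transitivity (\int[mx \x my]_z k z)%E.
  transitivity (\int[distribution P Z]_z k z)%E.
    by rewrite ge0_integral_distribution.
  apply: eq_measure_integral => A mA _; apply/esym.
  by apply: product_measure_unique => // B C mB mC; exact: XY.
rewrite fubini_tonelli1// /fubini_F.
transitivity (\int[mx]_u (\int[my]_v g v * f u))%E.
  by apply: eq_integral => u _; rewrite /k /= ge0_integralZl// muleC.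
rewrite ge0_integralZl//; last by exact: integral_ge0.
by rewrite muleC !ge0_integral_distribution.
Qed.

Section trap_environment.
Context d (T : measurableType d) (R : realType) (Pr : probability T R).
Variables (alpha : R) (tau : int -> {RV Pr >-> R}).
Hypotheses (htau : is_trap_environment alpha tau) (alpha2 : 2 < alpha).

Lemma trap_law y (f : R -> \bar R) : measurable_fun setT f -> (forall v, (0 <= f v)%E) ->
  (\int[Pr]_w f (tau y w) = \int[Pr]_w f (tau 0 w))%E.
Proof.
move=> mf f0; have [_ hid _] := htau.
have := ge0_integral_distribution (tau y) mf f0.
have := ge0_integral_distribution (tau 0) mf f0.
rewrite /comp /= => <- <-.
by apply: eq_measure_integral => A mA _; exact: hid.
Qed.

(** The law of a trap charges no point below 1, because its tail tends to 1
    there; all traps are therefore at least 1 almost surely. *)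
Lemma trap_ge1 : {ae Pr, forall w, forall y, 1 <= tau y w}.
Proof.
have [_ hid htail] := htau.
pose A y := [set w | 1 <= tau y w].
have mI : measurable [set v : measurableTypeR R | 1 <= v].
  rewrite [X in measurable X](_ : _ = `[1, +oo[%classic); first exact: measurable_itv.
  by apply/seteqP; split => v /=; rewrite in_itv /= andbT.
have mA y : measurable (A y).
  exact: (@measurable_funPTI _ _ _ _ (tau y) _ mI).
have PA0 : Pr (A 0) = 1%E.
  apply/eqP; rewrite eq_le probability_le1//=.
  have Pf : Pr (A 0) \is a fin_num by exact: fin_num_measure.
  rewrite -(fineK Pf) lee_fin; set q := fine _.
  have qE u : 1 < u -> u `^ (- alpha) <= q.
    move=> u1; rewrite -lee_fin fineK// -htail//; apply: le_measure; rewrite ?inE//.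
      have mIu : measurable [set v : measurableTypeR R | u <= v].
        rewrite [X in measurable X](_ : _ = `[u, +oo[%classic); first exact: measurable_itv.
        by apply/seteqP; split => v /=; rewrite in_itv /= andbT.
      exact: (@measurable_funPTI _ _ _ _ (tau 0) _ mIu).
    by move=> w /= uw; exact: le_trans (ltW u1) uw.
  have q0 : 0 < q by apply: lt_le_trans (qE 2 _); rewrite ?powR_gt0// ltr1n.
  rewrite leNgt; apply/negP => q1.
  have a0 : 0 < alpha by apply: lt_trans alpha2.
  (* this level has tail [q^(1/2)], which exceeds [q] when [q < 1] *)
  have u1 : 1 < q `^ (- (2 * alpha)^-1).
    rewrite powRN invf_gt1 ?powR_gt0//.
    have : q `^ (2 * alpha)^-1 < 1 `^ (2 * alpha)^-1.
      by rewrite gt0_ltr_powR ?invr_gt0 ?mulr_gt0 ?nnegrE ?ler01 ?(ltW q0).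
    by rewrite powR1.
  have := qE _ u1; rewrite -powRrM.
  rewrite (_ : - (2 * alpha)^-1 * - alpha = 2^-1); last by field; rewrite gt_eqF.
  have sE : q `^ 2^-1 * q `^ 2^-1 = q.
    by rewrite -powRD ?gt_eqF ?implybT// (_ : 2^-1 + 2^-1 = 1) ?powRr1 ?(ltW q0)//; field.
  set s := q `^ 2^-1 in sE *; have s0 : 0 < s by exact: powR_gt0.
  rewrite -sE -[X in X <= _]mulr1 ler_pM2l// => s1.
  have : 1 * 1 <= s * s by apply: ler_pM.
  by rewrite sE; lra.
have PA y : Pr (~` A y) = 0%E.
  rewrite probability_setC// (_ : Pr (A y) = 1%E) ?subee//.
  by rewrite -PA0; exact: hid mI.
have H (f : nat -> int) : {ae Pr, forall w, forall k, 1 <= tau (f k) w}.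
  apply: ae_foralln => k; exists (~` A (f k)); split => //; last exact: PA.
  exact: measurableC.
by apply: filterS2 (H Posz) (H Negz) => w h1 h2 [k|k]; [exact: h1|exact: h2].
Qed.

Lemma dyadic_bound (v : R) : 1 <= v ->
  exists k : nat, 2 ^+ k <= v /\ v ^+ 2 <= 4 ^+ k.+1.
Proof.
move=> v1.
pose P m := v < 2 ^+ m.
have exP : exists m, P m.
  exists (Num.bound v); apply: (lt_trans (archi_boundP (le_trans ler01 v1))).
  by rewrite -natrX ltr_nat ltn_expl.
case: (ex_minnP exP) => -[|k] Pk mink.
  by move: Pk; rewrite /P expr0 => /lt_geF; rewrite v1.
exists k; split.
  by rewrite leNgt; apply/negP => /mink; rewrite ltnn.
rewrite (_ : 4 = 2 ^+ 2) -?exprM; last by rewrite expr2 -natrM.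
rewrite mulnC exprM lerXn2r ?nnegrE ?exprn_ge0//; [exact: le_trans v1|exact: ltW].
Qed.

(** The tail exponent exceeds 2, so summing over dyadic levels gives a finite
    second moment. *)
Lemma trap_second_moment : (\int[Pr]_w ((tau 0 w) ^+ 2)%:E < +oo)%E.
Proof.
have [_ _ htail] := htau.
pose I k := [set v : R | 2 ^+ k <= v].
pose f (k : nat) (w : T) : \bar R := (4 ^+ k.+1 * \1_(I k) (tau 0 w))%:E.
have mI k : measurable (I k : set (measurableTypeR R)).
  rewrite [X in measurable X](_ : _ = `[2 ^+ k, +oo[%classic); first exact: measurable_itv.
  by apply/seteqP; split => v /=; rewrite in_itv /= andbT.
have mindic k : measurable_fun setT (fun w => \1_(I k) (tau 0 w) : R).
  exact: (measurableT_comp (@measurable_indic _ (measurableTypeR R) R setT _ (mI k)) (@measurable_funP _ _ _ _ setT (tau 0))).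
have f0 k w : (0 <= f k w)%E by rewrite lee_fin mulr_ge0// exprn_ge0.
have mf k : measurable_fun setT (f k).
  by apply/measurable_EFinP; apply: measurable_funM.
have PI k : (\int[Pr]_w f k w = (4 ^+ k.+1)%:E * Pr (tau 0 @^-1` I k))%E.
  rewrite /f; under eq_integral do rewrite EFinM.
  rewrite ge0_integralZl//; last first.
    exact/measurable_EFinP/mindic.
  congr (_ * _)%E; rewrite -[X in Pr X]setIT -integral_indic//.
  exact: (@measurable_funPTI _ _ _ _ (tau 0) _ (mI k)).
pose r : R := 4 * 2 `^ (- alpha).
have r0 : 0 < r by rewrite mulr_gt0// powR_gt0.
have r1 : r < 1.
  have : 2 `^ (- alpha) < 2 `^ (- 2%:R) :> R.
    rewrite !powRN ltf_pV2 ?posrE ?powR_gt0//.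
    rewrite /powR gt_eqF// ltr_expR ltr_pM2r// ln_gt0 ?ltr1n//.
  by rewrite powR_invn// /r expr2; lra.
have fk k : (\int[Pr]_w f k w <= (4 * r ^+ k)%:E)%E.
  rewrite PI exprS !EFinM -muleA lee_pmul2l// ?lte_fin//.
  case: k => [|k]; first by rewrite !expr0 mul1e; apply: probability_le1; exact: (@measurable_funPTI _ _ _ _ (tau 0) _ (mI 0%N)).
  rewrite htail; last by rewrite exprn_egt1// ltr1n.
  rewrite -EFinM lee_fin /r exprMn ler_pM2l ?exprn_gt0//.
  by rewrite -[2 ^+ k.+1]powR_mulrn// -powRrM mulrC powRrM powR_mulrn// powR_ge0.
apply: (@le_lt_trans _ _ (\int[Pr]_w (\sum_(k <oo) f k w))%E).
  apply: ae_ge0_le_integral => //.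
  - by move=> w _; rewrite lee_fin sqr_ge0.
  - by apply/measurable_EFinP; exact: measurable_funX.
  - by move=> w _; exact: nneseries_ge0.
  - exact: ge0_emeasurable_sum.
  apply: filterS trap_ge1 => w /(_ 0) w1 _.
  have [k [k1 k2]] := dyadic_bound w1.
  apply: (@le_trans _ _ (f k w)).
    by rewrite lee_fin /f indicE mem_set// mulr1.
  apply: le_trans (nneseries_lim_ge k.+1 _) => //.
  by rewrite big_nat_recr//= leeDr// sume_ge0.
rewrite integral_nneseries//.
apply: (@le_lt_trans _ _ ((4 * (1 - r)^-1)%:E)); last exact: ltry.
apply: lime_le; first by apply: is_cvg_nneseries => k _ _; exact: integral_ge0.
apply: nearW => k.
apply: (@le_trans _ _ (\sum_(0 <= i < k) (4 * r ^+ i)%:E)%E).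
  by apply: lee_sum => i _; exact: fk.
rewrite sumEFin lee_fin; apply: geometric_le_lim => //.
by rewrite ger0_norm// ltW.
Qed.

Lemma trap_square_integrable y : (tau y : T -> R) \in Lfun Pr 2%:E.
Proof.
apply/andP; split; rewrite inE/=; first exact: measurable_funP.
rewrite /finite_norm unlock /Lnorm/= poweR_lty//.
have -> : (\int[Pr]_w ((`|tau y w| `^ 2)%:E) = \int[Pr]_w ((tau 0 w) ^+ 2)%:E)%E.
  rewrite -(@trap_law y (fun v => (v ^+ 2)%:E)).
  - by apply: eq_integral => w _; rewrite powR_mulrn// real_normK// num_real.
  - by apply/measurable_EFinP; exact: measurable_funX.
  - by move=> v; rewrite lee_fin sqr_ge0.
exact: trap_second_moment.
Qed.

Lemma trap_product x y : x != y ->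
  (\int[Pr]_w (`|tau x w * tau y w|)%:E =
   \int[Pr]_w (`|tau x w|)%:E * \int[Pr]_w (`|tau y w|)%:E)%E.
Proof.
move=> xy; have [hind _ _] := htau.
have mn : measurable_fun setT (fun v : R => (`|v|)%:E).
  by apply/measurable_EFinP; exact: normr_measurable.
under eq_integral do rewrite normrM EFinM.
apply: (@independent_product _ _ T _ R Pr (tau x) (tau y)
  (fun v => (`|v|)%:E) (fun v => (`|v|)%:E)) => // B C mB mC.
have := hind [:: x; y] (fun z => if z == x then B else C).
rewrite /= inE xy /= => /(_ isT).
rewrite !big_cons big_nil mule1 eqxx eq_sym (negbTE xy) => <-; last first.
  by move=> z; case: ifP.
congr (Pr _); apply/seteqP; split => w /=.
  move=> [Bw Cw] z /=; rewrite !inE => /orP[] /eqP ->; first by rewrite eqxx.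
  by rewrite eq_sym (negbTE xy).
move=> H; split.
  by have := H x; rewrite /= !inE eqxx; apply.
by have := H y; rewrite /= !inE eqxx orbT eq_sym (negbTE xy); apply.
Qed.

Lemma trap_expectation_norm y : ('E_Pr[tau y] = \int[Pr]_w (`|tau y w|)%:E)%E.
Proof.
rewrite unlock; apply: ae_eq_integral => //.
- exact/measurable_EFinP.
- by apply/measurable_EFinP; apply: measurableT_comp.
apply: filterS trap_ge1 => w H _; rewrite ger0_norm//.
exact: le_trans ler01 (H y).
Qed.

Lemma mean_trapE y : ('E_Pr[tau y] = 'E_Pr[tau 0%R])%E.
Proof.
rewrite !trap_expectation_norm (@trap_law y (fun v => (`|v|)%:E))//.
by apply/measurable_EFinP; exact: normr_measurable.
Qed.

Lemma trap_uncorrelated x y : x != y -> covariance Pr (tau x) (tau y) = 0%E.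
Proof.
move=> xy.
have Pf : Pr setT \is a fin_num by exact: fin_num_measure.
have L2 := trap_square_integrable.
have L1 z : (tau z : T -> R) \in Lfun Pr 1 by exact: (Lfun_subset12 Pf (L2 z)).
rewrite covarianceE//; last by exact: Lfun2_mul_Lfun1.
have -> : ('E_Pr[(tau x : T -> R) * (tau y : T -> R)] = 'E_Pr[tau x] * 'E_Pr[tau y])%E.
  rewrite !trap_expectation_norm -trap_product// unlock; apply: ae_eq_integral => //.
  - by apply/measurable_EFinP; exact: measurable_funM.
  - by apply/measurable_EFinP; apply: measurableT_comp => //; exact: measurable_funM.
  apply: filterS trap_ge1 => w H _; rewrite ger0_norm//.
  by rewrite mulr_ge0// (le_trans ler01 (H _)).
by rewrite subee// fin_numM// expectation_fin_num.
Qed.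

Definition trap_sum (s : seq int) (w : T) : R := \sum_(y <- s) tau y w.

Lemma trap_sumS x s : trap_sum (x :: s) = ((tau x : T -> R) \+ trap_sum s)%R.
Proof. by apply/funext => w; rewrite /trap_sum big_cons. Qed.

Lemma trap_sum_square_integrable s : trap_sum s \in Lfun Pr 2%:E.
Proof.
elim: s => [|x s IH].
  rewrite (_ : trap_sum [::] = cst 0); last by apply/funext => w; rewrite /trap_sum big_nil.
  exact: Lfun_cst.
rewrite trap_sumS; by rewrite rpredD ?lee1n//= => _; exact: trap_square_integrable.
Qed.

Lemma trap_sum_uncorrelated x s : x \notin s -> covariance Pr (tau x) (trap_sum s) = 0%E.
Proof.
elim: s => [_|y s IH].
  rewrite (_ : trap_sum [::] = cst 0); last by apply/funext => w; rewrite /trap_sum big_nil.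
  exact: covariance_cst_r.
rewrite inE negb_or => /andP[xy xs].
rewrite trap_sumS covarianceDr ?trap_square_integrable ?trap_sum_square_integrable//.
by rewrite IH// trap_uncorrelated// adde0.
Qed.

Lemma trap_varianceE y : ('V_Pr[tau y] = 'V_Pr[tau 0%R])%E.
Proof.
rewrite !varianceE ?trap_square_integrable// mean_trapE; congr (_ - _)%E.
rewrite unlock; apply: (@trap_law y (fun v => (v ^+ 2)%:E)).
  by apply/measurable_EFinP; exact: measurable_funX.
by move=> v; rewrite lee_fin sqr_ge0.
Qed.

Definition trap_variance : R := fine ('V_Pr[tau 0%R])%E.

Lemma trap_variance_ge0 : 0 <= trap_variance.
Proof. by rewrite fine_ge0// variance_ge0. Qed.

Lemma trap_sum_variance s : uniq s ->
  ('V_Pr[trap_sum s] = ((size s)%:R * trap_variance)%:E)%E.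
Proof.
elim: s => [_|x s IH /= /andP[xs us]].
  rewrite (_ : trap_sum [::] = cst 0); last by apply/funext => w; rewrite /trap_sum big_nil.
  by rewrite variance_cst mul0r.
rewrite trap_sumS varianceD ?trap_square_integrable ?trap_sum_square_integrable//.
rewrite trap_sum_uncorrelated// mule0 adde0 IH// trap_varianceE.
rewrite -[X in (X + _)%E]fineK ?variance_fin_num ?trap_square_integrable//.
by rewrite -EFinD -natr1 mulrDl mul1r addrC.
Qed.

Notation c := (mean_trap tau).

Lemma trap_integrable y : (tau y : T -> R) \in Lfun Pr 1.
Proof.
have Pf : Pr setT \is a fin_num by exact: fin_num_measure.
exact: (Lfun_subset12 Pf (trap_square_integrable y)).
Qed.

Lemma mean_trapK y : ('E_Pr[tau y] = c%:E)%E.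
Proof. by rewrite mean_trapE /mean_trap fineK// expectation_fin_num// trap_integrable. Qed.

Lemma mean_trap_ge1 : 1 <= c.
Proof.
rewrite -lee_fin -(mean_trapK 0) trap_expectation_norm.
rewrite -[X in (X <= _)%E](@probability_setT _ _ _ Pr) -[X in (X <= _)%E]mul1e.
rewrite -integral_cst//; apply: ae_ge0_le_integral => //.
  by apply/measurable_EFinP; apply: measurableT_comp.
apply: filterS trap_ge1 => w H _; rewrite lee_fin (le_trans (H 0))//.
exact: ler_norm.
Qed.

Lemma trap_sum_mean s : ('E_Pr[trap_sum s] = ((size s)%:R * c)%:E)%E.
Proof.
have Pf : Pr setT \is a fin_num by exact: fin_num_measure.
elim: s => [|x s IH].
  rewrite (_ : trap_sum [::] = cst 0); last by apply/funext => w; rewrite /trap_sum big_nil.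
  by rewrite expectation_cst mul0r.
rewrite trap_sumS expectationD ?trap_integrable//.
  by rewrite IH mean_trapK -EFinD/= -[in RHS]natr1 mulrDl mul1r addrC.
exact: (Lfun_subset12 Pf (trap_sum_square_integrable s)).
Qed.

(** The signs are such that the same increment identity holds on both sides of
    the origin. *)
Definition fluctuation (w : T) (y : int) : R :=
  match y with
  | Posz k => \sum_(0 <= j < k) (c - tau (Posz j) w)
  | Negz k => - \sum_(0 <= j < k.+1) (c - tau (Negz j) w)
  end.

Lemma fluctuation_increment w y : fluctuation w (y + 1) - fluctuation w y = c - tau y w.
Proof.
clear htau alpha2; case: y => k.
  rewrite -PoszD addn1 /= big_nat_recr//=; ring.
case: k => [|k].
  rewrite (_ : Negz 0 + 1 = Posz 0); last by lia.
  by rewrite /fluctuation big_geq// big_nat1; ring.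
rewrite (_ : Negz k.+1 + 1 = Negz k); last by lia.
by rewrite /fluctuation [in X in _ - X]big_nat_recr//=; ring.
Qed.

Lemma centred_sum_second_moment (f : nat -> int) k : injective f ->
  (\int[Pr]_w ((\sum_(0 <= j < k) (c - tau (f j) w)) ^+ 2)%:E =
   (k%:R * trap_variance)%:E)%E.
Proof.
move=> finj; pose s := map f (index_iota 0 k).
have us : uniq s by rewrite map_inj_uniq// iota_uniq.
have sk : size s = k by rewrite size_map size_iota subn0.
have := trap_sum_variance us; rewrite sk => <-.
rewrite /variance covariance.unlock trap_sum_mean sk expectation.unlock; apply: eq_integral => w _; congr (_%:E).
rewrite fctE /= /trap_sum big_map -expr2 -sqrrN; congr (_ ^+ 2).
by rewrite sumrB sumr_const_nat subn0 opprB mulr_natl.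
Qed.

Lemma fluctuation_second_moment y :
  (\int[Pr]_w (fluctuation w y ^+ 2)%:E = (`|y|%:R * trap_variance)%:E)%E.
Proof.
case: y => k; rewrite /fluctuation.
  by rewrite centred_sum_second_moment// => i j [].
under eq_integral do rewrite sqrrN.
by rewrite (@centred_sum_second_moment Negz)// => i j [].
Qed.

Lemma measurable_fluctuation y : measurable_fun setT (fun w => fluctuation w y).
Proof.
have H (f : nat -> int) k :
    measurable_fun setT (fun w => \sum_(0 <= j < k) (c - tau (f j) w)).
  by apply: measurable_sum => j; apply: measurable_funB.
case: y => k; first exact: H.
by apply: measurableT_comp => //; exact: H.
Qed.

Variable n : nat.
Hypothesis n0 : (0 < n)%N.
Notation N := (n%:R : R).
Notation pt := (lattice_point n).

Let term w y : R := N^-1 * ((N^-1 * fluctuation w y) ^+ 2 * weight (pt y)).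

(** The supremum over windows of the weighted energy required by the
    deterministic bound, as a series and hence as a measurable function of the
    environment. *)
Definition fluctuation_energy (w : T) : \bar R :=
  (\sum_(k <oo) (term w (Posz k) + term w (Negz k))%:E)%E.

Let term_ge0 w y : 0 <= term w y.
Proof.
apply: mulr_ge0; first by rewrite invr_ge0.
by apply: mulr_ge0; [exact: sqr_ge0|exact/ltW/weight_gt0].
Qed.

Let measurable_term y : measurable_fun setT (fun w => term w y).
Proof.
apply: measurable_funM => //; apply: measurable_funM => //; apply: measurable_funX.
by apply: measurable_funM => //; exact: measurable_fluctuation.
Qed.

Let measurable_pair k :
  measurable_fun setT (fun w => (term w (Posz k) + term w (Negz k))%:E).
Proof. by apply/measurable_EFinP; apply: measurable_funD; exact: measurable_term. Qed.

Lemma fluctuation_energy_ge0 w : (0 <= fluctuation_energy w)%E.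
Proof. by apply: nneseries_ge0 => k _ _; rewrite lee_fin addr_ge0. Qed.

Lemma measurable_fluctuation_energy : measurable_fun setT fluctuation_energy.
Proof.
apply: ge0_emeasurable_sum => k; last by [].
by move=> w _ _; rewrite lee_fin addr_ge0.
Qed.

Lemma fluctuation_energy_ge w J :
  ((N^-1 * zsum J (fun y => (N^-1 * fluctuation w y) ^+ 2 * weight (pt y)))%:E
     <= fluctuation_energy w)%E.
Proof.
apply: le_trans (nneseries_lim_ge J _); last by move=> k _ _; rewrite lee_fin addr_ge0.
rewrite sumEFin lee_fin -zsumZ /zsum big_mkord.
by apply: ler_sum => k _.
Qed.

(** The partial sums grow diffusively, so that the rescaled fluctuations have
    mean energy of order 1/n. *)
Lemma fluctuation_energy_mean :
  (\int[Pr]_w fluctuation_energy w <= (8 * trap_variance / N)%:E)%E.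
Proof.
have V0 := trap_variance_ge0.
have N0 : 0 < N by rewrite ltr0n.
rewrite integral_nneseries//; last by move=> k w _; rewrite lee_fin addr_ge0.
have E y : (\int[Pr]_w (term w y)%:E =
    (N^-1 * (trap_variance / N * (`|pt y| * weight (pt y))))%:E)%E.
  transitivity (\int[Pr]_w ((N^-1 * (N^-1 ^+ 2 * weight (pt y)))%:E
      * (fluctuation w y ^+ 2)%:E))%E.
    by apply: eq_integral => w _; rewrite -EFinM /term; congr (_%:E); ring.
  rewrite ge0_integralZl//; last 3 first.
  - by apply/measurable_EFinP; apply: measurable_funX; exact: measurable_fluctuation.
  - by move=> w _; rewrite lee_fin sqr_ge0.
  - rewrite lee_fin; apply: mulr_ge0; first by rewrite invr_ge0.
    by apply: mulr_ge0; [exact: sqr_ge0|exact/ltW/weight_gt0].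
  rewrite fluctuation_second_moment -EFinM; congr (_%:E).
  rewrite /lattice_point normrM normfV (ger0_norm (ltW N0)) -intr_norm.
  by rewrite -[`|y|%R]/(Posz `|y|%N); field; rewrite gt_eqF.
apply: lime_le; first by apply: is_cvg_nneseries => k _ _;
  apply: integral_ge0 => w _; rewrite lee_fin addr_ge0.
apply: nearW => J.
have -> : (\sum_(0 <= k < J) \int[Pr]_w (term w (Posz k) + term w (Negz k))%:E =
    (trap_variance / N * (N^-1 * zsum J (fun y => `|pt y| * weight (pt y))))%:E)%E.
  rewrite -zsumZ -zsumZ /zsum -sumEFin big_mkord; apply: eq_bigr => k _.
  under eq_integral do rewrite EFinD.
  rewrite ge0_integralD// ?E; last 4 first.
  - by move=> w _; rewrite lee_fin.
  - by apply/measurable_EFinP; exact: measurable_term.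
  - by move=> w _; rewrite lee_fin.
  - by apply/measurable_EFinP; exact: measurable_term.
  by rewrite -EFinD; congr (_%:E); ring.
rewrite lee_fin (_ : 8 * trap_variance / N = trap_variance / N * 8); last by ring.
by apply: ler_wpM2l; [apply: divr_ge0 => //; exact: ltW|exact: weight_moment_sum].
Qed.

End trap_environment.

(** * The mean error *)

Import HBNNSimple.

(** The integral of a nonnegative function is a supremum over simple minorants,
    so that a measurable majorant controls it even without measurability. *)
Lemma ae_le_integral_majorant d (T : measurableType d) (R : realType)
    (mu : {measure set T -> \bar R}) (f g : T -> \bar R) :
  (forall x, 0 <= f x)%E -> (forall x, 0 <= g x)%E -> measurable_fun setT g ->
  {ae mu, forall x, (f x <= g x)%E} -> (\int[mu]_x f x <= \int[mu]_x g x)%E.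
Proof.
move=> f0 g0 mg fg; rewrite ge0_integralTE//.
apply: ge_ereal_sup => _ [h hf <-].
rewrite -integralT_nnsfun; apply: ae_ge0_le_integral => //.
- by move=> x _; rewrite lee_fin.
- by apply/measurable_EFinP; exact: measurable_funP.
- by apply: filterS fg => x fgx _; exact: le_trans (hf x) fgx.
Qed.

Section main_estimate.
Context d (T : measurableType d) (R : realType) (Pr : probability T R).
Variables (alpha : R) (tau : int -> {RV Pr >-> R}).
Variables (p : R -> R -> R -> R) (pn : nat -> T -> R -> R -> R -> R).
Hypotheses (htau : is_trap_environment alpha tau)
  (hp : is_limit_heat_kernel (mean_trap tau) p)
  (hpn : {ae Pr, forall w : T, forall n : nat, (0 < n)%N ->
            is_btm_heat_kernel n (fun x => tau x w) (pn n w)}).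

(** On an environment of finite energy the deterministic bound applies. The mean
    energy is of order [1/n = kap^42], so that the noise contributes at most
    [kap^5] on average and the smoothing error [kap] prevails. *)
Lemma sup_error_mean t K : 2 < alpha -> 0 < t -> 0 < K ->
  exists2 C : R, 0 < C & forall n : nat, (0 < n)%N ->
    (\int[Pr]_w sup_error t K n p (pn n w) <= (C * n%:R `^ (- (1 / 42)))%:E)%E.
Proof.
move=> alpha2 t0 K0.
have c0 : 0 < mean_trap tau by exact: lt_le_trans ltr01 (mean_trap_ge1 htau alpha2).
have [Q [QF QL Qp]] := hp.
have pE x : p t 0 x = gauss (mean_trap tau) t x by exact: (limit_kernel_gauss c0 QF QL Qp).
have [C C0 HC] := pointwise_error K c0 t0.
pose V := trap_variance tau; have V0 : 0 <= V := trap_variance_ge0 tau.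
exists (C * (1 + 8 * V)).
  by rewrite mulr_gt0// ltr_pwDl// mulr_ge0.
move=> n n0.
have N0 : 0 < n%:R :> R by rewrite ltr0n.
have N1 : 1 <= n%:R :> R by rewrite ler1n.
pose kap : R := n%:R `^ (- (1 / 42)).
have kap0 : 0 < kap by exact: powR_gt0.
have kap1 : kap <= 1.
  by rewrite -[leRHS](powRr0 n%:R); apply: ler_powR => //; lra.
have kapN : kap ^+ 42 = n%:R^-1.
  rewrite -powR_mulrn ?(ltW kap0)// -powRrM -[RHS]powR_inv1 ?(ltW N0)//.
  by congr (_ `^ _); field.
have k37 : 0 <= C * kap ^- 37.
  by rewrite mulr_ge0 ?invr_ge0 ?exprn_ge0 ?(ltW kap0) ?(ltW C0).
pose W := fluctuation_energy tau n.
have W0 w : (0 <= W w)%E by exact: fluctuation_energy_ge0.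
have mW : measurable_fun setT W by exact: measurable_fluctuation_energy.
pose g w : \bar R := ((C * kap)%:E + (C * kap ^- 37)%:E * W w)%E.
apply: (@le_trans _ _ (\int[Pr]_w g w)%E); last first.
  rewrite /g ge0_integralD//; last 3 first.
  - by move=> w _; rewrite lee_fin mulr_ge0// ltW.
  - by move=> w _; rewrite mule_ge0// lee_fin.
  - exact: measurable_funeM.
  have -> : (\int[Pr]__ (C * kap)%:E = (C * kap)%:E)%E.
    rewrite integral_cst// -[RHS]mule1; congr (_ * _)%E; exact: probability_setT.
  rewrite ge0_integralZl//.
  apply: (@le_trans _ _ ((C * kap)%:E + (C * kap ^- 37)%:E * (8 * V / n%:R)%:E)%E).
    rewrite leeD2l// lee_wpmul2l ?lee_fin//.
    exact: (fluctuation_energy_mean htau alpha2 n0).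
  rewrite -EFinM -EFinD lee_fin -/kap -kapN.
  have -> : C * kap + C * kap ^- 37 * (8 * V * kap ^+ 42)
      = C * (kap + 8 * V * kap ^+ 5) by field; rewrite gt_eqF.
  rewrite -[leRHS]mulrA ler_pM2l// [leRHS]mulrDl mul1r lerD2l ler_wpM2l ?mulr_ge0//.
  by rewrite exprS ler_piMr ?(ltW kap0)// exprn_ile1// ltW.
apply: ae_le_integral_majorant.
- move=> w; apply: le_trans (ereal_sup_ubound _); last first.
    by exists 0 => //=; rewrite normr0 ltW.
  by rewrite lee_fin.
- by move=> w; rewrite /g adde_ge0 ?mule_ge0 ?lee_fin// mulr_ge0// ltW.
- by apply: emeasurable_funD => //; exact: measurable_funeM.
apply: filterS2 hpn (trap_ge1 htau alpha2) => w /(_ n n0) Hw w1.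
apply: ge_ereal_sup => _ [x /= xK <-].
rewrite pE /g.
case EW : (W w) => [W2| |]; last by have := W0 w; rewrite EW.
  rewrite -EFinM -EFinD lee_fin -mulrA -mulrDr.
  apply: (HC n (fun y => tau y w) (pn n w) (fun y => n%:R^-1 * fluctuation tau w y)) => //.
    by move=> y; rewrite -mulrBr fluctuation_increment.
  by move=> J; rewrite -lee_fin -EW; exact: fluctuation_energy_ge.
rewrite gt0_muley ?addey ?leey// lte_fin mulr_gt0// invr_gt0 exprn_gt0//.
Qed.

Lemma sup_error_mean_rate t K E : 2 < alpha -> 0 < t -> 0 < K -> E <= 1 / 42 ->
  exists2 C : R, 0 < C & forall n : nat, (0 < n)%N ->
    (\int[Pr]_w sup_error t K n p (pn n w) <= (C * n%:R `^ (- E))%:E)%E.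
Proof.
move=> alpha2 t0 K0 E42; have [C C0 HC] := sup_error_mean alpha2 t0 K0.
exists C => // n n0; apply: (le_trans (HC n n0)); rewrite lee_fin ler_pM2l//.
by apply: ler_powR; [rewrite ler1n|rewrite lerN2].
Qed.

End main_estimate.

Theorem theorem8p24 (d : measure_display) (T : measurableType d) (R : realType)
    (Pr : probability T R) (alpha : R) (tau : int -> {RV Pr >-> R})
    (p : R -> R -> R -> R) (pn : nat -> T -> R -> R -> R -> R)
    (halpha : 1 < alpha)
    (htau : is_trap_environment alpha tau)
    (hp : is_limit_heat_kernel (mean_trap tau) p)
    (hpn : {ae Pr, forall w : T, forall n : nat, (0 < n)%N ->
             is_btm_heat_kernel n (fun x => tau x w) (pn n w)}) :
  (forall kappa : R, 1 / 2 < kappa -> kappa <= 1 ->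
     kappa / (3 * kappa + 4) + 5 * kappa + 7 / 2 < alpha ->
     forall t K E : R, 0 < t -> 0 < K ->
       E < kappa / (2 * (3 * kappa + 4) * (kappa + 2)) ->
       exists2 C : R, 0 < C & forall n : nat, (0 < n)%N ->
         (\int[Pr]_w sup_error t K n p (pn n w) <= (C * n%:R `^ (- E))%:E)%E)
  /\
  (121 / 14 < alpha ->
     forall t K E : R, 0 < t -> 0 < K -> E < 1 / 42 ->
       exists2 C : R, 0 < C & forall n : nat, (0 < n)%N ->
         (\int[Pr]_w sup_error t K n p (pn n w) <= (C * n%:R `^ (- E))%:E)%E).
Proof.
split=> [kappa kappa_gt kappa_le alpha_gt|alpha_gt] t K E t0 K0 EE; last first.
  by apply: (sup_error_mean_rate htau hp hpn) => //; lra.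
have d1 : 0 < 3 * kappa + 4 by lra.
apply: (sup_error_mean_rate htau hp hpn) => //.
  have : 0 <= kappa / (3 * kappa + 4) by rewrite divr_ge0//; lra.
  lra.
apply: le_trans (ltW EE) _.
rewrite ler_pdivrMr; last by rewrite !mulr_gt0//; lra.
(* 3 kappa^2 + 10 kappa + 8 - 21 kappa factors, with 1 as a root *)
have : 0 <= (1 - kappa) * (8 - 3 * kappa) by apply: mulr_ge0; lra.
by nra.
Qed.
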